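(* Let $\mathbf{K}$ be an algebraically closed field. Let $G\subset \mathrm{Jonq}(\mathbf{K})$ be a subgroup isomorphic to $\mathbf{Z}^2$. Suppose that the action of $G$ on the base of the rational fibration is faithful, i.e. the homomorphism $G\to \mathrm{PGL}_2(\mathbf{K})$ recording the action on the $x$-coordinate is injective. Then $G$ is an elliptic subgroup.
   Context: $\mathrm{Cr}_2(\mathbf{K})$ is the group of birational transformations of $\mathbb{P}^2_{\mathbf{K}}$. In a fixed affine chart $(x,y)$, $\mathrm{Jonq}(\mathbf{K})\cong \mathrm{PGL}_2(\mathbf{K})\ltimes \mathrm{PGL}_2(\mathbf{K}(x))$ is the subgroup of all transformations $(x,y)\dashrightarrow \left(\frac{ax+b}{cx+d},\frac{A(x)y+B(x)}{C(x)y+D(x)}\right)$ with $\begin{pmatrix}a&b\\c&d\end{pmatrix}\in\mathrm{PGL}_2(\mathbf{K})$ and $\begin{pmatrix}A&B\\C&D\end{pmatrix}\in\mathrm{PGL}_2(\mathbf{K}(x))$; these preserve the rational fibration $(x,y)\mapsto x$. An element $f\in\mathrm{Cr}_2(\mathbf{K})$ is elliptic if the sequence $(\deg f^n)_{n\in\mathbf{N}}$ is bounded (equivalently, $f$ is birationally conjugate to an automorphism of a projective rational surface a positive iterate of which lies in the identity component of the automorphism group). A subgroup $G\subset\mathrm{Cr}_2(\mathbf{K})$ is an elliptic (sub)group if every element of $G$ is elliptic and $G$ is conjugate (by a single birational map) to a group of automorphisms of a projective rational surface. *)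

(* Defs.v *)
From HB Require Import structures.
From mathcomp Require Import all_boot all_order all_algebra.
From mathcomp Require Import generic_quotient ring_quotient fraction.
From mathcomp Require Import mpoly boolp ring.

Set Implicit Arguments.
Unset Strict Implicit.
Unset Printing Implicit Defensive.

Import GRing.Theory.
Local Open Scope ring_scope.
Local Open Scope quotient_scope.

(* Closed integral subschemes of P^n correspond to the homogeneous prime      *)
(* ideals of K[X_0, ..., X_n] that do not contain all the variables.          *)
Record projvar (K : closedFieldType) (n : nat) := ProjVar {
  pv_ideal : prime_idealr {mpoly K[n.+1]};
  pv_homog : forall p d, p \in (pv_ideal : pred _) ->
               pihomog mdeg d p \in (pv_ideal : pred _);
  pv_relevant : exists i, 'X_i \notin (pv_ideal : pred _)
}.

Definition vanishes (K : closedFieldType) n (X : projvar K n)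
  (p : {mpoly K[n.+1]}) : bool := p \in (pv_ideal X : pred _).

(* Points are given by nonzero vectors of homogeneous coordinates.            *)
Definition on_projvar (K : closedFieldType) n (X : projvar K n)
    (v : 'I_n.+1 -> K) : Prop :=
  (exists i, v i != 0) /\ (forall p, vanishes X p -> p.@[v] = 0).

Section RationalMaps.
Variable K : closedFieldType.
Implicit Types n m k : nat.

(* A rational map from X in P^n to P^m is given by m + 1 forms of the same    *)
(* degree, not all vanishing on X; it has values in Y when the equations of   *)
(* Y pull back to equations of X.                                             *)
Definition ratmap n m (X : projvar K n) (Y : projvar K m)
    (F : m.+1.-tuple {mpoly K[n.+1]}) : Prop :=
  [/\ exists d, forall i, tnth F i \is d.-homog,
      exists i, ~~ vanishes X (tnth F i)
    & forall p, vanishes Y p -> vanishes X (p \mPo F)].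

(* Equality, as rational maps on X, of the maps with homogeneous components   *)
(* F and G.                                                                   *)
Definition same_map n m (X : projvar K n)
    (F G : m.+1.-tuple {mpoly K[n.+1]}) : Prop :=
  [/\ exists i, ~~ vanishes X (tnth F i),
      exists i, ~~ vanishes X (tnth G i)
    & forall i j,
        vanishes X (tnth F i * tnth G j - tnth F j * tnth G i)].

Definition comp_tuple n m k (G : k.+1.-tuple {mpoly K[m.+1]})
    (F : m.+1.-tuple {mpoly K[n.+1]}) : k.+1.-tuple {mpoly K[n.+1]} :=
  [tuple tnth G i \mPo F | i < k.+1].

Definition id_tuple n : n.+1.-tuple {mpoly K[n.+1]} :=
  [tuple 'X_i | i < n.+1].

Record bir_rep n m (X : projvar K n) (Y : projvar K m) := BirRep {
  fwd : m.+1.-tuple {mpoly K[n.+1]};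
  bwd : n.+1.-tuple {mpoly K[m.+1]};
  fwdP : ratmap X Y fwd;
  bwdP : ratmap Y X bwd;
  fwdK : same_map X (comp_tuple bwd fwd) (id_tuple n);
  bwdK : same_map Y (comp_tuple fwd bwd) (id_tuple m)
}.

HB.instance Definition _ n m X Y := gen_eqMixin (@bir_rep n m X Y).
HB.instance Definition _ n m X Y := gen_choiceMixin (@bir_rep n m X Y).

Lemma vanishesM n (X : projvar K n) p q :
  vanishes X (p * q) = vanishes X p || vanishes X q.
Proof. exact: prime_idealrM. Qed.

Lemma vanishes0 n (X : projvar K n) : vanishes X 0.
Proof. exact: idealr0. Qed.

Lemma vanishesMl n (X : projvar K n) p q :
  vanishes X q -> vanishes X (p * q).
Proof. by rewrite vanishesM => ->; rewrite orbT. Qed.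

Lemma vanishesD n (X : projvar K n) p q :
  vanishes X p -> vanishes X q -> vanishes X (p + q).
Proof. exact: rpredD. Qed.

Lemma vanishesN n (X : projvar K n) p : vanishes X (- p) = vanishes X p.
Proof. exact: rpredN. Qed.

Lemma vanishesXn n (X : projvar K n) p d :
  ~~ vanishes X p -> ~~ vanishes X (p ^+ d).
Proof.
move=> Np; elim: d => [|d IHd]; last by rewrite exprS vanishesM negb_or Np.
by rewrite expr0 /vanishes idealr1.
Qed.

Lemma vanishes_cross n (X : projvar K n) (a b c d : {mpoly K[n.+1]}) :
  vanishes X (a - b) -> vanishes X (c - d) -> vanishes X (a * c - b * d).
Proof.
move=> ab cd; have ->: a * c - b * d = c * (a - b) + b * (c - d).
  by rewrite !mulrBr [c * a]mulrC [c * b]mulrC addrA subrK.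
by apply: vanishesD; apply: vanishesMl.
Qed.

Lemma vanishes_expB n (X : projvar K n) (a b : {mpoly K[n.+1]}) d :
  vanishes X (a - b) -> vanishes X (a ^+ d - b ^+ d).
Proof.
move=> ab; elim: d => [|d IHd]; first by rewrite subrr vanishes0.
by rewrite !exprS; apply: vanishes_cross.
Qed.

Lemma vanishes_prodB n (X : projvar K n) (I : finType)
    (F G : I -> {mpoly K[n.+1]}) :
  (forall i, vanishes X (F i - G i)) ->
  vanishes X (\prod_i F i - \prod_i G i).
Proof.
move=> FG; apply: (big_ind2 (fun a b => vanishes X (a - b))) => //.
  by rewrite subrr vanishes0.
by move=> *; apply: vanishes_cross.
Qed.

Lemma vanishes_compB n m (X : projvar K n)
    (F G : m.+1.-tuple {mpoly K[n.+1]}) p :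
  (forall i, vanishes X (tnth F i - tnth G i)) ->
  vanishes X ((p \mPo F) - (p \mPo G)).
Proof.
move=> FG; rewrite !comp_mpolyE -sumrB.
apply: (big_ind (fun a => vanishes X a)); first exact: vanishes0.
  by move=> a b; apply: vanishesD.
move=> mo _; rewrite -scalerBr -mul_mpolyC; apply: vanishesMl.
by apply: vanishes_prodB => i; apply: vanishes_expB.
Qed.

Lemma comp_homogM n m (F : m.-tuple {mpoly K[n]}) (p : {mpoly K[m]}) d c :
  p \is d.-homog ->
  p \mPo [tuple c * tnth F i | i < m] = c ^+ d * (p \mPo F).
Proof.
move=> /dhomogP hp; rewrite !comp_mpolyE mulr_sumr; apply: eq_big_seq => mo mop.
rewrite -scalerAr; congr (_ *: _).
under eq_bigr => i _ do rewrite tnth_mktuple exprMn.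
by rewrite big_split /= prodrXr -mdegE (hp _ mop).
Qed.

Lemma comp_dhomog n m (F : m.-tuple {mpoly K[n]}) (p : {mpoly K[m]}) d e :
  p \is d.-homog -> (forall i, tnth F i \is e.-homog) ->
  p \mPo F \is (e * d).-homog.
Proof.
move=> /dhomogP hp hF; rewrite comp_mpolyE big_seq; apply: rpred_sum => mo mop.
apply: rpredZ; have -> : d = \sum_i mo i by rewrite -mdegE -(hp _ mop).
rewrite big_distrr /=.
elim/big_rec2: _ => [|i x y _ hy]; first exact: dhomog1.
by apply: dhomogM => //; apply: dhomogMn.
Qed.

Lemma comp_mpolyA n m k (G : m.-tuple {mpoly K[k]}) (F : n.-tuple {mpoly K[m]})
    (p : {mpoly K[n]}) :
  (p \mPo F) \mPo G = p \mPo [tuple tnth F i \mPo G | i < n].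
Proof.
rewrite [p \mPo F]comp_mpolyE [RHS]comp_mpolyE raddf_sum /=; apply: eq_bigr => mo _.
rewrite comp_mpolyZ rmorph_prod; congr (_ *: _); apply: eq_bigr => i _.
by rewrite rmorphXn /= tnth_mktuple.
Qed.

Lemma comp_tupleA n m k l (H : l.+1.-tuple {mpoly K[k.+1]})
    (G : k.+1.-tuple {mpoly K[m.+1]}) (F : m.+1.-tuple {mpoly K[n.+1]}) :
  comp_tuple H (comp_tuple G F) = comp_tuple (comp_tuple H G) F.
Proof. by apply: eq_from_tnth => i; rewrite !tnth_mktuple comp_mpolyA. Qed.

Lemma comp_id_tuplel n m (F : m.+1.-tuple {mpoly K[n.+1]}) :
  comp_tuple (id_tuple m) F = F.
Proof.
apply: eq_from_tnth => i.
by rewrite !tnth_mktuple comp_mpolyXU -tnth_nth.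
Qed.

Lemma comp_id_tupler n m (F : m.+1.-tuple {mpoly K[n.+1]}) :
  comp_tuple F (id_tuple n) = F.
Proof. by apply: eq_from_tnth => i; rewrite !tnth_mktuple comp_mpoly_id. Qed.

Lemma same_map_refl n m (X : projvar K n) (F : m.+1.-tuple {mpoly K[n.+1]}) :
  (exists i, ~~ vanishes X (tnth F i)) -> same_map X F F.
Proof. by move=> NF; split=> // i j; rewrite mulrC subrr vanishes0. Qed.

Lemma same_map_sym n m (X : projvar K n) (F G : m.+1.-tuple {mpoly K[n.+1]}) :
  same_map X F G -> same_map X G F.
Proof.
case=> NF NG FG; split=> // i j; have := FG j i.
by rewrite [tnth F j * _]mulrC [tnth F i * _]mulrC.
Qed.

Lemma same_map_trans n m (X : projvar K n)
    (F G H : m.+1.-tuple {mpoly K[n.+1]}) :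
  same_map X F G -> same_map X G H -> same_map X F H.
Proof.
case=> NF [k NG] FG [_ NH GH]; split=> // i j.
suff: vanishes X (tnth G k * (tnth F i * tnth H j - tnth F j * tnth H i)).
  by rewrite vanishesM (negPf NG).
set a := tnth F; set b := tnth G; set c := tnth H.
have ->: b k * (a i * c j - a j * c i) =
    c j * (a i * b k - a k * b i) - c i * (a j * b k - a k * b j)
    + a k * (b i * c j - b j * c i).
  ring.
by repeat apply: vanishesD; rewrite ?vanishesN; apply: vanishesMl; rewrite ?FG.
Qed.

Lemma vanishes_comp_proj n m (X : projvar K n)
    (A B : m.+1.-tuple {mpoly K[n.+1]}) p d j :
  (forall i, vanishes X (tnth A i * tnth B j - tnth A j * tnth B i)) ->
  p \is d.-homog ->
  vanishes X (tnth B j ^+ d * (p \mPo A) - tnth A j ^+ d * (p \mPo B)).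
Proof.
move=> AB hp; rewrite -!(comp_homogM _ _ hp); apply: vanishes_compB => i.
by rewrite !tnth_mktuple mulrC.
Qed.

(* A birational map is dominant.                                              *)
Lemma rep_dominant n m (X : projvar K n) (Y : projvar K m)
    (f : bir_rep X Y) p d :
  p \is d.-homog -> vanishes X (p \mPo fwd f) -> vanishes Y p.
Proof.
move=> hp /(let: And3 _ _ h := bwdP f in h _); rewrite comp_mpolyA => fp.
case: (bwdK f) => -[j Nj] _ eqj.
have := vanishes_comp_proj (eqj^~ j) hp; rewrite comp_mpoly_id => h.
have : vanishes Y (tnth (comp_tuple (fwd f) (bwd f)) j ^+ d * p).
  rewrite -vanishesN -[- _](addKr (tnth (id_tuple m) j ^+ d *
    (p \mPo comp_tuple (fwd f) (bwd f)))).
  by apply: vanishesD => //; rewrite vanishesN vanishesMl.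
by rewrite vanishesM (negPf (vanishesXn _ Nj)).
Qed.

Lemma ratmap_comp n m k (X : projvar K n) (Y : projvar K m) (Z : projvar K k)
    (f : bir_rep X Y) G :
  ratmap Y Z G -> ratmap X Z (comp_tuple G (fwd f)).
Proof.
case=> -[d hG] [j Nj] GZ; case: (fwdP f) => -[e hF] _ FY; split.
- by exists (e * d)%N => i; rewrite tnth_mktuple; apply: comp_dhomog.
- exists j; rewrite tnth_mktuple; apply: contra Nj; exact: rep_dominant (hG j).
- by move=> p /GZ /FY; rewrite comp_mpolyA.
Qed.

Lemma same_map_precomp n m k (X : projvar K n) (Y : projvar K m)
    (f : bir_rep X Y) (A B : k.+1.-tuple {mpoly K[m.+1]}) d e :
  (forall i, tnth A i \is d.-homog) -> (forall i, tnth B i \is e.-homog) ->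
  same_map Y A B -> same_map X (comp_tuple A (fwd f)) (comp_tuple B (fwd f)).
Proof.
move=> hA hB [[i Ai] [j Bj] AB]; case: (fwdP f) => _ _ FY; split.
- exists i; rewrite tnth_mktuple; apply: contra Ai; exact: rep_dominant (hA i).
- exists j; rewrite tnth_mktuple; apply: contra Bj; exact: rep_dominant (hB j).
- by move=> i' j'; rewrite !tnth_mktuple -!rmorphM -rmorphB; apply/FY/AB.
Qed.

Lemma same_map_postcomp n m k (X : projvar K n)
    (A B : m.+1.-tuple {mpoly K[n.+1]}) (H : k.+1.-tuple {mpoly K[m.+1]}) d :
  (forall i, tnth H i \is d.-homog) -> same_map X A B ->
  (exists i, ~~ vanishes X (tnth (comp_tuple H B) i)) ->
  same_map X (comp_tuple H A) (comp_tuple H B).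
Proof.
move=> hH [NA [j Bj] AB] [k0 Nk].
have AH i : vanishes X (tnth B j ^+ d * (tnth H i \mPo A)
                        - tnth A j ^+ d * (tnth H i \mPo B)).
  by apply: vanishes_comp_proj (hH i) => i'; apply: AB.
have Aj : ~~ vanishes X (tnth A j).
  case: NA => i Ai; apply/negP => Aj.
  have : vanishes X (tnth A i * tnth B j).
    rewrite -[_ * _](subrK (tnth A j * tnth B i)).
    by apply: vanishesD => //; rewrite mulrC; apply: vanishesMl.
  by rewrite vanishesM (negPf Ai) (negPf Bj).
split; last 1 first.
- move=> i l; rewrite !tnth_mktuple.
  set a := _ \mPo A; set b := _ \mPo B; set c := _ \mPo A; set e := _ \mPo B.
  suff: vanishes X (tnth B j ^+ d * (a * b - c * e)).
    by rewrite vanishesM (negPf (vanishesXn _ Bj)).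
  have -> : tnth B j ^+ d * (a * b - c * e) =
     b * (tnth B j ^+ d * a - tnth A j ^+ d * e)
     - e * (tnth B j ^+ d * c - tnth A j ^+ d * b) by ring.
  by apply: vanishesD; rewrite ?vanishesN; apply: vanishesMl; apply: AH.
- exists k0; rewrite tnth_mktuple; apply/negP => HA.
  move: Nk; rewrite tnth_mktuple => /negP; apply.
  have : vanishes X (tnth A j ^+ d * (tnth H k0 \mPo B)).
    rewrite -vanishesN -[- _](addKr (tnth B j ^+ d * (tnth H k0 \mPo A))).
    by apply: vanishesD => //; rewrite vanishesN vanishesMl.
  by rewrite vanishesM (negPf (vanishesXn _ Aj)).
- by exists k0.
Qed.

Lemma ratmap_id n (X : projvar K n) : ratmap X X (id_tuple n).
Proof.
split; first by exists 1%N => i; rewrite tnth_mktuple dhomogX /= mdeg1.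
  by case: (pv_relevant X) => i Xi; exists i; rewrite tnth_mktuple.
by move=> p; rewrite comp_mpoly_id.
Qed.

Lemma rep_id_subproof n (X : projvar K n) :
  same_map X (comp_tuple (id_tuple n) (id_tuple n)) (id_tuple n).
Proof.
by rewrite comp_id_tuplel; apply: same_map_refl; case: (ratmap_id X).
Qed.

Definition rep_id n (X : projvar K n) : bir_rep X X :=
  BirRep (ratmap_id X) (ratmap_id X) (rep_id_subproof X) (rep_id_subproof X).

Definition rep_inv n m (X : projvar K n) (Y : projvar K m) (f : bir_rep X Y) :
    bir_rep Y X :=
  BirRep (bwdP f) (fwdP f) (bwdK f) (fwdK f).

Lemma rep_comp_subproof n m k (X : projvar K n) (Y : projvar K m)
    (Z : projvar K k) (g : bir_rep Y Z) (f : bir_rep X Y) :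
  same_map X
    (comp_tuple (comp_tuple (bwd f) (bwd g)) (comp_tuple (fwd g) (fwd f)))
    (id_tuple n).
Proof.
rewrite -comp_tupleA [comp_tuple (bwd g) _]comp_tupleA.
case: (fwdP f) (bwdP f) (fwdK f) => -[d hf] _ _ [[e hf'] _ _] fK.
apply: same_map_trans fK; apply: same_map_postcomp hf' _ _; last first.
  by case: (fwdK f).
case: (fwdP g) (bwdP g) => -[d' hg] _ _ [[e' hg'] _ _].
rewrite -[X in same_map _ _ X]comp_id_tuplel.
apply: (@same_map_precomp _ _ _ _ _ _ _ _ (d' * e') 1) (fwdK g) => i.
  by rewrite tnth_mktuple; apply: comp_dhomog.
by rewrite tnth_mktuple dhomogX /= mdeg1.
Qed.

Definition rep_comp n m k (X : projvar K n) (Y : projvar K m) (Z : projvar K k)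
    (g : bir_rep Y Z) (f : bir_rep X Y) : bir_rep X Z :=
  BirRep (ratmap_comp f (fwdP g)) (ratmap_comp (rep_inv g) (bwdP f))
    (rep_comp_subproof g f) (rep_comp_subproof (rep_inv f) (rep_inv g)).

Definition rep_equiv n m (X : projvar K n) (Y : projvar K m) :
    rel (bir_rep X Y) :=
  fun f g => `[< same_map X (fwd f) (fwd g) >].

Lemma rep_equiv_refl n m X Y : reflexive (@rep_equiv n m X Y).
Proof. by move=> f; apply/asboolP/same_map_refl; case: (fwdP f). Qed.

Lemma rep_equiv_sym n m X Y : ssrbool.symmetric (@rep_equiv n m X Y).
Proof. by move=> f g; apply/asboolP/asboolP => /same_map_sym. Qed.

Lemma rep_equiv_trans n m X Y : transitive (@rep_equiv n m X Y).
Proof.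
by move=> g f h /asboolP fg /asboolP gh; apply/asboolP/(same_map_trans fg).
Qed.

Canonical rep_equiv_rel n m X Y := EquivRel (@rep_equiv n m X Y)
  (@rep_equiv_refl n m X Y) (@rep_equiv_sym n m X Y) (@rep_equiv_trans n m X Y).

Definition bir n m (X : projvar K n) (Y : projvar K m) :=
  {eq_quot (@rep_equiv n m X Y)}.

HB.instance Definition _ n m X Y := Choice.on (@bir n m X Y).
HB.instance Definition _ n m X Y := EqQuotient.on (@bir n m X Y).


Definition bir_id n (X : projvar K n) : bir X X := \pi_(bir X X) (rep_id X).

Definition bir_inv n m (X : projvar K n) (Y : projvar K m) (f : bir X Y) :
  bir Y X := \pi_(bir Y X) (rep_inv (repr f)).

Definition bir_comp n m k (X : projvar K n) (Y : projvar K m)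
    (Z : projvar K k) (g : bir Y Z) (f : bir X Y) : bir X Z :=
  \pi_(bir X Z) (rep_comp (repr g) (repr f)).

Lemma pi_birP n m (X : projvar K n) (Y : projvar K m) (f g : bir_rep X Y) :
  same_map X (fwd f) (fwd g) <-> \pi_(bir X Y) f = \pi_(bir X Y) g.
Proof.
by split=> [fg|/eqmodP/asboolP //]; apply/eqmodP/asboolP.
Qed.

Lemma pi_fwd n m (X : projvar K n) (Y : projvar K m) (f g : bir_rep X Y) :
  fwd f = fwd g -> \pi_(bir X Y) f = \pi_(bir X Y) g.
Proof.
move=> fg; apply/pi_birP; rewrite fg; apply: same_map_refl.
by case: (fwdP g).
Qed.

Lemma repr_pi n m (X : projvar K n) (Y : projvar K m) (f : bir_rep X Y) :
  same_map X (fwd (repr (\pi_(bir X Y) f))) (fwd f).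
Proof. by apply/pi_birP; rewrite reprK. Qed.

Lemma rep_comp_eq n m k (X : projvar K n) (Y : projvar K m) (Z : projvar K k)
    (g g' : bir_rep Y Z) (f f' : bir_rep X Y) :
  same_map Y (fwd g) (fwd g') -> same_map X (fwd f) (fwd f') ->
  same_map X (fwd (rep_comp g f)) (fwd (rep_comp g' f')).
Proof.
move=> gg' ff'; case: (fwdP g) (fwdP g') => -[d hg] _ _ [[d' hg'] _ _].
apply: same_map_trans (same_map_precomp f hg hg' gg') _.
apply: (same_map_postcomp hg' ff').
by case: (fwdP (rep_comp g' f')).
Qed.

Lemma pi_comp n m k (X : projvar K n) (Y : projvar K m) (Z : projvar K k)
    (g : bir_rep Y Z) (f : bir_rep X Y) :
  bir_comp (\pi_(bir Y Z) g) (\pi_(bir X Y) f) = \pi_(bir X Z) (rep_comp g f).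
Proof. by apply/pi_birP/rep_comp_eq; apply: repr_pi. Qed.

Lemma bir_compA n m k l (X : projvar K n) (Y : projvar K m) (Z : projvar K k)
    (W : projvar K l) (h : bir Z W) (g : bir Y Z) (f : bir X Y) :
  bir_comp h (bir_comp g f) = bir_comp (bir_comp h g) f.
Proof.
rewrite -[h]reprK -[g]reprK -[f]reprK.
move: (repr h) (repr g) (repr f) => h' g' f'.
rewrite (pi_comp g' f') (pi_comp h' g') !pi_comp; apply: pi_fwd.
exact: comp_tupleA.
Qed.

Lemma bir_comp1f n m (X : projvar K n) (Y : projvar K m) (f : bir X Y) :
  bir_comp (bir_id Y) f = f.
Proof.
rewrite -[f in LHS]reprK pi_comp -[RHS]reprK; apply: pi_fwd.
exact: comp_id_tuplel.
Qed.

Lemma bir_compf1 n m (X : projvar K n) (Y : projvar K m) (f : bir X Y) :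
  bir_comp f (bir_id X) = f.
Proof.
rewrite -[f in LHS]reprK pi_comp -[RHS]reprK; apply: pi_fwd.
exact: comp_id_tupler.
Qed.

Lemma bir_compVf n m (X : projvar K n) (Y : projvar K m) (f : bir X Y) :
  bir_comp (bir_inv f) f = bir_id X.
Proof. by rewrite -[f in bir_comp _ f]reprK pi_comp; apply/pi_birP/fwdK. Qed.

Lemma bir_compfV n m (X : projvar K n) (Y : projvar K m) (f : bir X Y) :
  bir_comp f (bir_inv f) = bir_id Y.
Proof. by rewrite -[f in bir_comp f _]reprK pi_comp; apply/pi_birP/bwdK. Qed.

HB.instance Definition _ n (X : projvar K n) := isGroup.Build (bir X X)
  (@bir_compA _ _ _ _ X X X X) (@bir_comp1f _ _ X X) (@bir_compf1 _ _ X X)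
  (@bir_compVf _ _ X X) (@bir_compfV _ _ X X).

Definition represents n m (X : projvar K n) (Y : projvar K m) (f : bir X Y)
    (F : m.+1.-tuple {mpoly K[n.+1]}) : Prop :=
  exists2 r : bir_rep X Y, \pi_(bir X Y) r = f & fwd r = F.

Definition regular_at n m (X : projvar K n) (Y : projvar K m) (f : bir X Y)
    (v : 'I_n.+1 -> K) : Prop :=
  exists2 F, represents f F & exists i, (tnth F i).@[v] != 0.

(* Since K is algebraically closed, the domain of definition, which is open,  *)
(* is X as soon as it contains all the K-points.                              *)
Definition regular n m (X : projvar K n) (Y : projvar K m) (f : bir X Y) :=
  forall v, on_projvar X v -> regular_at f v.

Definition is_automorphism n (X : projvar K n) (f : bir X X) : Prop :=
  regular f /\ regular (f^-1)%g.

End RationalMaps.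

Section ProjectiveSpace.
Variables (K : closedFieldType) (n : nat).

Definition zero_ideal : {pred {mpoly K[n.+1]}} := pred1 0.

Lemma zero_ideal_closed : idealr_closed zero_ideal.
Proof.
split; rewrite ?unfold_in ?eqxx ?oner_eq0 // => a u v.
by rewrite !unfold_in => /eqP-> /eqP->; rewrite mulr0 addr0.
Qed.

Lemma zero_ideal_prime : prime_idealr_closed zero_ideal.
Proof. by move=> u v; rewrite !unfold_in mulf_eq0. Qed.

HB.instance Definition _ :=
  isIdealr.Build {mpoly K[n.+1]} zero_ideal zero_ideal_closed.
HB.instance Definition _ :=
  isPrimeIdealrClosed.Build {mpoly K[n.+1]} zero_ideal zero_ideal_prime.

Lemma zero_ideal_homog p d :
  p \in (zero_ideal : pred _) -> pihomog mdeg d p \in (zero_ideal : pred _).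
Proof. by rewrite !unfold_in => /eqP->; rewrite pihomog0. Qed.

Lemma zero_ideal_relevant :
  exists i : 'I_n.+1, 'X_i \notin (zero_ideal : pred {mpoly K[n.+1]}).
Proof.
exists ord0; rewrite unfold_in; apply/eqP => /(congr1 (mcoeff U_(ord0))).
by rewrite mcoeffX eqxx mcoeff0 => /eqP; rewrite oner_eq0.
Qed.

Definition projspace : projvar K n :=
  @ProjVar K n zero_ideal zero_ideal_homog zero_ideal_relevant.

End ProjectiveSpace.

Section Cremona.
Variable K : closedFieldType.

Notation P2 := (projspace K 2).

Definition Cr2 := bir P2 P2.
HB.instance Definition _ := Group.on Cr2.

(* The degree of f is the common degree of homogeneous components without     *)
(* common factor.                                                             *)
Definition has_degree (f : Cr2) (d : nat) : Prop :=
  exists F, [/\ represents f F, forall i, tnth F i \is d.-homog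
    & forall h : {mpoly K[3]},
        (forall i, exists q, tnth F i = q * h) -> (msize h <= 1)%N].

Definition elliptic (f : Cr2) : Prop :=
  exists D, forall k, exists2 d, has_degree (f ^+ k)%g d & (d <= D)%N.

(* A projective variety birational to P^2 is a projective rational surface.   *)
Definition elliptic_subgroup (G : {pred Cr2}) : Prop :=
  (forall f, f \in G -> elliptic f) /\
  exists n (X : projvar K n) (phi : bir P2 X),
    forall f, f \in G ->
      is_automorphism (bir_comp (bir_comp phi f) (bir_inv phi)).

(* The function fields K(x) and K(x,y) = K(x)(y).                             *)
Definition Kx := {fraction {poly K}}.
HB.instance Definition _ := GRing.Field.on Kx.
Definition Kxy := {fraction {poly Kx}}.
HB.instance Definition _ := GRing.Field.on Kxy.

Definition constx : K -> Kx := @tofrac _ \o polyC.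
HB.instance Definition _ := GRing.RMorphism.copy constx (@tofrac _ \o polyC).
Definition constxy : Kx -> Kxy := @tofrac _ \o polyC.
HB.instance Definition _ := GRing.RMorphism.copy constxy (@tofrac _ \o polyC).
Definition xcoord : Kx := tofrac 'X.
Definition ycoord : Kxy := tofrac 'X.

(* Restriction to the affine chart (x, y) |-> [x : y : 1].                    *)
Definition in_chart (p : {mpoly K[3]}) : Kxy :=
  mmap (constxy \o constx) (tnth [tuple constxy xcoord; ycoord; 1]) p.

Definition mobius (L : fieldType) (M : 'M[L]_2) (z : L) : L :=
  (M 0 0 * z + M 0 1) / (M 1 0 * z + M 1 1).

(* f is (x, y) |-> ((ax + b) / (cx + d), (Ay + B) / (Cy + D)), with M and N   *)
(* the matrices of coefficients.                                              *)
Definition jonq_form (f : Cr2) (M : 'M[K]_2) (N : 'M[Kx]_2) : Prop :=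
  exists F, [/\ represents f F,
    in_chart (tnth F 0) / in_chart (tnth F 2)
      = constxy (mobius (map_mx constx M) xcoord)
  & in_chart (tnth F 1) / in_chart (tnth F 2)
      = mobius (map_mx constxy N) ycoord].

Definition Jonq (f : Cr2) : Prop :=
  exists M N, [/\ M \in unitmx, N \in unitmx & jonq_form f M N].

(* M represents the image of f under Jonq -> PGL_2(K).                        *)
Definition base_action (f : Cr2) (M : 'M[K]_2) : Prop :=
  M \in unitmx /\ exists2 N, N \in unitmx & jonq_form f M N.

Definition PGL_eq (M N : 'M[K]_2) : Prop := exists2 c, c != 0 & N = c *: M.

Definition faithful_on_base (G : {pred Cr2}) : Prop :=
  forall f g M N, f \in G -> g \in G ->
    base_action f M -> base_action g N -> PGL_eq M N -> f = g.

Definition isomorphic_Z2 (G : {pred Cr2}) : Prop :=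
  exists rho : int * int -> Cr2,
    [/\ injective rho, {morph rho : u v / u + v >-> (u * v)%g}
      & forall f, f \in G <-> exists u, rho u = f].

End Cremona.

(* Main.v *)
(* Let f and g generate G. After a coordinate change on the base,             *)
(* faithfulness forces f and g to act on it by two independent scalings or    *)
(* two independent translations u, v, and on the fibres by matrices A, B over *)
(* K[x] such that (A o v) B and (B o u) A are proportional. The fibre matrix  *)
(* X of f^n g^m moves the standard vertex of the Bruhat-Tits tree of PGL_2 at *)
(* each place of K(x) by a bounded amount. At a place with free orbit this    *)
(* holds because Z^2 has one end: any two points of the orbit outside the     *)
(* poles are joined by a path avoiding the poles, along which nothing moves.  *)
(* At a fixed place the leading coefficients of the commutation relation,     *)
(* compared with those of its determinant, would give a multiplicative or     *)
(* additive relation between u and v unless the leading matrix is nilpotent,  *)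
(* and then a change of lattice reduces the degree. Hence the quadratic forms *)
(* in the fibre variable that are transforms under G of finitely many given   *)
(* ones have a common denominator and bounded degree. They span a finite-     *)
(* dimensional space on which G acts projectively, and a basis of it maps P^2 *)
(* birationally onto a surface on which G acts by linear maps.                *)
Require Import Defs.
From HB Require Import structures.
From mathcomp Require Import all_boot all_order all_algebra.
From mathcomp Require Import generic_quotient ring_quotient fraction.
From mathcomp Require Import mpoly boolp.
From mathcomp Require Import zify ring.

Set Implicit Arguments.
Unset Strict Implicit.
Unset Printing Implicit Defensive.

Import Order.TTheory GRing.Theory Num.Theory.
Local Open Scope ring_scope.
Local Open Scope quotient_scope.

(** * Two by two matrices *)

(** The theorem reduces to finding a finite-dimensional linear system on the plane that both
    generators of G preserve. By faithfulness the base maps of the generators are independent in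
    PGL_2(K), which forces their matrices to commute ([indep_powers_commute]). In one base
    coordinate they are then two independent scalings or two independent translations
    ([indep_powers_normal_form]). Apart from infinity, and 0 in the case of scalings, every place
    has a free orbit.

    The fibre parts form a cocycle [coc2] of 2x2 matrices over K[x]. Its displacement [disp] is
    bounded uniformly over the iterates, and at a free place it vanishes when the place and its
    image avoid a finite set. For free orbits ([disp_finite_places]) this is a matter of choosing
    paths in a grid with finitely many singular points. At infinity ([bounded_infinity]) the degree
    defect of the determinant is lowered until the matrix, or the one of the squared map, fixes a
    vertex. The obstruction would be a singular leading matrix with a nonzero eigenvalue, and
    [no_translation] rules it out: comparing the two top coefficients in the commutation relation
    ([asymp_degree]) would relate the two base maps. The place 0 is carried to infinity by reversing
    polynomials ([bounded_zero]).

    Translated into divisibility, these bounds give the transforms of quadratic forms in the fibre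
    variable a common denominator and a bounded degree ([common_denominator]), so they span a
    finite-dimensional space ([invariant_span]). A basis, homogenised, maps the plane to a
    projective space. The map is birational onto its image because the coordinates are recovered
    linearly ([coord_matrix]), and the generators act through it by linear maps ([quad_linear_on]).
    Linear maps have no base points and keep the degrees bounded, whence [elliptic_criterion]. *)

Section Matrix2.
Variable R : comNzRingType.
Implicit Types A B : 'M[R]_2.

Lemma lift2E (j : 'I_1) : (lift 0 j = 1 :> 'I_2) * (lift 1 j = 0 :> 'I_2).
Proof. by split; apply: val_inj; rewrite /= (ord1 j). Qed.

Lemma mulmx2E A B i j : (A *m B) i j = A i 0 * B 0 j + A i 1 * B 1 j.
Proof. by rewrite mxE !big_ord_recl big_ord0 addr0 lift2E. Qed.

Lemma ord2P (i : 'I_2) : i = 0 \/ i = 1.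
Proof. by case: i => [[|[|//]] ?]; [left|right]; apply: val_inj. Qed.

Lemma mx2P A B : A 0 0 = B 0 0 -> A 0 1 = B 0 1 -> A 1 0 = B 1 0 ->
  A 1 1 = B 1 1 -> A = B.
Proof.
by move=> *; apply/matrixP => i j; case: (ord2P i) => ->; case: (ord2P j) => ->.
Qed.

Lemma det2E A : \det A = A 0 0 * A 1 1 - A 0 1 * A 1 0.
Proof.
rewrite (expand_det_row _ 0) !big_ord_recl big_ord0 addr0 /cofactor !det_mx11 !mxE.
by rewrite expr0 expr1 mul1r mulN1r mulrN !lift2E.
Qed.

Lemma adj2E A :
  [/\ \adj A 0 0 = A 1 1, \adj A 0 1 = - A 0 1,
      \adj A 1 0 = - A 1 0 & \adj A 1 1 = A 0 0].
Proof.
split; rewrite mxE /cofactor det_mx11 !mxE ?lift2E /=;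
  by rewrite ?expr0 ?expr1 ?expr2 ?mulrNN ?mulN1r ?mul1r.
Qed.

Lemma det_adj2 A : \det (\adj A) = \det A.
Proof. by have [e1 e2 e3 e4] := adj2E A; rewrite !det2E e1 e2 e3 e4; ring. Qed.

End Matrix2.

(** * Displacements at a place *)

Section Displacement.
Variable K : closedFieldType.
Notation P := {poly K}.
Implicit Types (A B C : 'M[P]_2) (u : P).

Definition act u A : 'M[P]_2 := map_mx (comp_poly u) A.

Lemma actM u A B : act u (A *m B) = act u A *m act u B.
Proof. exact: map_mxM. Qed.

Lemma actE u A i j : act u A i j = A i j \Po u.
Proof. by rewrite mxE. Qed.

Lemma det_act u A : \det (act u A) = \det A \Po u.
Proof. by rewrite /act det_map_mx. Qed.

Lemma act_comp u v A : act u (act v A) = act (v \Po u) A.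
Proof. by apply/matrixP => i j; rewrite !actE comp_polyA. Qed.

Lemma actX A : act 'X A = A.
Proof. by apply/matrixP => i j; rewrite !actE comp_polyXr. Qed.

Lemma act1 u : act u 1%:M = 1%:M.
Proof. exact: map_mx1. Qed.

Lemma actZ u p A : act u (p *: A) = (p \Po u) *: act u A.
Proof. by rewrite /act map_mxZ. Qed.

Lemma act_adj u A : act u (\adj A) = \adj (act u A).
Proof. by rewrite /act map_mx_adj. Qed.

(** Equality in PGL_2(K(x)), with denominators cleared so that everything stays over K[x]. *)
Definition prop A B := exists p q, [/\ p != 0, q != 0 & p *: A = q *: B].

Lemma prop_refl A : prop A A.
Proof. by exists 1, 1; rewrite oner_neq0. Qed.

Lemma prop_sym A B : prop A B -> prop B A.
Proof. by case=> p [q [? ? ?]]; exists q, p. Qed.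

Lemma prop_trans A B C : prop A B -> prop B C -> prop A C.
Proof.
case=> p [q [p0 q0 AB]] [p' [q' [p'0 q'0 BC]]]; exists (p' * p), (q * q').
by rewrite !mulf_neq0 // -!scalerA AB -BC !scalerA mulrC.
Qed.

Lemma prop_mul A B C D : prop A B -> prop C D -> prop (A *m C) (B *m D).
Proof.
case=> p [q [p0 q0 AB]] [p' [q' [p'0 q'0 CD]]]; exists (p * p'), (q * q').
rewrite !mulf_neq0 //; split=> //.
have E (a b : P) X Y : (a * b) *: (X *m Y) = (a *: X) *m (b *: Y).
  by rewrite -scalemxAl -scalemxAr scalerA.
by rewrite !E AB CD.
Qed.

Lemma prop_mull A B C : prop A B -> prop (C *m A) (C *m B).
Proof. by move=> AB; apply: prop_mul AB; apply: prop_refl. Qed.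

Lemma prop_mulr A B C : prop A B -> prop (A *m C) (B *m C).
Proof. by move=> AB; apply: prop_mul AB _; apply: prop_refl. Qed.

Lemma prop_act u A B : size u = 2 -> prop A B -> prop (act u A) (act u B).
Proof.
move=> su [p [q [p0 q0 AB]]]; exists (p \Po u), (q \Po u).
by rewrite !comp_poly2_eq0 // -!actZ AB.
Qed.

Lemma prop_scale p A : p != 0 -> prop (p *: A) A.
Proof. by move=> p0; exists 1, p; rewrite oner_neq0 scale1r. Qed.

(** Integer values leave no room for an infinite value at 0, so both axioms, the second being the
    ultrametric inequality, are restricted to nonzero arguments. *)
Definition valuation (v : P -> int) :=
  (forall p q, p != 0 -> q != 0 -> v (p * q) = v p + v q) /\
  (forall p q, p != 0 -> q != 0 -> p + q != 0 ->
     v p <= v (p + q) \/ v q <= v (p + q)).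

Lemma valuationN v p : valuation v -> p != 0 -> v (- p) = v p.
Proof.
move=> [vM _] p0; have N1 : (-1 : P) != 0 by rewrite oppr_eq0 oner_neq0.
have := vM _ _ N1 N1; rewrite mulrNN mulr1 => v1.
have := vM _ _ (oner_neq0 P) (oner_neq0 P); rewrite mulr1 => v1'.
rewrite -mulN1r vM //; move: (v (-1)) (v 1) (v p) v1 v1' => a b c; lia.
Qed.

(* A moves the standard vertex of the Bruhat-Tits tree of PGL_2 at the place  *)
(* v by at most N. Only nonzero entries are used, as v 0 is a junk value.     *)
Definition disp v A (N : int) := forall i j k l,
  A i j != 0 -> A k l != 0 -> v (\det A) <= v (A i j) + v (A k l) + N.

Lemma disp_le v A M N : disp v A M -> M <= N -> disp v A N.
Proof. by move=> h MN i j k l a b; apply: le_trans (h _ _ _ _ a b) _; rewrite lerD2l. Qed.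

Lemma entry_mul v A B i j : valuation v -> (A *m B) i j != 0 ->
  exists k, [/\ A i k != 0, B k j != 0 & v (A i k) + v (B k j) <= v ((A *m B) i j)].
Proof.
move=> [vM vD]; rewrite mulmx2E.
have [/eqP|n0] := eqVneq (A i 0 * B 0 j) 0.
  move=> e; rewrite (eqP e) add0r mulf_eq0 negb_or => /andP[a b].
  by exists 1; rewrite vM.
have [/eqP|n1] := eqVneq (A i 1 * B 1 j) 0.
  move=> e; rewrite (eqP e) addr0 mulf_eq0 negb_or => /andP[a b].
  by exists 0; rewrite vM.
move=> n; have := vD _ _ n0 n1 n.
move: n0 n1; rewrite !mulf_eq0 !negb_or => /andP[a b] /andP[c d].
by rewrite (vM _ _ a b) (vM _ _ c d) => -[]; [exists 0|exists 1].
Qed.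

(** Triangle inequality in the tree: a nonzero entry of the product has at least the valuation of
    some product of two nonzero entries, and valuations of determinants add. *)
Lemma disp_mul v A B M N : valuation v -> \det A != 0 -> \det B != 0 ->
  disp v A M -> disp v B N -> disp v (A *m B) (M + N).
Proof.
move=> hv A0 B0 hA hB i j k l /(entry_mul hv)[a [a1 a2 a3]] /(entry_mul hv)[b [b1 b2 b3]].
rewrite det_mulmx (hv.1 _ _ A0 B0).
apply: le_trans (lerD (hA _ _ _ _ a1 b1) (hB _ _ _ _ a2 b2)) _.
by rewrite addrACA lerD2r addrACA; apply: lerD a3 b3.
Qed.

Lemma disp_scale v A p N : valuation v -> p != 0 -> \det A != 0 ->
  disp v (p *: A) N <-> disp v A N.
Proof.
move=> hv p0 A0; have vM := hv.1.
have E (x d a b : int) : (x + x + d <= x + a + (x + b) + N) = (d <= a + b + N).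
  by rewrite [x + a + _]addrACA -[X in _ <= X]addrA lerD2l.
split=> h i j k l a b; have := h i j k l; rewrite detZ !mxE expr2.
  by rewrite !vM ?mulf_neq0 // => /(_ isT isT); rewrite E.
move: a b; rewrite !mxE !mulf_eq0 !negb_or => /andP[_ a] /andP[_ b].
by rewrite !vM ?mulf_neq0 // => /(_ a b); rewrite E.
Qed.

Lemma prop_det A B : prop A B -> \det A != 0 -> \det B != 0.
Proof.
case=> p [q [p0 q0 AB]] A0; have : \det (p *: A) != 0.
  by rewrite detZ mulf_neq0 ?expf_neq0.
by rewrite AB detZ mulf_eq0 negb_or => /andP[].
Qed.

Lemma disp_prop v A B N : valuation v -> \det A != 0 -> prop A B ->
  disp v A N -> disp v B N.
Proof.
move=> hv A0 AB; have B0 := prop_det AB A0; case: AB => p [q [p0 q0 AB]].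
by rewrite -(disp_scale _ hv p0 A0) AB disp_scale.
Qed.

(** The adjugate stands for the inverse. In size two it has the same entries up to sign and
    position, and the same determinant. *)
Lemma disp_adj v A N : valuation v -> disp v A N -> disp v (\adj A) N.
Proof.
move=> hv hA; have [e1 e2 e3 e4] := adj2E A.
have E i j : \adj A i j != 0 ->
   exists k l, A k l != 0 /\ v (\adj A i j) = v (A k l).
  case: (ord2P i) => ->; case: (ord2P j) => ->; rewrite ?e1 ?e2 ?e3 ?e4 ?oppr_eq0 => n0.
  - by exists 1, 1.
  - by exists 0, 1; rewrite valuationN.
  - by exists 1, 0; rewrite valuationN.
  - by exists 0, 0.
move=> i j k l /E[a [b [ab ->]]] /E[c [d [cd ->]]]; rewrite det_adj2.
exact: hA.
Qed.

Lemma disp_cancell v A B M N : valuation v -> \det A != 0 -> \det B != 0 ->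
  disp v (A *m B) M -> disp v A N -> disp v B (N + M).
Proof.
move=> hv A0 B0 hAB hA; apply: (@disp_prop v (\adj A *m (A *m B))) => //.
- by rewrite !det_mulmx det_adj2 !mulf_neq0.
- by rewrite mulmxA mul_adj_mx mul_scalar_mx; apply: prop_scale.
- by apply: disp_mul => //; rewrite ?det_mulmx ?det_adj2 ?mulf_neq0 //; apply: disp_adj.
Qed.

Lemma disp_cancelr v A B M N : valuation v -> \det A != 0 -> \det B != 0 ->
  disp v (A *m B) M -> disp v B N -> disp v A (M + N).
Proof.
move=> hv A0 B0 hAB hB; apply: (@disp_prop v ((A *m B) *m \adj B)) => //.
- by rewrite !det_mulmx det_adj2 !mulf_neq0.
- by rewrite -mulmxA mul_mx_adj mul_mx_scalar; apply: prop_scale.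
- by apply: disp_mul => //; rewrite ?det_mulmx ?det_adj2 ?mulf_neq0 //; apply: disp_adj.
Qed.

End Displacement.

(** * Valuations of K(x) and the cocycle of the iterates *)

Section Places.
Variable K : closedFieldType.
Notation P := {poly K}.
Implicit Types (A B : 'M[P]_2) (u p q : P).

(** Minus the degree of a nonzero polynomial, as [size] exceeds the degree by one. *)
Definition vinf p : int := 1 - (size p)%:Z.
Definition vmup (b : K) p : int := (mup b p)%:Z.

Lemma vinf_valuation : valuation vinf.
Proof.
split=> p q p0 q0; rewrite /vinf.
  rewrite size_mul //; move: p0 q0; rewrite -!size_poly_gt0.
  move: (size p) (size q) => m n; case: m => // m; case: n => // n _ _.
  lia.
move=> _; have := size_polyD p q; rewrite leq_max => /orP[] h; [left|right].
  by rewrite lerB // lez_nat.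
by rewrite lerB // lez_nat.
Qed.

Lemma vmup_valuation b : valuation (vmup b).
Proof.
split=> p q p0 q0; rewrite /vmup; first by rewrite mupM.
move=> pq; rewrite !lez_nat; apply/orP; rewrite -geq_min mup_geq // dvdp_add //.
  by rewrite -mup_geq // geq_minl.
by rewrite -mup_geq // geq_minr.
Qed.

Lemma vmup_ge0 b p : 0 <= vmup b p.
Proof. by []. Qed.

(** For u of degree one, u - u(b) is a constant multiple of X - b, so orders of vanishing are
    transported along u. *)
Lemma mup_comp b p u : p != 0 -> size u = 2 -> mup b (p \Po u) = mup u.[b] p.
Proof.
move=> p0 su; have u0 : u != 0 by rewrite -size_poly_gt0 su.
have [m [q]] := multiplicity_XsubC p u.[b]; rewrite p0 /= => rq ->.
have e : u - u.[b]%:P = u`_1 *: ('X - b%:P).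
  apply/polyP => i; rewrite coefB coefC coefZ coefB coefX coefC.
  rewrite (horner_coef u) su !big_ord_recl big_ord0 /= expr0 expr1 mulr1 addr0.
  case: i => [|[|i]] /=; rewrite ?subr0 ?sub0r ?mulr1 ?mulr0 ?mulrN //.
    by rewrite opprD addNKr.
  by rewrite nth_default ?su.
have u1 : u`_1 != 0 by have := u0; rewrite -lead_coef_eq0 lead_coefE su.
rewrite comp_polyM [_ ^+ m \Po u]rmorphXn /= comp_polyB comp_polyX comp_polyC e.
have rq' : ~~ root (q \Po u) b by rewrite rootE horner_comp -rootE.
rewrite mupMr // exprZn -mul_polyC mupMr ?mup_XsubCX ?eqxx; last first.
  by rewrite rootC expf_neq0.
by rewrite mupMr // mup_XsubCX eqxx.
Qed.

Lemma disp_mup_act b u A N : size u = 2 -> \det A != 0 ->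
  disp (vmup b) (act u A) N <-> disp (vmup u.[b]) A N.
Proof.
move=> su A0; rewrite /disp /vmup; split=> h i j k l; move: (h i j k l);
  rewrite !actE det_act !comp_poly2_eq0 // => g a b'; move: (g a b');
  by rewrite !mup_comp.
Qed.

Lemma disp_inf_act u A N : size u = 2 ->
  disp vinf (act u A) N <-> disp vinf A N.
Proof.
move=> su; rewrite /disp /vinf; split=> h i j k l; move: (h i j k l);
  by rewrite !actE det_act !comp_poly2_eq0 // !size_comp_poly2.
Qed.

(** Polynomials have nonnegative valuation at a finite place, so only the determinant costs
    anything; away from its zeros A moves nothing. *)
Lemma disp_mup_det b A : disp (vmup b) A (vmup b (\det A)).
Proof.
move=> i j k l _ _; have := vmup_ge0 b (A i j); have := vmup_ge0 b (A k l); lia.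
Qed.

Lemma disp_mup1 b : disp (vmup b) 1%:M 0.
Proof. by have := @disp_mup_det b 1%:M; rewrite det1 /vmup mupNroot // root1. Qed.

Lemma disp_inf1 : disp vinf 1%:M 0.
Proof.
have E (i j : 'I_2) : (1%:M : 'M[P]_2) i j != 0 -> (1%:M : 'M[P]_2) i j = 1.
  by rewrite mxE; case: (i == j); rewrite ?eqxx.
by move=> i j k l /E-> /E->; rewrite det1 /vinf size_poly1.
Qed.

Fixpoint itp u n : P := if n is n'.+1 then itp u n' \Po u else 'X.

(* The fibre matrix of f^n when f is (X, Y) |-> (u(X), A(X).Y), up to the     *)
(* scalars that PGL_2 ignores; coc2 below is that of f^n followed by g^m.     *)
Fixpoint coc u A n : 'M[P]_2 := if n is n'.+1 then act u (coc u A n') *m A else 1%:M.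

Lemma size_itp u n : size u = 2 -> size (itp u n) = 2.
Proof. by move=> su; elim: n => [|n IH] /=; rewrite ?size_polyX // size_comp_poly2. Qed.

Lemma horner_itp u n b : (itp u n).[b] = iter n (horner u) b.
Proof.
by elim: n b => [|n IH] b; rewrite ?hornerX // iterSr -IH /= horner_comp.
Qed.

Lemma itp_comm u v n : u \Po v = v \Po u -> itp u n \Po v = v \Po itp u n.
Proof.
move=> uv; elim: n => [|n IH] /=; first by rewrite comp_polyX comp_polyXr.
by rewrite -comp_polyA uv comp_polyA IH -comp_polyA.
Qed.

Lemma det_coc u A n : size u = 2 -> \det A != 0 -> \det (coc u A n) != 0.
Proof.
move=> su A0; elim: n => [|n IH] /=; first by rewrite det1 oner_neq0.
by rewrite det_mulmx mulf_neq0 // det_act comp_poly2_eq0.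
Qed.

Lemma cocD u A n m : coc u A (n + m) = act (itp u m) (coc u A n) *m coc u A m.
Proof.
elim: m => [|m IH] /=; first by rewrite addn0 mulmx1 actX.
by rewrite addnS /= IH actM act_comp mulmxA.
Qed.

(** The matrix of g is pushed through the n factors of f one at a time, with the commutation
    relation used at each. *)
Lemma coc_comm u v A B n : u \Po v = v \Po u -> size u = 2 -> size v = 2 ->
  prop (act v A *m B) (act u B *m A) ->
  prop (act v (coc u A n) *m B) (act (itp u n) B *m coc u A n).
Proof.
move=> uv su sv AB; elim: n => [|n IH] /=.
  by rewrite act1 mul1mx mulmx1 actX; apply: prop_refl.
rewrite actM act_comp uv -act_comp -mulmxA.
apply: prop_trans (prop_mull _ AB) _.
rewrite mulmxA -actM mulmxA -act_comp -actM.
exact/prop_mulr/prop_act.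
Qed.

Lemma coc_comm2 u v A B n m : u \Po v = v \Po u -> size u = 2 -> size v = 2 ->
  prop (act v A *m B) (act u B *m A) ->
  prop (act (itp v m) (coc u A n) *m coc v B m)
       (act (itp u n) (coc v B m) *m coc u A n).
Proof.
move=> uv su sv AB; apply: prop_sym; apply: coc_comm.
- by rewrite itp_comm.
- by [].
- exact: size_itp.
exact/prop_sym/coc_comm.
Qed.

End Places.

(** * Orbits on the base and displacement along one line *)

Section Orbits.
Variable K : closedFieldType.
Notation P := {poly K}.
Implicit Types (A B : 'M[P]_2) (u v p q : P) (b c s : K) (r : seq K).

Lemma roots_seq p : p != 0 -> exists r, forall b, mup b p = count_mem b r.
Proof.
move=> p0; have [r e] := closed_field_poly_normal p; exists r => b.
by rewrite {1}e -mul_polyC mupMr ?mu_prod_XsubC // rootC lead_coef_eq0.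
Qed.

Lemma sum_mup_le p (x : nat -> K) n : p != 0 -> injective x ->
  (\sum_(i < n) mup (x i) p < size p)%N.
Proof.
move=> p0 xI; have [r e] := closed_field_poly_normal p.
have sr : size p = (size r).+1.
  by rewrite e size_scale ?lead_coef_eq0 // size_prod_XsubC.
rewrite sr ltnS.
have -> : (\sum_(i < n) mup (x i) p = \sum_(z <- r) \sum_(i < n) (z == x i))%N.
  rewrite exchange_big; apply: eq_bigr => i _ /=.
  rewrite {1}e -mul_polyC mupMr ?mu_prod_XsubC ?rootC ?lead_coef_eq0 //.
  by rewrite -sumn_count sumnE big_map.
rewrite -sum1_size; apply: leq_sum => z _.
have [[i zi]|nz] := pselect (exists i : 'I_n, z = x i); last first.
  by rewrite big1 // => i _; case: eqP => // zi; case: nz; exists i.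
rewrite (bigD1 i) //= zi eqxx big1 // => j ji; case: eqP => // /xI ij.
by rewrite -val_eqE /= ij eqxx in ji.
Qed.

(** Each label of the list accounts for at most one point. The labels will be pairs of singular
    points, and the point attached to a pair the crossing of the lines through them. *)
Lemma finite_unique (T : eqType) (l : seq T) (R : K -> T -> Prop) :
  (forall b c t, R b t -> R c t -> b = c) ->
  exists S : seq K, forall b t, t \in l -> R b t -> b \in S.
Proof.
move=> RI; elim: l => [|t l [S hS]]; first by exists [::].
have [[b0 Rb]|nR] := pselect (exists b, R b t).
  exists (b0 :: S) => b t'; rewrite !inE => /orP[/eqP->|tl] h.
    by rewrite (RI _ _ _ h Rb) eqxx.
  by rewrite (hS b t') ?orbT.
exists S => b t'; rewrite inE => /orP[/eqP->|tl] h; last exact: hS h.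
by case: nR; exists b.
Qed.

Lemma avoid_finite (T : eqType) (l : seq T) (R : nat -> T -> Prop) :
  (forall i j t, R i t -> R j t -> i = j) ->
  exists N, forall t, t \in l -> ~ R N t.
Proof.
move=> RI; suff [N hN] : exists N, forall M t, (N <= M)%N -> t \in l -> ~ R M t.
  by exists N => t; apply: hN.
elim: l => [|t l [N hN]]; first by exists 0%N.
have [[i0 Ri]|nR] := pselect (exists i, R i t).
  exists (maxn N i0.+1) => M t'; rewrite geq_max inE => /andP[NM iM] /orP[/eqP->|tl].
    by move=> h; rewrite (RI _ _ _ h Ri) ltnn in iM.
  exact: hN.
exists N => M t' NM; rewrite inE => /orP[/eqP-> h|tl]; last exact: hN.
by apply: nR; exists M.
Qed.

Definition pt u n b := iter n (horner u) b.

(* The orbit of b under u and v is a copy of the grid N^2, whose horizontal   *)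
(* and vertical lines are the orbits of u and of v.                           *)
Definition free u v b := forall i j i' j',
  pt u i (pt v j b) = pt u i' (pt v j' b) -> i = i' /\ j = j'.

(** Comparing forward orbits expresses that two points lie on one full orbit of u, without iterating
    the inverse of u. *)
Definition same_line u b c := exists i j, pt u i b = pt u j c.

Definition off_line u r b := forall s, s \in r -> ~ same_line u b s.

Lemma ptD u i j b : pt u (i + j) b = pt u i (pt u j b).
Proof. exact: iterD. Qed.

Lemma ptC u v b : u \Po v = v \Po u -> forall i j,
  pt u i (pt v j b) = pt v j (pt u i b).
Proof.
move=> uv i j.
by rewrite /pt -!horner_itp -!horner_comp itp_comm // -itp_comm.
Qed.

Lemma pt_inj u n : size u = 2 -> injective (pt u n).
Proof.
move=> su; elim: n => [|n IH] b c //=.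
suff I : injective (horner u) by move=> /I /IH.
move=> x y; rewrite !horner_coef su !big_ord_recl !big_ord0 /= => /addrI.
rewrite !addr0 !expr1; apply: mulfI.
have : lead_coef u != 0 by rewrite lead_coef_eq0 -size_poly_gt0 su.
by rewrite lead_coefE su.
Qed.

Lemma free_sym u v b : u \Po v = v \Po u -> free u v b -> free v u b.
Proof. by move=> uv h i j i' j'; rewrite -!(ptC b uv) => /h[]. Qed.

Lemma free_inj u v b : free u v b -> injective (fun i => pt u i b).
Proof. by move=> h i j e; have [] := h i 0%N j 0%N e. Qed.

Lemma free_pt u v b n m : u \Po v = v \Po u -> free u v b ->
  free u v (pt u n (pt v m b)).
Proof.
move=> uv h i j i' j'.
rewrite -(ptC (pt v m b) uv n j) -(ptC (pt v m b) uv n j') -!ptD => /h[]; lia.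
Qed.

Lemma same_line_pt u b c n : same_line u (pt u n b) c <-> same_line u b c.
Proof.
split=> -[i [j e]]; first by exists (i + n)%N, j; rewrite ptD.
by exists i, (n + j)%N; rewrite -ptD addnC !ptD e.
Qed.

Lemma off_line_pt u r b n : off_line u r (pt u n b) <-> off_line u r b.
Proof. by split=> h s sr /(same_line_pt u b s n) /h; apply. Qed.

Lemma disp_off_line u r A b n : size u = 2 -> \det A != 0 ->
  (forall c, c \notin r -> mup c (\det A) = 0%N) -> off_line u r b ->
  disp (vmup b) (coc u A n) 0.
Proof.
move=> su A0 hr; elim: n b => [|n IH] b hb; first exact: disp_mup1.
have br : b \notin r by apply/negP => /hb; apply; exists 0%N, 0%N.
rewrite -[0]addr0; apply: disp_mul => //; first exact: vmup_valuation.
- by rewrite det_act comp_poly2_eq0 // det_coc.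
- by apply/disp_mup_act; rewrite ?det_coc //; apply: IH; apply/(off_line_pt u r b 1).
by apply: disp_le (@disp_mup_det _ b A) _; rewrite /vmup hr.
Qed.

Lemma disp_sum u A b n : size u = 2 -> \det A != 0 ->
  disp (vmup b) (coc u A n) (\sum_(i < n) mup (pt u i b) (\det A))%N%:Z.
Proof.
move=> su A0; elim: n b => [|n IH] b; first by rewrite big_ord0; apply: disp_mup1.
rewrite big_ord_recl addnC PoszD; apply: disp_mul => //.
- exact: vmup_valuation.
- by rewrite det_act comp_poly2_eq0 // det_coc.
- apply/disp_mup_act; rewrite ?det_coc //; apply: disp_le (IH _) _.
  rewrite lez_nat leq_sum // => i _; rewrite /pt /= -iterSr; exact: leqnn.
exact: disp_mup_det.
Qed.

(** The points u^i(b) are distinct, so the multiplicities of det A collected along the orbit add up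
    to at most its degree, whatever n is. *)
Lemma disp_free u v A b n : size u = 2 -> \det A != 0 -> free u v b ->
  disp (vmup b) (coc u A n) (size (\det A))%:Z.
Proof.
move=> su A0 hb; apply: disp_le (@disp_sum u A b n su A0) _; rewrite lez_nat.
by apply: ltnW; apply: sum_mup_le => //; apply: free_inj hb.
Qed.

End Orbits.

(** * Places with a free orbit *)

Section OneEnded.
Variable K : closedFieldType.
Notation P := {poly K}.
Implicit Types (A B : 'M[P]_2) (u v p q : P) (b c s : K) (r : seq K).

Definition coc2 u v A B n m := act (itp u n) (coc v B m) *m coc u A n.

Lemma det_coc2 u v A B n m : size u = 2 -> size v = 2 ->
  \det A != 0 -> \det B != 0 -> \det (coc2 u v A B n m) != 0.
Proof.
move=> su sv A0 B0; rewrite det_mulmx mulf_neq0 ?det_coc //.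
by rewrite det_act comp_poly2_eq0 ?size_itp // det_coc.
Qed.

Lemma coc2_sym u v A B n m : u \Po v = v \Po u -> size u = 2 -> size v = 2 ->
  prop (act v A *m B) (act u B *m A) ->
  prop (coc2 v u B A m n) (coc2 u v A B n m).
Proof. by move=> *; apply: coc_comm2. Qed.

(** A path with one turn: along the u-line of b, then along the v-line of u^n(b). Neither line meets
    a zero of the determinants, so no step costs anything. *)
Lemma disp_corner u v r A B b n m : size u = 2 -> size v = 2 ->
  \det A != 0 -> \det B != 0 ->
  (forall c, c \notin r -> mup c (\det A) = 0%N) ->
  (forall c, c \notin r -> mup c (\det B) = 0%N) ->
  off_line u r b -> off_line v r (pt u n b) ->
  disp (vmup b) (coc2 u v A B n m) 0.
Proof.
move=> su sv A0 B0 hA hB hu hv; rewrite -[0]addr0; apply: disp_mul.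
- exact: vmup_valuation.
- by rewrite det_act comp_poly2_eq0 ?size_itp // det_coc.
- exact: det_coc.
- apply/disp_mup_act; rewrite ?size_itp ?det_coc // horner_itp.
  exact: disp_off_line hv.
exact: disp_off_line hu.
Qed.

(* The two points are joined by running along the horizontal lines through    *)
(* them up to a far away vertical line free of singular points.               *)
Lemma disp_parallel u v r A B b n m : u \Po v = v \Po u ->
  size u = 2 -> size v = 2 -> \det A != 0 -> \det B != 0 ->
  prop (act v A *m B) (act u B *m A) ->
  (forall c, c \notin r -> mup c (\det A) = 0%N) ->
  (forall c, c \notin r -> mup c (\det B) = 0%N) ->
  free u v b -> off_line u r b -> off_line u r (pt u n (pt v m b)) ->
  disp (vmup b) (coc2 u v A B n m) 0.
Proof.
move=> uv su sv A0 B0 AB hA hB fb hb hc.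
(* By freeness the v-lines through the points u^M(u^n(b)) are disjoint, so each singular point
   spoils at most one M. *)
have [M hM] : exists M, forall s, s \in r -> ~ same_line v (pt u M (pt u n b)) s.
  apply: avoid_finite => i j s [k [l e]] [k' [l' e']].
  have : pt u (i + n) (pt v (l' + k) b) = pt u (j + n) (pt v (l + k') b).
    rewrite !(ptC _ uv) (ptD v l' k) (ptD u i n) e (ptD v l k') (ptD u j n) e'.
    by rewrite -!ptD addnC.
  by move=> /fb[]; lia.
(* The one-turn path to the far point is also a path through u^n(v^m(b)) followed by M steps on the
   u-line of that point. The matrix Y belongs to those last steps. *)
have e1 : prop (coc2 u v A B (M + n) m)
    (act (itp v m) (act (itp u n) (coc u A M)) *m coc2 u v A B n m).
  apply: prop_trans (prop_sym (coc2_sym _ _ uv su sv AB)) _.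
  rewrite /coc2 cocD actM -mulmxA; apply/prop_mull.
  exact: (coc2_sym _ _ uv su sv AB).
set Y := act _ (act _ _) in e1.
have Y0 : \det Y != 0.
  by rewrite !det_act !comp_poly2_eq0 ?size_itp // det_coc.
rewrite -[0]addr0; apply: (@disp_cancell _ _ Y) => //.
- exact: vmup_valuation.
- exact: det_coc2.
- apply: disp_prop e1 _; [exact: vmup_valuation | exact: det_coc2 |].
  by apply: disp_corner hb _ => //; rewrite ptD.
apply/disp_mup_act; rewrite ?size_itp ?det_act ?comp_poly2_eq0 ?size_itp ?det_coc //.
apply/disp_mup_act; rewrite ?size_itp ?det_coc // !horner_itp.
exact: disp_off_line hc.
Qed.

(** Clean lines of different directions at the two ends meet and give a path with one turn; clean
    lines of the same direction call for [disp_parallel]. *)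
Lemma disp_good u v r A B b n m : u \Po v = v \Po u ->
  size u = 2 -> size v = 2 -> \det A != 0 -> \det B != 0 ->
  prop (act v A *m B) (act u B *m A) ->
  (forall c, c \notin r -> mup c (\det A) = 0%N) ->
  (forall c, c \notin r -> mup c (\det B) = 0%N) ->
  free u v b -> let c := pt u n (pt v m b) in
  off_line u r b \/ off_line v r b -> off_line u r c \/ off_line v r c ->
  disp (vmup b) (coc2 u v A B n m) 0.
Proof.
move=> uv su sv A0 B0 AB hA hB fb c; rewrite /c => hb hc.
have sw : disp (vmup b) (coc2 v u B A m n) 0 -> disp (vmup b) (coc2 u v A B n m) 0.
  apply: disp_prop (coc2_sym _ _ uv su sv AB); first exact: vmup_valuation.
  exact: det_coc2.
case: hb hc => hb [] hc.
- exact: disp_parallel hc.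
- by apply: disp_corner hb _ => //; apply/(off_line_pt v r _ m); rewrite -ptC.
- apply: sw; apply: disp_corner hb _ => //.
  by apply/(off_line_pt u r _ n).
apply: sw; apply: (@disp_parallel v u r) => //.
- exact: prop_sym.
- exact: free_sym.
by rewrite -ptC.
Qed.

(** In a free grid a row and a column meet only once. Hence only finitely many points have a
    singular point on both of their lines. *)
Lemma crossing_unique u v b c s s' : u \Po v = v \Po u -> size u = 2 ->
  size v = 2 -> free u v b ->
  same_line u b s -> same_line v b s' -> same_line u c s -> same_line v c s' ->
  b = c.
Proof.
move=> uv su sv fb [i [i1 e1]] [j [j1 e2]] [k [k1 e3]] [l [l1 e4]].
have E1 : pt u (k1 + i) b = pt u (i1 + k) c.
  by rewrite !ptD e1 e3 -!ptD addnC.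
have E2 : pt v (l1 + j) b = pt v (j1 + l) c.
  by rewrite !ptD e2 e4 -!ptD addnC.
have : pt u (k1 + i) (pt v (j1 + l) b) = pt u (i1 + k) (pt v (l1 + j) b).
  by rewrite E2 !(ptC _ uv) E1.
move=> /fb[e _]; apply: (@pt_inj _ u (k1 + i)) => //.
by rewrite E1 e.
Qed.

(** The set S contains all crossings of two singular lines, so a free point outside S has a clean
    line and [disp_good] applies between two such points. The bound N holds everywhere, from
    [disp_free] on each leg of the path. *)
Lemma disp_finite_places u v A B : u \Po v = v \Po u ->
  size u = 2 -> size v = 2 -> \det A != 0 -> \det B != 0 ->
  prop (act v A *m B) (act u B *m A) ->
  exists (S : seq K) (N : nat), forall b n m, free u v b ->
    disp (vmup b) (coc2 u v A B n m) N%:Z /\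
    (b \notin S -> pt u n (pt v m b) \notin S ->
       disp (vmup b) (coc2 u v A B n m) 0).
Proof.
move=> uv su sv A0 B0 AB.
have [r hr] := roots_seq (mulf_neq0 A0 B0).
have hr0 c : c \notin r -> mup c (\det A) = 0%N /\ mup c (\det B) = 0%N.
  by move/count_memPn; rewrite -hr mupM // => /eqP; rewrite addn_eq0 => /andP[/eqP ? /eqP ?].
have [S hS] := @finite_unique K _ [seq (s, s') | s <- r, s' <- r]
  (fun b t => [/\ free u v b, same_line u b t.1 & same_line v b t.2])
  (fun b c t hb hc => let: And3 f1 h1 h2 := hb in let: And3 _ h3 h4 := hc in
     crossing_unique uv su sv f1 h1 h2 h3 h4).
have hS' b : free u v b -> b \notin S -> off_line u r b \/ off_line v r b.
  move=> fb bS; have [|nu] := pselect (off_line u r b); first by left.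
  right=> s' s'r bs'; apply: nu => s sr bs; move/negP: bS; apply.
  by apply: (hS _ (s, s')) => //; apply/allpairsP; exists (s, s').
exists S, (size (\det A) + size (\det B))%N => b n m fb; split; last first.
  move=> bS cS; apply: (disp_good (r := r)) => //.
  - by move=> c /hr0[].
  - by move=> c /hr0[].
  - exact: hS'.
  by apply: hS' => //; apply: free_pt.
rewrite addnC PoszD; apply: disp_mul.
- exact: vmup_valuation.
- by rewrite det_act comp_poly2_eq0 ?size_itp // det_coc.
- exact: det_coc.
- apply/disp_mup_act; rewrite ?size_itp ?det_coc // horner_itp.
  apply: (@disp_free _ v u) => //; apply: free_sym => //.
  exact: (@free_pt _ u v b n 0).
exact: disp_free fb.
Qed.

End OneEnded.

(** * Leading coefficients of the commutation relation at infinity *)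

Section Asymptotics.
Variable K : closedFieldType.
Notation P := {poly K}.
Implicit Types (A B : 'M[P]_2) (u v p q : P).

(** Natural exponents on both sides express independence over the integers without inverses. The
    second case forces characteristic zero. *)
Definition affine_indep u v :=
  (exists a b : K, [/\ a != 0, b != 0, u = a *: 'X, v = b *: 'X
     & forall i j i' j', a ^+ i * b ^+ j = a ^+ i' * b ^+ j' -> i = i' /\ j = j'])
  \/ (exists c d : K, [/\ u = 'X + c%:P, v = 'X + d%:P
     & forall i j i' j', c *+ i + d *+ j = c *+ i' + d *+ j' -> i = i' /\ j = j']).

Lemma affine_indep_size u v : affine_indep u v -> size u = 2 /\ size v = 2.
Proof.
case=> [[a [b [a0 b0 -> -> _]]]|[c [d [-> -> _]]]].
  by rewrite !size_scale // size_polyX.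
by rewrite !size_XaddC.
Qed.

Lemma affine_indep_comm u v : affine_indep u v -> u \Po v = v \Po u.
Proof.
case=> [[a [b [a0 b0 -> -> _]]]|[c [d [-> -> _]]]].
  by rewrite !comp_polyZ !comp_polyX !scalerA mulrC.
by rewrite !comp_polyD !comp_polyX !comp_polyC addrAC.
Qed.

(** Agreement of the two top coefficients. *)
Definition approx p q := (size (p - q)%R <= (size p).-2)%N.

Lemma approx_size p q : p != 0 -> approx p q -> size p = size q /\ lead_coef p = lead_coef q.
Proof.
rewrite -size_poly_gt0 /approx => p0 h.
have -> : q = p + - (p - q) by rewrite opprB addrC subrK.
have lt : (size (- (p - q)) < size p)%N by rewrite size_polyN; apply: leq_ltn_trans h _; rewrite -subn2 ltn_subrL.
by rewrite size_polyDl // lead_coefDl.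
Qed.

(** Minus the sum of the roots. The factor ['X] makes the value 0 for constants, where a truncated
    index would return the leading coefficient. *)
Definition subcoef p := (p * 'X)`_(size p).-1 / lead_coef p.

Lemma subcoefE c (r : seq K) : c != 0 ->
  subcoef (c *: \prod_(z <- r) ('X - z%:P)) = - \sum_(z <- r) z.
Proof.
move=> c0; rewrite /subcoef lead_coefZ lead_coef_prod_XsubC // mulr1.
rewrite coefMX coefZ size_scale // size_prod_XsubC /=.
case: eqP => [/size0nil->|/eqP r0]; first by rewrite big_nil oppr0 mul0r.
by rewrite coefPn_prod_XsubC // mulrC mulKf.
Qed.

Lemma subcoefM p q : p != 0 -> q != 0 -> subcoef (p * q) = subcoef p + subcoef q.
Proof.
move=> p0 q0.
have [r er] := closed_field_poly_normal p; have [s es] := closed_field_poly_normal q.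
rewrite {1}er {1}es -scalerAl -scalerAr scalerA -big_cat /=.
rewrite subcoefE ?mulf_neq0 ?lead_coef_eq0 // big_cat /= opprD.
by rewrite [in RHS]er [in RHS]es !subcoefE ?lead_coef_eq0.
Qed.

Lemma subcoef_shift p c : p != 0 ->
  subcoef (p \Po ('X + c%:P)) = subcoef p + c *+ (size p).-1.
Proof.
move=> p0; have [r e] := closed_field_poly_normal p.
rewrite e comp_polyZ rmorph_prod /=.
have -> : \prod_(z <- r) (('X - z%:P) \Po ('X + c%:P)) =
  \prod_(z <- [seq z - c | z <- r]) ('X - z%:P).
  rewrite big_map; apply: eq_bigr => z _.
  by rewrite comp_polyB comp_polyX comp_polyC polyCB opprB addrA addrAC.
rewrite !subcoefE ?lead_coef_eq0 // big_map sumrB opprB addrC.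
congr (_ + _); rewrite size_scale ?lead_coef_eq0 // size_prod_XsubC /=.
by rewrite big_const_seq count_predT iter_addr_0.
Qed.

Lemma subcoef_approx p q : p != 0 -> approx p q -> subcoef p = subcoef q.
Proof.
move=> p0 h; have [es el] := approx_size p0 h; rewrite /subcoef -es -el.
congr (_ / _); rewrite !coefMX; case: eqP => // /eqP s0.
apply/eqP; rewrite -subr_eq0 -coefB nth_default //.
Qed.

(* The first two coefficients at infinity: [q], [b] are moved by [u] and [p], *)
(* [a] by [v]; [da], [db] play the role of determinants.                      *)
Lemma asymp_degree u v p q a b da db : affine_indep u v ->
  p != 0 -> q != 0 -> a != 0 -> b != 0 -> da != 0 -> db != 0 ->
  p ^+ 2 * ((da \Po v) * db) = q ^+ 2 * ((db \Po u) * da) ->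
  approx (p * (a \Po v) * b) (q * (b \Po u) * a) \/
  approx (p * db * (b \Po u) * (a \Po v)) (q * (db \Po u) * a * b) ->
  ((size a).-1).*2 = (size da).-1.
Proof.
move=> uv p0 q0 a0 b0 da0 db0 edet happ; have [su sv] := affine_indep_size uv.
have nz (r w : P) : size w = 2 -> r != 0 -> r \Po w != 0.
  by move=> ? ?; rewrite comp_poly2_eq0.
case: uv => [[x [y [x0 y0 eu ev ind]]]|[c [d [eu ev ind]]]].
  have lu : lead_coef u = x by rewrite eu lead_coefZ lead_coefX mulr1.
  have lv : lead_coef v = y by rewrite ev lead_coefZ lead_coefX mulr1.
  set i := (size da).-1; set j := (size db).-1; set n := (size a).-1.
  have nl (r : P) : r != 0 -> lead_coef r != 0 by rewrite lead_coef_eq0.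
  (* Leading coefficients of the determinant relation. Combined with the square of the relation [e1]
     below they leave an identity between monomials in x and y, and independence compares the
     exponents. *)
  have ed' : lead_coef p ^+ 2 * y ^+ i = lead_coef q ^+ 2 * x ^+ j.
    apply: (mulIf (mulf_neq0 (nl _ da0) (nl _ db0))).
    transitivity (lead_coef (p ^+ 2 * ((da \Po v) * db))); last rewrite edet.
      by rewrite expr2 !lead_coefM lead_coef_comp ?sv // lv -/i; ring.
    by rewrite expr2 !lead_coefM lead_coef_comp ?su // lu -/j; ring.
  set m := (size b).-1.
  case: happ => h; (have [|_] := approx_size _ h; first by rewrite !(mulf_neq0, nz));
    rewrite !lead_coefM !lead_coef_comp ?su ?sv // lu lv -/m -/n -/j => e.
  - have e1 : lead_coef p * y ^+ n = lead_coef q * x ^+ m.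
      apply: (mulIf (mulf_neq0 (nl _ a0) (nl _ b0)));
      transitivity (lead_coef p * (lead_coef a * y ^+ n) * lead_coef b); first ring.
      by rewrite e; ring.
    have : x ^+ j * y ^+ n.*2 = x ^+ m.*2 * y ^+ i.
      rewrite -!muln2 !exprM; apply: (mulfI (expf_neq0 2 (nl _ q0))).
      rewrite mulrA -ed'; transitivity ((lead_coef p * y ^+ n) ^+ 2 * y ^+ i); first ring.
      by rewrite e1; ring.
    by move=> /ind[].
  have e1 : lead_coef p * (x ^+ m * y ^+ n) = lead_coef q * x ^+ j.
    apply: (mulIf (mulf_neq0 (nl _ db0) (mulf_neq0 (nl _ a0) (nl _ b0)))).
    transitivity (lead_coef p * lead_coef db * (lead_coef b * x ^+ m) *
      (lead_coef a * y ^+ n)); first ring.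
    by rewrite e; ring.
  have : x ^+ m.*2 * y ^+ n.*2 = x ^+ j * y ^+ i.
    rewrite -!muln2 !exprM; apply: (mulfI (expf_neq0 2 (nl _ p0))).
    transitivity ((lead_coef p * (x ^+ m * y ^+ n)) ^+ 2); first ring.
    rewrite e1; transitivity (lead_coef q ^+ 2 * x ^+ j * x ^+ j); first ring.
    by rewrite -ed'; ring.
  by move=> /ind[].
set i := (size da).-1; set j := (size db).-1; set n := (size a).-1.
(* Translations do not change leading coefficients; the next coefficient, through the additive
   [subcoef], takes their place. *)
have ed' : subcoef p *+ 2 + d *+ i = subcoef q *+ 2 + c *+ j.
  apply: (addIr (subcoef da + subcoef db)).
  transitivity (subcoef (p ^+ 2 * ((da \Po v) * db))); last rewrite edet.
    by rewrite expr2 !subcoefM ?(mulf_neq0, nz) // ev subcoef_shift // -/i; ring.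
  by rewrite expr2 !subcoefM ?(mulf_neq0, nz) // eu subcoef_shift // -/j; ring.
set m := (size b).-1.
case: happ => h; (have := subcoef_approx _ h; rewrite !(mulf_neq0, nz) // => /(_ isT));
  rewrite !subcoefM ?(mulf_neq0, nz) // eu ev !subcoef_shift // -/m -/n -?/j => e.
- have e1 : subcoef p + d *+ n = subcoef q + c *+ m.
    apply: (addIr (subcoef a + subcoef b)).
    transitivity (subcoef p + (subcoef a + d *+ n) + subcoef b); first ring.
    by rewrite e; ring.
  have : c *+ j + d *+ n.*2 = c *+ m.*2 + d *+ i.
    rewrite -!muln2 !mulrnA; apply: (addrI (subcoef q *+ 2)).
    rewrite addrA -ed'; transitivity ((subcoef p + d *+ n) *+ 2 + d *+ i); first ring.
    by rewrite e1; ring.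
  by move=> /ind[].
have e1 : subcoef p + (c *+ m + d *+ n) = subcoef q + c *+ j.
  apply: (addIr (subcoef db + (subcoef a + subcoef b))).
  transitivity (subcoef p + subcoef db + (subcoef b + c *+ m) +
    (subcoef a + d *+ n)); first ring.
  by rewrite e; ring.
have : c *+ m.*2 + d *+ n.*2 = c *+ j + d *+ i.
  rewrite -!muln2 !mulrnA; apply: (addrI (subcoef p *+ 2)).
  transitivity ((subcoef p + (c *+ m + d *+ n)) *+ 2); first ring.
  rewrite e1; transitivity (subcoef q *+ 2 + c *+ j + c *+ j); first ring.
  by rewrite -ed'; ring.
by move=> /ind[].
Qed.

End Asymptotics.

Section Infinity.
Variable K : closedFieldType.
Notation P := {poly K}.
Implicit Types (A B G : 'M[P]_2) (u v p q : P).

Definition szle A n := forall i j, (size (A i j) <= n)%N.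

(** The number k is the defect of the degree of the determinant, zero exactly when the leading
    matrix is invertible. It bounds the displacement because all nonzero entries have valuation at
    least -n. *)
Lemma disp_inf_size A n k : szle A n.+1 -> (size (\det A) + k)%N = n.*2.+1 ->
  disp (@vinf K) A k%:Z.
Proof.
move=> hA e i j k' l _ _; rewrite /vinf.
move: e (hA i j) (hA k' l).
move: (size (\det A)) (size (A i j)) (size (A k' l)) => a b c; lia.
Qed.

Lemma disp_inf_ex A : \det A != 0 -> exists N : nat, disp (@vinf K) A N%:Z.
Proof.
move=> A0; exists (\sum_i \sum_j size (A i j)).*2.+1 => i j k l _ _.
have h i' j' : (size (A i' j') <= \sum_i \sum_j size (A i j))%N.
  by rewrite (bigD1 i') //= (bigD1 j') //= -addnA leq_addr.
have h1 := h i j; have h2 := h k l; rewrite -size_poly_gt0 in A0.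
move: A0 h1 h2; rewrite /vinf; set s := (\sum_i _)%N.
move: s (size (\det A)) (size (A i j)) (size (A k l)) => s a b c h0 h1 h2.
lia.
Qed.

Lemma mul3_size (a b c : P) i j k : (size a <= i.+1)%N -> (size b <= j.+1)%N ->
  (size c <= k)%N -> (size (a * b * c)%R <= i + j + k)%N.
Proof.
move=> ha hb hc; have [->|c0] := eqVneq c 0; first by rewrite mulr0 size_poly0.
rewrite -size_poly_gt0 in c0.
apply: leq_trans (size_polyMleq _ _) _; move: c0 hc (size_polyMleq a b) ha hb.
by move: (size (a * b)) (size a) (size b) (size c) => s x y z; lia.
Qed.

Lemma mul3_size2 (a b c : P) i j k : (size a <= i.+1)%N -> (size b <= j)%N ->
  (size c <= k)%N -> (size (a * b * c)%R <= (i + j + k).-1)%N.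
Proof.
move=> ha hb hc; have [->|b0] := eqVneq b 0; first by rewrite mulr0 mul0r size_poly0.
case: j hb => [|j] hb; first by rewrite leqn0 size_poly_eq0 (negPf b0) in hb.
by rewrite addnS addSn; apply: mul3_size.
Qed.

Lemma mul3_size_eq (a b c : P) i j k : size a = i.+1 -> size b = j.+1 ->
  size c = k.+1 -> size (a * b * c) = (i + j + k).+1%N.
Proof.
move=> ha hb hc; have n0 (r : P) t : size r = t.+1 -> r != 0.
  by rewrite -size_poly_gt0 => ->.
rewrite !size_mul ?mulf_neq0 ?(n0 _ _ ha) ?(n0 _ _ hb) ?(n0 _ _ hc) //.
by rewrite ha hb hc; lia.
Qed.

Lemma max_size A : \det A != 0 ->
  exists m i j, szle A m.+1 /\ size (A i j) = m.+1.
Proof.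
move=> A0; pose F (ij : 'I_2 * 'I_2) := size (A ij.1 ij.2).
have [[i j] _ h] := @arg_maxnP _ (0, 0) xpredT F isT.
have pos : (0 < size (A i j))%N.
  rewrite lt0n; apply: contraNN A0 => /eqP e; rewrite det2E.
  have z i' j' : A i' j' = 0.
    by apply/eqP; rewrite -size_poly_eq0 -leqn0; apply: leq_trans (h (i', j') isT) _; rewrite /F /= e.
  by rewrite !z mul0r subrr.
have [s es] : exists s, size (A i j) = s.+1 by exists (size (A i j)).-1; case: size pos.
exists s, i, j; split=> // i' j'; apply: leq_trans (h (i', j') isT) _.
by rewrite /F /= es.
Qed.

(** Comparing degrees of determinants shows that p and q have the same size. The last identity is an
    entry of the relation rewritten as adj(B(u)) A(v) ~ A adj(B), needed when the lower diagonal
    entry of B dominates. *)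
Lemma prop_entries u v A B : prop (act v A *m B) (act u B *m A) ->
  \det A != 0 -> \det B != 0 -> size u = 2 -> size v = 2 ->
  exists p q, [/\ p != 0, q != 0 & size p = size q] /\
  [/\ p ^+ 2 * ((\det A \Po v) * \det B) = q ^+ 2 * ((\det B \Po u) * \det A),
    forall i j, p * ((A i 0 \Po v) * B 0 j + (A i 1 \Po v) * B 1 j) =
                q * ((B i 0 \Po u) * A 0 j + (B i 1 \Po u) * A 1 j)
  & p * \det B * ((B 1 1 \Po u) * (A 0 0 \Po v) - (B 0 1 \Po u) * (A 1 0 \Po v))
    = q * (\det B \Po u) * (A 0 0 * B 1 1 - A 0 1 * B 1 0)].
Proof.
move=> [p [q [p0 q0 e]]] A0 B0 su sv; exists p, q.
have ed : p ^+ 2 * ((\det A \Po v) * \det B) = q ^+ 2 * ((\det B \Po u) * \det A).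
  by have := congr1 determinant e; rewrite !detZ !det_mulmx !det_act.
split; split=> //.
- have := congr1 (fun r : P => size r) ed.
  rewrite !expr2 !size_mul ?(mulf_neq0, comp_poly2_eq0) //.
  rewrite !size_comp_poly2 //; move: p0 q0 A0 B0; rewrite -!size_poly_gt0.
  move: (size p) (size q) (size (\det A)) (size (\det B)) => x y z t; lia.
- move=> i j; have := congr1 (fun X : 'M_2 => X i j) e.
  by rewrite [LHS]mxE [RHS]mxE !mulmx2E !actE.
have e' : (p * \det B) *: (\adj (act u B) *m act v A) =
          (q * (\det B \Po u)) *: (A *m \adj B).
  transitivity (\adj (act u B) *m (p *: (act v A *m B)) *m \adj B).
    by rewrite -scalemxAr -scalemxAl -!mulmxA mul_mx_adj mul_mx_scalar -scalemxAr scalerA.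
  by rewrite e -scalemxAr -scalemxAl !mulmxA mul_adj_mx det_act mul_scalar_mx -!scalemxAl scalerA.
have := congr1 (fun X : 'M_2 => X 0 0) e'; rewrite /= [LHS]mxE [RHS]mxE !mulmx2E.
have [-> -> _ _] := adj2E (act u B); have [-> _ -> _] := adj2E B.
by rewrite !actE !mulNr !mulrN.
Qed.

Lemma eq_by_sub (V : zmodType) (a b c d : V) : c = d -> a - b = c - d -> a = b.
Proof. by move=> ->; rewrite subrr => /subr0_eq. Qed.

(** The leading matrix of A is diag(t, 0) with t nonzero. Counting degrees in the commutation
    relation makes the off-diagonal entries of B small, so a diagonal entry of B has maximal degree.
    The scalar relation for that entry holds up to the two top coefficients, and [asymp_degree] then
    gives det A the degree 2n, against the bound on its size. *)
Lemma no_translation u v A B n : affine_indep u v ->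
  \det A != 0 -> \det B != 0 -> prop (act v A *m B) (act u B *m A) ->
  size (A 0%R 0%R) = n.+1 -> (size (A 0%R 1%R) <= n)%N -> (size (A 1%R 0%R) <= n)%N ->
  (size (A 1%R 1%R) <= n)%N -> (size (\det A) <= n.*2)%N -> False.
Proof.
move=> uv A0 B0 AB h00 h01 h10 h11 hdet; have [su sv] := affine_indep_size uv.
have [p [q [[p0 q0 spq] [ed hent hadj]]]] := prop_entries AB A0 B0 su sv.
have [m [i0 [j0 [hB hB0]]]] := max_size B0.
have [e sp] : exists e, size p = e.+1.
  by exists (size p).-1; rewrite prednK // size_poly_gt0.
have sq : size q = e.+1 by rewrite -spq.
have le2 (a b : P) s : (size a <= s)%N -> (size b <= s)%N -> (size (a + b)%R <= s)%N.
  by move=> ha hb; apply: leq_trans (size_polyD _ _) _; rewrite geq_max ha hb.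
have leN (a : P) s : (size a <= s)%N -> (size (- a)%R <= s)%N by rewrite size_polyN.
have cu (r : P) : size (r \Po u) = size r by rewrite size_comp_poly2.
have cv (r : P) : size (r \Po v) = size r by rewrite size_comp_poly2.
have B01 : (size (B 0%R 1%R) <= m)%N.
  rewrite leqNgt; apply/negP => lt; have s01 : size (B 0%R 1%R) = m.+1.
    by apply/eqP; rewrite eqn_leq hB.
  have := @mul3_size_eq p (A 0 0 \Po v) (B 0 1) e n m sp _ s01.
  rewrite cv h00 => /(_ erefl).
  have -> : p * (A 0 0 \Po v) * B 0 1 = q * (B 0 0 \Po u) * A 0 1 +
    (q * (B 0 1 \Po u) * A 1 1 - p * B 1 1 * (A 0 1 \Po v)).
    by apply: (eq_by_sub (hent 0 1)); ring.
  apply/eqP; rewrite neq_ltn ltnS.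
  have -> : (e + n + m = e + m + n)%N by lia.
  rewrite le2 //; first by rewrite mul3_size ?sq ?cu.
  by rewrite le2 ?leN // mul3_size ?sq ?sp ?cu ?cv.
have B10 : (size (B 1%R 0%R) <= m)%N.
  rewrite leqNgt; apply/negP => lt; have s10 : size (B 1%R 0%R) = m.+1.
    by apply/eqP; rewrite eqn_leq hB.
  have := @mul3_size_eq q (B 1 0 \Po u) (A 0 0) e m n sq _ h00.
  rewrite cu s10 => /(_ erefl).
  have -> : q * (B 1 0 \Po u) * A 0 0 = p * B 0 0 * (A 1 0 \Po v) +
    (p * B 1 0 * (A 1 1 \Po v) - q * (B 1 1 \Po u) * A 1 0).
    by apply: (eq_by_sub (esym (hent 1 0))); ring.
  apply/eqP; rewrite neq_ltn ltnS.
  rewrite le2 //; first by rewrite mul3_size ?sp ?cv.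
  by rewrite le2 ?leN // mul3_size ?sq ?sp ?cu ?cv.
have A00 : A 0 0 != 0 by rewrite -size_poly_gt0 h00.
have fin b : b != 0 ->
  approx (p * (A 0 0 \Po v) * b) (q * (b \Po u) * A 0 0) \/
  approx (p * \det B * (b \Po u) * (A 0 0 \Po v)) (q * (\det B \Po u) * A 0 0 * b) ->
  False.
  move=> b0 hap; have := asymp_degree uv p0 q0 A00 b0 A0 B0 ed hap.
  rewrite h00 /=; move: A0 hdet; rewrite -size_poly_gt0.
  move: (size (\det A)) => s; lia.
have [lt|ge] := ltnP m (size (B 0%R 0%R)).
  have s00 : size (B 0%R 0%R) = m.+1 by apply/eqP; rewrite eqn_leq hB.
  apply: (fin (B 0 0)); first by rewrite -size_poly_gt0 s00.
  (* In each discarded product both off-diagonal factors have lost a degree, so the error starts two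
     degrees below the top. *)
  left; rewrite /approx (@mul3_size_eq _ _ _ e n m) ?cv //=.
  have -> : p * (A 0 0 \Po v) * B 0 0 - q * (B 0 0 \Po u) * A 0 0 =
    q * (B 0 1 \Po u) * A 1 0 - p * (A 0 1 \Po v) * B 1 0.
    by apply: (eq_by_sub (hent 0 0)); ring.
  apply: le2; last rewrite leN //; last by apply: mul3_size2; rewrite ?sp ?cv.
  by rewrite addnAC; apply: mul3_size2; rewrite ?sq ?cu.
have s11 : size (B 1%R 1%R) = m.+1.
  by move: hB0; case: (ord2P i0) => ->; case: (ord2P j0) => -> // h; move: B01 B10 ge; rewrite ?h ltnn.
apply: (fin (B 1 1)); first by rewrite -size_poly_gt0 s11.
have [d sd] : exists d, size (\det B) = d.+1.
  by exists (size (\det B)).-1; rewrite prednK // size_poly_gt0.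
have spd : size (p * \det B) = (e + d).+1%N by rewrite size_mul // sp sd addSn addnS.
have sqd : size (q * (\det B \Po u)) = (e + d).+1%N.
  by rewrite size_mul ?comp_poly2_eq0 // cu sq sd addSn addnS.
right; rewrite /approx (@mul3_size_eq _ _ _ (e + d) m n) ?cu ?cv //=.
have -> : p * \det B * (B 1 1 \Po u) * (A 0 0 \Po v) -
    q * (\det B \Po u) * A 0 0 * B 1 1 =
  p * \det B * (B 0 1 \Po u) * (A 1 0 \Po v) - q * (\det B \Po u) * A 0 1 * B 1 0.
  by apply: (eq_by_sub hadj); ring.
apply: le2; last rewrite leN //; last first.
  by rewrite addnAC; apply: mul3_size2; rewrite ?sqd.
by apply: mul3_size2; rewrite ?spd ?cu ?cv.
Qed.

End Infinity.

(** * The place at infinity *)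

Section Gauge.
Variable K : closedFieldType.
Notation P := {poly K}.
Implicit Types (A B G : 'M[P]_2) (u v p q : P) (C : 'M[K]_2).

(* The change of fibre coordinate by G, the inverse being replaced by the     *)
(* adjugate to stay over K[x].                                                *)
Definition gauge u G A := \adj (act u G) *m A *m G.

Lemma det_gauge u G A : size u = 2 -> \det G != 0 -> \det A != 0 ->
  \det (gauge u G A) != 0.
Proof.
move=> su G0 A0.
by rewrite !det_mulmx det_adj2 det_act !mulf_neq0 ?comp_poly2_eq0.
Qed.

Lemma gauge_actM u v G A B : u \Po v = v \Po u -> size u = 2 -> size v = 2 ->
  \det G != 0 ->
  prop (act v (gauge u G A) *m gauge v G B) (\adj (act (u \Po v) G) *m (act v A *m B) *m G).
Proof.
move=> uv su sv G0; rewrite /gauge !actM act_adj act_comp !mulmxA.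
rewrite -(mulmxA _ (act v G)) mul_mx_adj mul_mx_scalar.
by rewrite -!scalemxAl; apply: prop_scale; rewrite det_act comp_poly2_eq0.
Qed.

Lemma gauge_comm u v G A B : u \Po v = v \Po u -> size u = 2 -> size v = 2 ->
  \det G != 0 -> prop (act v A *m B) (act u B *m A) ->
  prop (act v (gauge u G A) *m gauge v G B) (act u (gauge v G B) *m gauge u G A).
Proof.
move=> uv su sv G0 AB; apply: prop_trans (gauge_actM _ _ uv su sv G0) _.
apply: prop_sym; apply: prop_trans (gauge_actM _ _ (esym uv) sv su G0) _.
by rewrite uv; apply/prop_mulr/prop_mull/prop_sym.
Qed.

(** The product telescopes: inner factors G and adj(G) cancel up to a determinant and only the two
    ends survive. *)
Lemma gauge_coc u G A n : size u = 2 -> \det G != 0 ->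
  prop (coc u (gauge u G A) n) (gauge (itp u n) G (coc u A n)).
Proof.
move=> su G0; elim: n => [|n IH] /=.
  rewrite /gauge actX mulmx1 mul_adj_mx -[(\det G)%:M]scalemx1.
  exact/prop_sym/prop_scale.
apply: prop_trans (prop_mulr _ (prop_act su IH)) _.
rewrite /gauge !actM act_adj act_comp !mulmxA.
rewrite -(mulmxA _ (act u G)) mul_mx_adj mul_mx_scalar.
by rewrite -!scalemxAl; apply: prop_scale; rewrite det_act comp_poly2_eq0.
Qed.

Definition bounded_inf u A := exists N : nat, forall n, disp (@vinf K) (coc u A n) N%:Z.

(** A change of fibre coordinate replaces the standard vertex by another fixed one, so all
    displacements change by at most twice that of G. *)
Lemma bounded_gauge u G A : size u = 2 -> \det G != 0 -> \det A != 0 ->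
  bounded_inf u (gauge u G A) -> bounded_inf u A.
Proof.
move=> su G0 A0 [N hN]; have [M hM] := disp_inf_ex G0.
exists (M + (N + M))%N => n; rewrite !PoszD.
have hv := @vinf_valuation K; have c0 := det_coc n su A0.
have a0 : \det (\adj (act (itp u n) G)) != 0.
  by rewrite det_adj2 det_act comp_poly2_eq0 ?size_itp.
apply: disp_cancell (a0) (c0) _ _ => //; last first.
  by apply: disp_adj => //; apply/disp_inf_act; rewrite ?size_itp.
apply: disp_cancelr (G0) _ hM => //; first by rewrite det_mulmx mulf_neq0.
apply: disp_prop (gauge_coc A n su G0) (hN n) => //.
by rewrite det_coc ?det_gauge.
Qed.

Lemma bounded_square u A : size u = 2 -> \det A != 0 ->
  bounded_inf (u \Po u) (act u A *m A) -> bounded_inf u A.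
Proof.
move=> su A0 [N hN]; have hv := @vinf_valuation K.
have e n : coc (u \Po u) (act u A *m A) n = coc u A n.*2.
  by elim: n => //= n ->; rewrite actM !act_comp mulmxA.
have [M hM] := disp_inf_ex A0; exists (N + M)%N => n.
rewrite -(odd_double_half n); case: (odd n); rewrite ?add0n.
  rewrite add1n /= PoszD -e; apply: disp_mul => //.
    by rewrite det_act comp_poly2_eq0 // e det_coc.
  exact/disp_inf_act.
by rewrite -e; apply: disp_le (hN _) _; rewrite lez_nat leq_addr.
Qed.

(** With defect 0 the standard vertex is fixed by A, hence by all iterates. *)
Lemma bounded_unimodular u A n : size u = 2 -> \det A != 0 ->
  szle A n.+1 -> size (\det A) = n.*2.+1 -> bounded_inf u A.
Proof.
move=> su A0 hA e; have hv := @vinf_valuation K.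
have d0 : disp (@vinf K) A 0 by apply: disp_inf_size hA _; rewrite addn0.
exists 0%N; elim=> [|m IH]; first exact: disp_inf1.
rewrite -[0%N%:Z]addr0; apply: disp_mul => //; last exact/disp_inf_act.
by rewrite det_act comp_poly2_eq0 // det_coc.
Qed.

Definition topmx n A : 'M[K]_2 := map_mx (coefp n) A.

Lemma coefM_top n m p q : (size p <= n.+1)%N -> (size q <= m.+1)%N ->
  (p * q)`_(n + m) = p`_n * q`_m.
Proof.
move=> hp hq; rewrite coefM (bigD1 (inord n)) //= inordK ?ltnS ?leq_addr //.
rewrite addKn big1 ?addr0 // => i; rewrite -val_eqE /= inordK ?ltnS ?leq_addr // => ni.
have [lt|gt|e] := ltngtP i n; last by rewrite e eqxx in ni.
  rewrite [q`_ _]nth_default ?mulr0 //; apply: leq_trans hq _.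
  by move: lt; move: (nat_of_ord i) => k; lia.
by rewrite [p`_ _]nth_default ?mul0r //; apply: leq_trans hp _.
Qed.

Lemma topmxM n m A B : szle A n.+1 -> szle B m.+1 ->
  topmx (n + m) (A *m B) = topmx n A *m topmx m B.
Proof.
move=> hA hB; apply/matrixP => i j.
by rewrite mxE [RHS]mulmx2E /= mulmx2E coefD !coefM_top // !mxE.
Qed.

Lemma det_topmx n A : szle A n.+1 -> \det (topmx n A) = (\det A)`_(n.*2).
Proof. by move=> hA; rewrite !det2E coefB -addnn !coefM_top // !mxE. Qed.

(** Composition with u only rescales the leading matrix, which can therefore be treated as that of
    an ordinary endomorphism. *)
Lemma topmx_act n u A : size u = 2 -> szle A n.+1 ->
  topmx n (act u A) = lead_coef u ^+ n *: topmx n A.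
Proof.
move=> su hA; apply/matrixP => i j; rewrite !mxE /=.
have [lt|] := ltnP (size (A i j)) n.+1.
  by rewrite !nth_default ?mulr0 // size_comp_poly2.
move=> ge; have e : size (A i j) = n.+1 by apply/eqP; rewrite eqn_leq hA.
have <- : lead_coef (A i j) = (A i j)`_n by rewrite lead_coefE e.
have -> : (A i j \Po u)`_n = lead_coef (A i j \Po u).
  by rewrite lead_coefE size_comp_poly2 // e.
by rewrite lead_coef_comp ?su // e mulrC.
Qed.

Lemma topmx_gaugeC n u C A : topmx n (gauge u (map_mx polyC C) A) =
  \adj C *m topmx n A *m C.
Proof.
have ea : act u (map_mx polyC C) = map_mx polyC C.
  by apply/matrixP => i j; rewrite !mxE comp_polyC.
rewrite /gauge ea -map_mx_adj; move: (\adj C) => D.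
by apply/mx2P; rewrite mxE /= !mulmx2E !coefD; rewrite !mxE !(coefCM, coefMC, coefD, mulmx2E, mxE).
Qed.

Lemma szle_gaugeC n u C A : szle A n -> szle (gauge u (map_mx polyC C) A) n.
Proof.
move=> hA i j.
have ea : act u (map_mx polyC C) = map_mx polyC C.
  by apply/matrixP => i' j'; rewrite !mxE comp_polyC.
rewrite /gauge ea -map_mx_adj mulmx2E.
have le2 (a b : P) s : (size a <= s)%N -> (size b <= s)%N -> (size (a + b)%R <= s)%N.
  by move=> ha hb; apply: leq_trans (size_polyD _ _) _; rewrite geq_max ha hb.
have lC (a : P) c s : (size a <= s)%N -> (size (a * c%:P)%R <= s)%N.
  by move=> h; rewrite mulrC mul_polyC; apply: leq_trans (size_scale_leq _ _) h.
by apply: (le2); rewrite ![map_mx _ C _ _]mxE; apply: (lC); rewrite mulmx2E;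
  apply: (le2); rewrite ![map_mx _ (\adj C) _ _]mxE mulrC; apply: (lC).
Qed.

End Gauge.

(** * Conjugating singular 2x2 matrices *)

Section Normalize2.
Variable F : fieldType.
Implicit Types T C : 'M[F]_2.

Definition mx2 (R : nmodType) (a b c d : R) : 'M[R]_2 :=
  \matrix_(i, j) (if i == 0 then if j == 0 then a else b
                  else if j == 0 then c else d).

Lemma mx2E (R : nmodType) (a b c d : R) :
  [/\ mx2 a b c d 0 0 = a, mx2 a b c d 0 1 = b, mx2 a b c d 1 0 = c
    & mx2 a b c d 1 1 = d].
Proof. by split; rewrite mxE. Qed.

Lemma conj2E T C :
  [/\ (\adj C *m T *m C) 0 0 = (C 1 1 * T 0 0 - C 0 1 * T 1 0) * C 0 0
                             + (C 1 1 * T 0 1 - C 0 1 * T 1 1) * C 1 0,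
      (\adj C *m T *m C) 0 1 = (C 1 1 * T 0 0 - C 0 1 * T 1 0) * C 0 1
                             + (C 1 1 * T 0 1 - C 0 1 * T 1 1) * C 1 1,
      (\adj C *m T *m C) 1 0 = (C 0 0 * T 1 0 - C 1 0 * T 0 0) * C 0 0
                             + (C 0 0 * T 1 1 - C 1 0 * T 0 1) * C 1 0
    & (\adj C *m T *m C) 1 1 = (C 0 0 * T 1 0 - C 1 0 * T 0 0) * C 0 1
                             + (C 0 0 * T 1 1 - C 1 0 * T 0 1) * C 1 1].
Proof.
have [e1 e2 e3 e4] := adj2E C.
by split; rewrite !mulmx2E ?e1 ?e2 ?e3 ?e4; ring.
Qed.

(** T has rank one and its trace is its nonzero eigenvalue. The columns of C are an image vector and
    a kernel vector of T. *)
Lemma singular_diag T : \det T = 0 -> T 0 0 + T 1 1 != 0 ->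
  exists C, [/\ \det C != 0, (\adj C *m T *m C) 0 0 != 0,
    (\adj C *m T *m C) 0 1 = 0, (\adj C *m T *m C) 1 0 = 0
  & (\adj C *m T *m C) 1 1 = 0].
Proof.
rewrite det2E => /eqP; rewrite subr_eq0 => /eqP h tr.
suff [C [c0 c1 c2 c3 c4]] : exists C, [/\ \det C != 0,
    (\adj C *m T *m C) 0 0 = (T 0 0 + T 1 1) * \det C, (\adj C *m T *m C) 0 1 = 0,
    (\adj C *m T *m C) 1 0 = 0 & (\adj C *m T *m C) 1 1 = 0].
  by exists C; rewrite c1 mulf_neq0.
move: h tr; set a := T 0 0; set b := T 0 1; set c := T 1 0; set d := T 1 1 => h tr.
have [a0|a0] := eqVneq a 0; last first.
  have ed : d = b * c / a by rewrite -h mulrC mulKf.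
  exists (mx2 a b c (- a)).
  have [e1 e2 e3 e4] := conj2E T (mx2 a b c (- a)).
  have [f1 f2 f3 f4] := mx2E a b c (- a).
  rewrite e1 e2 e3 e4 det2E f1 f2 f3 f4 -/a -/b -/c -/d; split.
  - rewrite mulrN -h -opprD oppr_eq0 -mulrDr mulf_neq0 //.
  - by rewrite ed; field.
  - by rewrite ed; field.
  - by rewrite ed; field.
  - by rewrite ed; field.
(* Here the first column of T may vanish, but (b, d) does not, and spans the image. *)
rewrite a0 add0r in tr; exists (mx2 b d d (- c)).
have [e1 e2 e3 e4] := conj2E T (mx2 b d d (- c)).
have [f1 f2 f3 f4] := mx2E b d d (- c).
rewrite e1 e2 e3 e4 det2E f1 f2 f3 f4 -/a -/b -/c -/d a0.
have bc : b * c = 0 by rewrite -h a0 mul0r.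
split; [|move/eqP: bc; rewrite mulf_eq0 => /orP[]/eqP->; ring..].
by rewrite mulrN bc oppr0 sub0r oppr_eq0 mulf_neq0.
Qed.

(** Jordan form: T squares to zero, and the basis is T e_0, e_0 when T e_0 is nonzero; otherwise T
    already has the required shape. *)
Lemma nilpotent_norm T : \det T = 0 -> T 0 0 + T 1 1 = 0 -> T != 0 ->
  exists C, [/\ \det C != 0, (\adj C *m T *m C) 0 1 != 0,
    (\adj C *m T *m C) 0 0 = 0, (\adj C *m T *m C) 1 0 = 0
  & (\adj C *m T *m C) 1 1 = 0].
Proof.
rewrite det2E => /eqP; rewrite subr_eq0 => /eqP h /eqP; rewrite addrC addr_eq0 => /eqP tr.
move=> T0; move: h tr.
set a := T 0 0; set b := T 0 1; set c := T 1 0; set d := T 1 1 => h tr.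
have [c0|c0] := eqVneq c 0.
  have a0 : a = 0.
    by apply/eqP; rewrite -[_ == _]orbb -mulf_eq0 -[_ * a]opprK -mulrN -tr h c0 mulr0 oppr0.
  exists (mx2 1 0 0 1).
  have [e1 e2 e3 e4] := conj2E T (mx2 1 0 0 1); have [f1 f2 f3 f4] := mx2E (1 : F) 0 0 1.
  rewrite e1 e2 e3 e4 det2E f1 f2 f3 f4 -/a -/b -/c -/d tr c0 a0; split; try ring.
    by rewrite mulr0 subr0 mulr1 oner_neq0.
  rewrite !(mulr0, mul0r, mul1r, mulr1, subr0, add0r); apply: contraNneq T0 => b0.
  by apply/eqP/mx2P; rewrite mxE // -/a -/b -/c -/d ?tr ?a0 ?oppr0.
have eb : b = - (a * a) / c by apply: (mulIf c0); rewrite divfK // -h tr mulrN.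
exists (mx2 a 1 c 0).
have [e1 e2 e3 e4] := conj2E T (mx2 a 1 c 0); have [f1 f2 f3 f4] := mx2E a 1 c 0.
rewrite e1 e2 e3 e4 det2E f1 f2 f3 f4 -/a -/b -/c -/d tr eb; split.
- by rewrite mulr0 sub0r mul1r oppr_eq0.
- by rewrite !(mul0r, sub0r, mul1r, mulr0, addr0, mulr1) oppr_eq0.
- by field.
- by field.
- by ring.
Qed.

End Normalize2.

Section Bounded.
Variable K : closedFieldType.
Notation P := {poly K}.
Implicit Types (A B : 'M[P]_2) (u v p q : P) (C : 'M[K]_2).

Lemma size_le_coef0 p n : (size p <= n.+1)%N -> p`_n = 0 -> (size p <= n)%N.
Proof.
move=> /leq_sizeP h p0; apply/leq_sizeP => j; rewrite leq_eqVlt => /orP[/eqP<- //|].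
exact: h.
Qed.

Lemma size_eq_coef p n : (size p <= n.+1)%N -> p`_n != 0 -> size p = n.+1.
Proof.
move=> h p0; apply/eqP; rewrite eqn_leq h ltnNge; apply: contraNN p0 => h'.
by rewrite nth_default.
Qed.

Lemma size_mul_double p q n : (size p <= n.+1)%N -> (size q <= n.+1)%N ->
  (size (p * q)%R <= n.*2.+1)%N.
Proof.
move=> hp hq; apply: leq_trans (size_polyMleq _ _) _.
by move: hp hq; move: (size p) (size q) => a b; lia.
Qed.

Lemma size_det A n : szle A n.+1 -> (size (\det A) <= n.*2.+1)%N.
Proof.
move=> hA; rewrite det2E; apply: leq_trans (size_polyD _ _) _.
by rewrite geq_max size_polyN !size_mul_double.
Qed.

Lemma det_gaugeC u C A : size u = 2 -> \det C != 0 ->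
  exists2 c, c != 0 & \det (gauge u (map_mx polyC C) A) = c%:P * \det A.
Proof.
move=> su C0; exists (\det C * \det C); first by rewrite mulf_neq0.
rewrite !det_mulmx det_adj2 det_act det_map_mx comp_polyC polyCM /=.
by rewrite mulrAC.
Qed.

Lemma gauge_diagX u A : let D := mx2 'X 0 0 1 in
  [/\ gauge u D A 0 0 = A 0 0 * 'X, gauge u D A 0 1 = A 0 1,
   gauge u D A 1 0 = u * A 1 0 * 'X & gauge u D A 1 1 = u * A 1 1].
Proof.
move=> D; have [d1 d2 d3 d4] := mx2E ('X : P) 0 0 1; rewrite -/D in d1 d2 d3 d4.
have [g1 g2 g3 g4] := adj2E (act u D).
rewrite /gauge !mulmx2E g1 g2 g3 g4 !actE d1 d2 d3 d4.
by rewrite comp_polyX comp_poly0 -[1]/(1%:P) comp_polyC; split; ring.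
Qed.

(* Induction on the defect k of the degree of det A: the leading matrix is    *)
(* singular if k > 0, and no_translation excludes a nonzero eigenvalue. When  *)
(* it is nilpotent, f^2 has defect 0 if k = 1, and the gauge by diag(x, 1)    *)
(* lowers k if k > 1.                                                         *)
Lemma bounded_infinity k n A B u v : affine_indep u v ->
  \det A != 0 -> \det B != 0 -> prop (act v A *m B) (act u B *m A) ->
  szle A n.+1 -> (size (\det A) + k)%N = n.*2.+1 -> bounded_inf u A.
Proof.
move=> uv; have [su sv] := affine_indep_size uv; have cuv := affine_indep_comm uv.
elim/ltn_ind: k n A B => k IH n A B A0 B0 AB hA ek.
have sA : (0 < size (\det A))%N by rewrite size_poly_gt0.
have [k0|kpos] := posnP k.
  by apply: bounded_unimodular hA _ => //; rewrite -ek k0 addn0.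
have detT : \det (topmx n A) = 0.
  rewrite det_topmx // nth_default //.
  by move: ek kpos; move: (size (\det A)) => s; lia.
have gaugeC C : \det C != 0 -> \det (map_mx polyC C) != 0.
  by rewrite det_map_mx polyC_eq0.
have [T0|Tn0] := eqVneq (topmx n A) 0.
  (* A zero leading matrix lets the degree bound drop by one, and the defect by two. *)
  case: n => [|n] in hA ek detT T0 *.
    move: A0; rewrite det2E.
    have z i j : A i j = 0.
      apply/eqP; rewrite -size_poly_leq0; apply: size_le_coef0; first exact: hA.
      by have := congr1 (fun X : 'M_2 => X i j) T0; rewrite !mxE.
    by rewrite !z mulr0 subrr eqxx.
  have hA' : szle A n.+1.
    move=> i j; apply: size_le_coef0; first exact: hA.
    by have := congr1 (fun X : 'M_2 => X i j) T0; rewrite !mxE.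
  apply: (IH k.-2 _ n A B) => //.
    by move: kpos; lia.
  by have := size_det hA'; move: ek kpos; move: (size (\det A)) => s; lia.
have [tr0|trn0] := eqVneq (topmx n A 0 0 + topmx n A 1 1) 0; last first.
  have [C [C0]] := singular_diag detT trn0.
  rewrite -(topmx_gaugeC n u C A) => c00 c01 c10 c11; exfalso.
  have hA' := szle_gaugeC u C hA.
  have [c cn0 ec] := det_gaugeC A su C0.
  move: c00 c01 c10 c11; rewrite ![topmx _ _ _ _]mxE /= => c00 c01 c10 c11.
  apply: (@no_translation _ u v (gauge u (map_mx polyC C) A)
    (gauge v (map_mx polyC C) B) n) => //.
  - exact/det_gauge/A0/gaugeC.
  - exact/det_gauge/B0/gaugeC.
  - exact/gauge_comm/AB/gaugeC.
  - exact: size_eq_coef (hA' _ _) c00.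
  - exact: size_le_coef0 (hA' _ _) c01.
  - exact: size_le_coef0 (hA' _ _) c10.
  - exact: size_le_coef0 (hA' _ _) c11.
  - rewrite ec size_Cmul //.
    by move: ek kpos; move: (size (\det A)) => s; lia.
have [k1|k2] : k = 1%N \/ (2 <= k)%N by move: kpos; lia.
  case: n => [|n] in hA ek detT Tn0 tr0 *.
    by move: ek sA; rewrite k1; move: (size (\det A)) => s; lia.
  apply: bounded_square => //.
  (* As the leading matrix squares to zero, the entries for f^2 have degree at most 2(n+1) - 1,
     while the determinant has exactly twice that degree. *)
  apply: (@bounded_unimodular _ _ _ (n + n.+1)).
  - by rewrite size_comp_poly2.
  - by rewrite det_mulmx mulf_neq0 // det_act comp_poly2_eq0.
  - have hu : szle (act u A) n.+2 by move=> i j; rewrite actE size_comp_poly2.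
    have T2 : topmx (n.+1 + n.+1) (act u A *m A) = 0.
      rewrite topmxM // topmx_act // -scalemxAl.
      suff -> : topmx n.+1 A *m topmx n.+1 A = 0 by rewrite scaler0.
      set T := topmx n.+1 A in detT tr0 *.
      have e : T 1 1 = - T 0 0 by apply/eqP; rewrite -addr_eq0 addrC tr0.
      have e' : T 0 0 * T 0 0 + T 0 1 * T 1 0 = 0.
        by have := detT; rewrite det2E e => h; rewrite -[RHS]oppr0 -h; ring.
      by apply/mx2P; rewrite mulmx2E [RHS]mxE ?e; try ring; rewrite -[RHS]e'; ring.
    move=> i j; rewrite -addSn; apply: size_le_coef0; last first.
      by have := congr1 (fun X : 'M_2 => X i j) T2; rewrite mxE [RHS]mxE.
    rewrite mulmx2E; apply: leq_trans (size_polyD _ _) _; rewrite geq_max.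
    by rewrite addnn !size_mul_double.
  rewrite det_mulmx size_mul ?det_act ?comp_poly2_eq0 // size_comp_poly2 //.
  by move: ek; rewrite k1; move: (size (\det A)) => s; lia.
have [C [C0]] := nilpotent_norm detT tr0 Tn0.
rewrite -(topmx_gaugeC n u C A) => c01 c00 c10 c11.
set A' := gauge u (map_mx polyC C) A in c00 c01 c10 c11.
set B' := gauge v (map_mx polyC C) B.
have hA' : szle A' n.+1 by apply: szle_gaugeC.
have [c cn0 ec] := det_gaugeC A su C0; rewrite -/A' in ec.
have A'0 : \det A' != 0 by apply/det_gauge/A0 => //; apply: gaugeC.
have B'0 : \det B' != 0 by apply/det_gauge/B0 => //; apply: gaugeC.
have AB' : prop (act v A' *m B') (act u B' *m A').
  by apply/gauge_comm/AB => //; apply: gaugeC.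
apply: (bounded_gauge su (gaugeC C C0) A0); rewrite -/A'.
pose D : 'M[P]_2 := mx2 'X 0 0 1; have [d1 d2 d3 d4] := mx2E ('X : P) 0 0 1.
have D0 : \det D != 0 by rewrite det2E d1 d2 d3 d4 mulr1 mulr0 subr0 polyX_eq0.
apply: (bounded_gauge su D0 A'0).
have eD := gauge_diagX u A'; rewrite -/D in eD.
move: c00 c01 c11; rewrite ![topmx _ _ _ _]mxE /= => c00 c01 c11.
have s00 : (size (A' 0%R 0%R) <= n)%N by apply: size_le_coef0 (hA' _ _) c00.
have s11 : (size (A' 1%R 1%R) <= n)%N by apply: size_le_coef0 (hA' _ _) c11.
have s01 : size (A' 0%R 1%R) = n.+1 by apply: size_eq_coef (hA' _ _) c01.
(* Since A'_01 has full degree n, the formula for the determinant pushes A'_10 two degrees below n.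
   This leaves room for the factor u X that the gauge by diag(X, 1) puts on that entry. *)
have s10 : (size (A' 1%R 0%R) <= n.-1)%N.
  have [->|z] := eqVneq (A' 1 0) 0; first by rewrite size_poly0.
  have e : A' 0 1 * A' 1 0 = A' 0 0 * A' 1 1 - \det A' by rewrite det2E opprB addrC subrK.
  have : (size (A' 0%R 1%R * A' 1%R 0%R)%R <= n.*2.-1)%N.
    rewrite e; apply: leq_trans (size_polyD _ _) _; rewrite geq_max size_polyN.
    apply/andP; split.
      apply: leq_trans (size_polyMleq _ _) _; move: s00 s11.
      by move: (size (A' 0 0)) (size (A' 1 1)) => a b; lia.
    by rewrite ec size_Cmul //; move: ek k2; move: (size (\det A)) => s; lia.
  rewrite size_mul //; last by rewrite -size_poly_gt0 s01.
  by rewrite s01; move: z; rewrite -size_poly_gt0; move: (size (A' 1 0)) => s; lia.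
have [eD1 eD2 eD3 eD4] := eD.
apply: (IH k.-2 _ n (gauge u D A') (gauge v D B')).
- by move: k2; lia.
- exact: det_gauge.
- exact: det_gauge.
- exact: gauge_comm.
- move=> i j; case: (ord2P i) => ->; case: (ord2P j) => ->; rewrite ?eD1 ?eD2 ?eD3 ?eD4.
  + by apply: leq_trans (size_polyMleq _ _) _; rewrite size_polyX addn2.
  + exact: hA'.
  + apply: leq_trans (size_polyMleq _ _) _; rewrite size_polyX addn2 /=.
    have [->|z] := eqVneq (A' 1 0) 0; first by rewrite mulr0 size_poly0.
    apply: (@leq_ltn_trans n) => //; apply: leq_trans (size_polyMleq _ _) _.
    rewrite su; move: s10; rewrite -size_poly_gt0 in z; move: z.
    by move: (size (A' 1 0)) => s; lia.
  + apply: leq_trans (size_polyMleq _ _) _; rewrite su add2n /=.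
    by rewrite ltnS.
have -> : \det (gauge u D A') = u * \det A' * 'X.
  by rewrite det2E eD1 eD2 eD3 eD4 det2E; ring.
have u0 : u != 0 by rewrite -size_poly_gt0 su.
rewrite size_mulX ?mulf_neq0 // size_mul // su ec size_Cmul //.
by move: ek k2 sA; move: (size (\det A)) => s; lia.
Qed.

End Bounded.

(** * The place at zero *)

Section Reversal.
Variable K : closedFieldType.
Notation P := {poly K}.
Implicit Types (A B : 'M[P]_2) (u v p q : P).

(** If r = p - q were nonzero, r X + 1 would have a root z. It is not 0, so r(z) = 0, which
    contradicts r(z) z = -1. *)
Lemma poly_eq_nonzero p q : (forall z, z != 0 -> p.[z] = q.[z]) -> p = q.
Proof.
move=> h; apply/eqP; rewrite -subr_eq0; apply/negPn/negP => r0.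
set r := p - q in r0.
have s : size (r * 'X + 1%:P) != 1.
  by rewrite size_MXaddC (negPf r0) eqSS size_poly_eq0.
have [z] := closed_rootP _ s; rewrite rootE hornerD hornerM hornerX hornerC.
have [->|z0] := eqVneq z 0; first by rewrite mulr0 add0r oner_eq0.
by rewrite hornerD hornerN h // subrr mul0r add0r oner_eq0.
Qed.

(** This is X^n p(1/X) when p has degree at most n, so it exchanges the places 0 and infinity. *)
Definition rev_poly n p : P := \poly_(i < n.+1) p`_(n - i).

Lemma size_rev n p : (size (rev_poly n p) <= n.+1)%N.
Proof. exact: size_poly. Qed.

Lemma rev_is_additive n : {morph rev_poly n : p q / p + q}.
Proof.
move=> p q; apply/polyP => i; rewrite coefD !coef_poly.
by case: ifP => _; rewrite ?coefD ?addr0.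
Qed.

Lemma horner_rev n p z : (size p <= n.+1)%N -> z != 0 ->
  (rev_poly n p).[z] = z ^+ n * p.[z^-1].
Proof.
move=> hp z0; rewrite horner_poly (horner_coef_wide _ hp) mulr_sumr.
rewrite (reindex_inj rev_ord_inj) /=; apply: eq_bigr => i _.
have le : (i <= n)%N by rewrite -ltnS.
rewrite subSS subKn // [RHS]mulrCA; congr (_ * _).
by apply: (mulIf (expf_neq0 i z0)); rewrite -exprD subnK // exprVn divfK ?expf_neq0.
Qed.

Lemma rev_mul n m p q : (size p <= n.+1)%N -> (size q <= m.+1)%N ->
  rev_poly (n + m) (p * q) = rev_poly n p * rev_poly m q.
Proof.
move=> hp hq; apply: poly_eq_nonzero => z z0.
have hpq : (size (p * q)%R <= (n + m).+1)%N.
  apply: leq_trans (size_polyMleq _ _) _.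
  by move: hp hq; move: (size p) (size q) => a b; lia.
by rewrite hornerM !horner_rev // hornerM exprD mulrACA.
Qed.

Lemma rev_scale n a p : a != 0 -> (size p <= n.+1)%N ->
  rev_poly n (p \Po (a *: 'X)) = a ^+ n *: (rev_poly n p \Po (a^-1 *: 'X)).
Proof.
move=> a0 hp; apply: poly_eq_nonzero => z z0.
have su : size (a *: 'X : P) = 2 by rewrite size_scale // size_polyX.
rewrite horner_rev ?size_comp_poly2 // hornerZ !horner_comp !hornerZ !hornerX.
rewrite horner_rev ?mulf_neq0 ?invr_neq0 // invfM invrK exprMn exprVn.
by rewrite -mulrA mulVKf ?expf_neq0.
Qed.

(** The order of vanishing at 0 is the drop in degree of the reversal. This matches [vmup 0] with
    [vinf]. *)
Lemma size_rev_mup n p : p != 0 -> (size p <= n.+1)%N ->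
  (size (rev_poly n p) + mup 0 p)%N = n.+1.
Proof.
move=> p0; have [m [q]] := multiplicity_XsubC p 0; rewrite p0 /= subr0 => q0 ep.
have qn0 : q != 0 by apply: contraNneq q0 => ->; rewrite root0.
have q0' : q`_0 != 0 by rewrite -horner_coef0 -rootE.
rewrite ep mupMr // -[X in mup _ (X ^+ _)]subr0 -[X in _ - X]/(0%:P) mup_XsubCX eqxx.
rewrite size_mulXn // => hm.
have sq : (size q <= (n - m).+1)%N by move: hm; move: (size q) => s; lia.
have mn : (m <= n)%N by move: hm; rewrite -size_poly_gt0 in qn0; move: qn0; move: (size q) => s; lia.
rewrite -{1}(subnK mn) rev_mul ?size_polyXn //.
have -> : rev_poly m 'X^m = 1.
  apply: poly_eq_nonzero => z z0.
  by rewrite horner_rev ?size_polyXn // !hornerE exprVn divff ?expf_neq0.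
rewrite mulr1; suff -> : size (rev_poly (n - m) q) = (n - m).+1 by rewrite addSn subnK.
by apply: size_eq_coef; rewrite ?size_rev // coef_poly ltnSn subnn.
Qed.

Lemma rev_neq0 n p : p != 0 -> (size p <= n.+1)%N -> rev_poly n p != 0.
Proof.
move=> p0 hp; have := size_rev_mup p0 hp; rewrite -size_poly_gt0 => h.
rewrite lt0n; apply: contraPN h => /eqP->; rewrite add0n => h.
have := p0; have := mup_geq 0 n.+1 p0; rewrite h leqnn => /esym d.
move=> p0'; have := dvdp_leq p0' d; rewrite size_exp_XsubC ltnNge hp //.
Qed.

Definition rev_mx n A : 'M[P]_2 := map_mx (rev_poly n) A.

Lemma rev_mxM n m A B : szle A n.+1 -> szle B m.+1 ->
  rev_mx (n + m) (A *m B) = rev_mx n A *m rev_mx m B.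
Proof.
move=> hA hB; apply/matrixP => i j.
rewrite mxE [LHS](congr1 (rev_poly _) (mulmx2E _ _ _ _)) [RHS]mulmx2E.
by rewrite rev_is_additive !rev_mul // !mxE.
Qed.

Lemma rev_mxZ n m p A : (size p <= n.+1)%N -> szle A m.+1 ->
  rev_mx (n + m) (p *: A) = rev_poly n p *: rev_mx m A.
Proof. by move=> hp hA; apply/matrixP => i j; rewrite !mxE rev_mul. Qed.

Lemma rev_opp n p : rev_poly n (- p) = - rev_poly n p.
Proof.
by apply/polyP => i; rewrite coefN !coef_poly; case: ifP => _; rewrite ?coefN ?oppr0.
Qed.

Lemma det_rev_mx n A : szle A n.+1 -> \det (rev_mx n A) = rev_poly (n + n) (\det A).
Proof.
by move=> hA; rewrite !det2E rev_is_additive rev_opp !rev_mul // !mxE.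
Qed.

Lemma rev_mx_act n a A : a != 0 -> szle A n.+1 ->
  rev_mx n (act (a *: 'X) A) = (a ^+ n)%:P *: act (a^-1 *: 'X) (rev_mx n A).
Proof.
by move=> a0 hA; apply/matrixP => i j; rewrite !mxE rev_scale // mul_polyC.
Qed.

Lemma szle_mul n m A B : szle A n.+1 -> szle B m.+1 -> szle (A *m B) (n + m).+1.
Proof.
move=> hA hB i j; rewrite mulmx2E.
apply: leq_trans (size_polyD _ _) _; rewrite geq_max.
have h p q : (size p <= n.+1)%N -> (size q <= m.+1)%N -> (size (p * q)%R <= (n + m).+1)%N.
  move=> hp hq; apply: leq_trans (size_polyMleq _ _) _.
  by move: hp hq; move: (size p) (size q) => a b; lia.
by rewrite !h.
Qed.

Lemma szle_act u n A : size u = 2 -> szle A n -> szle (act u A) n.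
Proof. by move=> su hA i j; rewrite actE size_comp_poly2. Qed.

Lemma szle_coc u n A k : size u = 2 -> szle A n.+1 -> szle (coc u A k) (k * n).+1.
Proof.
move=> su hA; elim: k => [|k IH] /=.
  by move=> i j; rewrite mxE; case: (i == j); rewrite ?size_poly1 ?size_poly0.
by rewrite mulSn addnC; apply: szle_mul => //; apply: szle_act.
Qed.

Lemma rev_coc a n A k : a != 0 -> szle A n.+1 ->
  prop (coc (a^-1 *: 'X) (rev_mx n A) k) (rev_mx (k * n) (coc (a *: 'X) A k)).
Proof.
move=> a0 hA; have su c : c != 0 -> size (c *: 'X : P) = 2.
  by move=> c0; rewrite size_scale // size_polyX.
elim: k => [|k IH] /=.
  suff -> : rev_mx (0 * n) 1%:M = 1%:M by apply: prop_refl.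
  have r0 c : rev_poly 0 c%:P = c%:P.
    by apply/polyP => -[|i]; rewrite coef_poly !coefC.
  by apply/matrixP => i j; rewrite !mxE; case: (i == j);
    [apply: (r0 1) | apply: (r0 0)].
rewrite mulSn addnC rev_mxM //; last by apply: szle_act; rewrite ?su //; apply: szle_coc; rewrite ?su.
apply: prop_mulr; rewrite rev_mx_act //; last by apply: szle_coc; rewrite ?su.
apply: prop_trans (prop_sym (prop_scale _ _)); last by rewrite polyC_eq0 expf_neq0.
by apply: prop_act => //; rewrite su ?invr_neq0.
Qed.

Lemma disp_rev n A N : \det A != 0 -> szle A n.+1 ->
  disp (@vinf K) (rev_mx n A) N -> disp (vmup 0) A N.
Proof.
move=> A0 hA h i j k l a b.
have := h i j k l; rewrite !mxE det_rev_mx // !rev_neq0 // => /(_ isT isT).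
have hd : (size (\det A) <= (n + n).+1)%N by rewrite addnn; apply: size_det.
have := size_rev_mup A0 hd; have := size_rev_mup a (hA i j); have := size_rev_mup b (hA k l).
rewrite /vinf /vmup.
move: (size (rev_poly _ (\det A))) (size (rev_poly n (A i j))) (size (rev_poly n (A k l))).
move: (mup 0 (\det A)) (mup 0 (A i j)) (mup 0 (A k l)) => x y z s t r.
lia.
Qed.

(** The coordinate 1/X turns the scalings into those by the inverse factors, still independent, and
    the place 0 into infinity, where [bounded_infinity] applies. *)
Lemma bounded_zero a b A B : a != 0 -> b != 0 ->
  (forall i j i' j', a ^+ i * b ^+ j = a ^+ i' * b ^+ j' -> i = i' /\ j = j') ->
  let u := a *: 'X in let v := b *: 'X in
  \det A != 0 -> \det B != 0 -> prop (act v A *m B) (act u B *m A) ->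
  exists N : nat, forall n, disp (vmup 0) (coc u A n) N%:Z.
Proof.
move=> a0 b0 ind u v A0 B0 AB.
have su c : c != 0 -> size (c *: 'X : P) = 2.
  by move=> c0; rewrite size_scale // size_polyX.
have [n [_ [_ [hA _]]]] := max_size A0; have [m [_ [_ [hB _]]]] := max_size B0.
have A'0 : \det (rev_mx n A) != 0.
  by rewrite det_rev_mx // rev_neq0 // addnn; apply: size_det.
have B'0 : \det (rev_mx m B) != 0.
  by rewrite det_rev_mx // rev_neq0 // addnn; apply: size_det.
have hi : affine_indep (a^-1 *: 'X) (b^-1 *: 'X : P).
  left; exists a^-1, b^-1; rewrite !invr_neq0 //; split=> // i j i' j'.
  by rewrite !exprVn -!invfM => /invr_inj/ind.
have AB' : prop (act (b^-1 *: 'X) (rev_mx n A) *m rev_mx m B)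
               (act (a^-1 *: 'X) (rev_mx m B) *m rev_mx n A).
  apply: (@prop_trans _ _ (rev_mx (n + m) (act v A *m B))).
    rewrite rev_mxM //; last by apply: szle_act; rewrite ?su.
    rewrite rev_mx_act // -scalemxAl; apply/prop_sym/prop_scale.
    by rewrite polyC_eq0 expf_neq0.
  apply: (@prop_trans _ _ (rev_mx (n + m) (act u B *m A))); last first.
    rewrite addnC rev_mxM //; last by apply: szle_act; rewrite ?su.
    rewrite rev_mx_act // -scalemxAl; apply/prop_scale.
    by rewrite polyC_eq0 expf_neq0.
  case: AB => p [q [p0 q0 e]]; exists (rev_poly (size p + size q) p), (rev_poly (size p + size q) q).
  rewrite !rev_neq0 ?(leq_trans _ (leqnSn _)) ?leq_addl ?leq_addr //; split=> //.
  rewrite -!rev_mxZ ?(leq_trans _ (leqnSn _)) ?leq_addl ?leq_addr ?e //.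
    by rewrite addnC; apply: szle_mul => //; apply: szle_act; rewrite ?su.
  by apply: szle_mul => //; apply: szle_act; rewrite ?su.
have sd : (size (\det (rev_mx n A)) + (n.*2.+1 - size (\det (rev_mx n A))) = n.*2.+1)%N.
  by rewrite subnKC // size_det // => i j; rewrite mxE size_rev.
have [|N hN] := bounded_infinity hi A'0 B'0 AB' _ sd.
  by move=> i j; rewrite mxE size_rev.
exists N => k; apply: (@disp_rev (k * n)).
- by rewrite det_coc ?su.
- by apply: szle_coc; rewrite ?su.
apply: disp_prop (rev_coc k a0 hA) (hN k); first exact: vinf_valuation.
by rewrite det_coc // su ?invr_neq0.
Qed.

End Reversal.

(** * The invariant space of quadratic forms *)

Section Basis.
Variable K : closedFieldType.
Notation P := {poly K}.

Definition lincomb n (w : 'I_n -> 'M[P]_2) (c : 'I_n -> K) : 'M[P]_2 :=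
  \sum_i (c i)%:P *: w i.

Lemma lincombE n (w : 'I_n -> 'M[P]_2) c i j k :
  (lincomb w c i j)`_k = \sum_l c l * (w l i j)`_k.
Proof.
rewrite summxE coef_sum; apply: eq_bigr => l _.
by rewrite mxE coefCM.
Qed.

(** The basis is drawn from Q itself: a family in Q of maximal rank, which exists because bounded
    degree leaves finitely many coefficients. The nonzero [w0] makes it nonempty. *)
Lemma span_basis (Q : 'M[P]_2 -> Prop) N w0 : (forall w, Q w -> szle w N.+1) ->
  Q w0 -> w0 != 0 ->
  exists n (w : 'I_n.+1 -> 'M[P]_2), [/\ forall i, Q (w i),
    forall c, lincomb w c = 0 -> forall i, c i = 0
  & forall x, Q x -> exists c, x = lincomb w c].
Proof.
move=> hQ Qw0 w00; pose T : finType := ('I_2 * 'I_2 * 'I_N.+1)%type.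
pose enc (x : 'M[P]_2) : 'rV[K]_#|T| := \row_(k < #|T|)
  (x (enum_val k).1.1 (enum_val k).1.2)`_((enum_val k).2).
have encE x i j (k : 'I_N.+1) : enc x 0 (enum_rank (i, j, k)) = (x i j)`_k.
  by rewrite mxE enum_rankK.
have enc_inj x y : szle x N.+1 -> szle y N.+1 -> enc x = enc y -> x = y.
  move=> hx hy e; apply/matrixP => i j; apply/polyP => k.
  have [lt|ge] := ltnP k N.+1; last by rewrite !nth_default // (leq_trans _ ge).
  by rewrite -!(encE _ _ _ (Ordinal lt)) e.
pose good r := exists M : 'M[K]_(r, #|T|), row_free M /\
  forall i, exists2 x, Q x & row i M = enc x.
have good0 : exists r, `[< good r >].
  exists 0%N; apply/asboolP; exists 0; split; last by case.
  by rewrite /row_free mxrank0.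
have goodb r : `[< good r >] -> (r <= #|T|)%N.
  by move/asboolP=> [M [/eqP e _]]; move: (rank_leq_col M); rewrite e.
case: (ex_maxnP good0 goodb) => r /asboolP[M [fM hM]] rmax.
have inM x : Q x -> (enc x <= M)%MS.
  move=> Qx; apply/negPn/negP => nin.
  suff : good (r + 1)%N by move/asboolP/rmax; rewrite addn1 ltnn.
  exists (col_mx M (enc x)); split; last first.
    move=> i; rewrite -(splitK i); case: (split i) => k /=.
      by rewrite rowKu; apply: hM.
    by exists x => //; rewrite rowKd (ord1 k) row_id.
  apply/inj_row_free => c; rewrite -[c]hsubmxK mul_row_col.
  set a := lsubmx c; set b := rsubmx c => e.
  have b0 : b = 0.
    apply/eqP/negPn/negP => bn0; move/negP: nin; apply.
    have eb : b *m enc x = b 0 0 *: enc x.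
      by rewrite {1}[b]mx11_scalar mul_scalar_mx.
    have bn : b 0 0 != 0 by apply: contraNneq bn0 => z; rewrite [b]mx11_scalar z -scalemx1 scale0r.
    have -> : enc x = (- (b 0 0)^-1 *: a) *m M.
      rewrite -scalemxAl; apply: (scalerI bn); rewrite scalerA mulrN divff // scaleN1r.
      by apply/eqP; rewrite -subr_eq0 opprK -eb addrC; apply/eqP.
    exact: submxMl.
  move: e; rewrite b0 mul0mx addr0 => /eqP.
  by rewrite mulmx_free_eq0 // => /eqP->; rewrite row_mx0.
have hM' i : exists x, Q x /\ row i M = enc x by have [x] := hM i; exists x.
have [w hw] := boolp.choice hM'.
have encL c : enc (lincomb w c) = (\row_i c i) *m M.
  apply/rowP => k; rewrite !mxE lincombE; apply: eq_bigr => l _.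
  have := congr1 (fun X : 'rV_ _ => X 0 k) (proj2 (hw l)).
  by rewrite !mxE => ->.
have szL c : szle (lincomb w c) N.+1.
  move=> i j; apply/leq_sizeP => k hk; rewrite lincombE big1 // => l _.
  by rewrite nth_default ?mulr0 //; apply: leq_trans hk; apply: hQ; case: (hw l).
have span x : Q x -> exists c, x = lincomb w c.
  move=> Qx; have /submxP[c ec] := inM x Qx; exists (c 0).
  apply: enc_inj => //; first exact: hQ.
  by rewrite encL ec; congr (_ *m M); apply/rowP => i; rewrite mxE.
case: r => [|r] in M fM hM hM' w hw encL szL span inM {rmax} *.
  by have [c e] := span _ Qw0; rewrite e /lincomb big_ord0 eqxx in w00.
exists r, w; split=> //; first by move=> i; case: (hw i).
move=> c c0 i; have := encL c; rewrite c0.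
have -> : enc 0 = 0 by apply/rowP => k; rewrite !mxE coef0.
move=> /esym/eqP; rewrite mulmx_free_eq0 // => /eqP/rowP/(_ i).
by rewrite !mxE.
Qed.

End Basis.

(** * Common denominators for the transforms of quadratic forms *)

Section InvariantSpan.
Variable K : closedFieldType.
Notation P := {poly K}.
Implicit Types (A B X : 'M[P]_2) (u v p q : P).

Lemma dvdp_mup p q : p != 0 -> q != 0 ->
  (forall b, (mup b p <= mup b q)%N) -> p %| q.
Proof.
move=> p0 q0 h; have [r e] := closed_field_poly_normal p.
have hr b : (count_mem b r <= mup b q)%N.
  by have := h b; rewrite {1}e -mul_polyC mupMr ?mu_prod_XsubC // rootC lead_coef_eq0.
rewrite e dvdpZl ?lead_coef_eq0 //; move: q q0 hr {h e}.
elim: r => [|z r IH] q q0 hr; first by rewrite big_nil dvd1p.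
have : ('X - z%:P) %| q.
  by rewrite XsubC_dvd // (leq_trans _ (hr z)) //= eqxx.
case/dvdpP => q' eq; rewrite big_cons eq mulrC dvdp_mul2r ?polyXsubC_eq0 //.
have q'0 : q' != 0 by apply: contraNneq q0 => q'0; rewrite eq q'0 mul0r.
apply: IH => // b; have := hr b.
by rewrite eq mupM ?polyXsubC_eq0 // (@mup_XsubCX _ 1) /=; case: (z == b); lia.
Qed.

Definition joint u v n m : P := itp u n \Po itp v m.

Lemma size_joint u v n m : size u = 2 -> size v = 2 -> size (joint u v n m) = 2.
Proof. by move=> su sv; rewrite size_comp_poly2 ?size_itp. Qed.

Lemma mup_joint u v n m b p : p != 0 -> size u = 2 -> size v = 2 ->
  mup b (p \Po joint u v n m) = mup (pt u n (pt v m b)) p.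
Proof.
by move=> *; rewrite mup_comp ?size_joint // horner_comp !horner_itp.
Qed.

(** Scalings have free orbits outside 0, translations everywhere. At 0, which u fixes,
    [bounded_zero] bounds both legs of the path. *)
Lemma special_places u v A B : affine_indep u v -> \det A != 0 -> \det B != 0 ->
  prop (act v A *m B) (act u B *m A) ->
  exists (Z : seq K) (N : nat), forall b, free u v b \/
    (b \in Z /\ forall n m, disp (vmup b) (coc2 u v A B n m) N%:Z).
Proof.
move=> uv A0 B0 AB; case: (uv) => [[a [b [a0 b0 eu ev ind]]]|[c [d [eu ev ind]]]].
  have ind' i j i' j' : b ^+ i * a ^+ j = b ^+ i' * a ^+ j' -> i = i' /\ j = j'.
    by rewrite ![b ^+ _ * _]mulrC => /ind[].
  have [N hN] : exists N : nat, forall n, disp (vmup 0) (coc u A n) N%:Z.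
    by rewrite eu; apply: (bounded_zero a0 b0 ind A0 B0); rewrite -eu -ev.
  have [M hM] : exists M : nat, forall n, disp (vmup 0) (coc v B n) M%:Z.
    rewrite ev; apply: (bounded_zero b0 a0 ind' B0 A0); rewrite -eu -ev.
    exact: prop_sym.
  have [su sv] := affine_indep_size uv.
  have ptu n x : pt u n x = a ^+ n * x.
    by elim: n => [|n IH]; rewrite ?mul1r //= IH eu hornerZ hornerX exprS mulrA.
  have ptv n x : pt v n x = b ^+ n * x.
    by elim: n => [|n IH]; rewrite ?mul1r //= IH ev hornerZ hornerX exprS mulrA.
  exists [:: 0], (M + N)%N => x; have [->|x0] := eqVneq x 0.
    right; rewrite inE eqxx; split=> // n m; rewrite PoszD.
    apply: disp_mul => //; first exact: vmup_valuation.
    - by rewrite det_act comp_poly2_eq0 ?size_itp // det_coc.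
    - exact: det_coc.
    apply/disp_mup_act; rewrite ?size_itp ?det_coc // horner_itp -/(pt u n 0).
    by rewrite ptu mulr0.
  left=> i j i' j'; rewrite !ptu !ptv !mulrA => /(mulIf x0); exact: ind.
have ptu n x : pt u n x = x + c *+ n.
  by elim: n => [|n IH]; rewrite ?addr0 //= IH eu hornerD hornerX hornerC mulrSr addrA.
have ptv n x : pt v n x = x + d *+ n.
  by elim: n => [|n IH]; rewrite ?addr0 //= IH ev hornerD hornerX hornerC mulrSr addrA.
exists [::], 0%N => x; left=> i j i' j'.
by rewrite !ptu !ptv -!addrA => /addrI; rewrite ![d *+ _ + _]addrC; apply: ind.
Qed.

Lemma affine_indep_sym u v : affine_indep u v -> affine_indep v u.
Proof.
case=> [[a [b [a0 b0 eu ev ind]]]|[c [d [eu ev ind]]]]; [left|right].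
  exists b, a; split=> // i j i' j'; rewrite ![b ^+ _ * _]mulrC => /ind[]; by split.
by exists d, c; split=> // i j i' j'; rewrite ![d *+ _ + _]addrC => /ind[]; split.
Qed.

Lemma bounded_infinity2 u v A B : affine_indep u v -> \det A != 0 -> \det B != 0 ->
  prop (act v A *m B) (act u B *m A) ->
  exists N : nat, forall n m, disp (@vinf K) (coc2 u v A B n m) N%:Z.
Proof.
have one u' v' A' B' : affine_indep u' v' -> \det A' != 0 -> \det B' != 0 ->
    prop (act v' A' *m B') (act u' B' *m A') -> bounded_inf u' A'.
  move=> uv A0 B0 AB; have [n [_ [_ [hA _]]]] := max_size A0.
  have sd : (size (\det A') + (n.*2.+1 - size (\det A')) = n.*2.+1)%N.
    by rewrite subnKC // size_det.
  exact: bounded_infinity uv A0 B0 AB hA sd.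
move=> uv A0 B0 AB; have [su sv] := affine_indep_size uv.
have [N hN] := one _ _ _ _ uv A0 B0 AB.
have [M hM] := one _ _ _ _ (affine_indep_sym uv) B0 A0 (prop_sym AB).
exists (M + N)%N => n m; rewrite PoszD; apply: disp_mul => //.
- exact: vinf_valuation.
- by rewrite det_act comp_poly2_eq0 ?size_itp // det_coc.
- exact: det_coc.
by apply/disp_inf_act; rewrite ?size_itp.
Qed.

Lemma mup_prod_exp (S : seq K) N b :
  mup b ((\prod_(s <- S) ('X - s%:P)) ^+ N) = (N * count_mem b S)%N.
Proof.
have n0 : \prod_(s <- S) ('X - s%:P) != 0 by rewrite monic_neq0 // monic_prod_XsubC.
elim: N => [|N IH]; first by rewrite expr0 mupNroot // root1.
by rewrite exprS mupM ?expf_neq0 // IH mu_prod_XsubC mulSn.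
Qed.

(** The displacement at b bounds the pole there of X_ij X_kl / det X. It can be positive only if b
    lies in Z or S, where D absorbs it, or if the end point lies in S, where the pull-back of Q
    does. The place at infinity then bounds the degree of the quotient. *)
Lemma common_denominator u v A B : affine_indep u v -> \det A != 0 -> \det B != 0 ->
  prop (act v A *m B) (act u B *m A) ->
  exists (D Q : P) (N : nat), [/\ D != 0, Q != 0 & forall n m i j k l,
    exists2 q, q * \det (coc2 u v A B n m) = D * (Q \Po joint u v n m) *
       (coc2 u v A B n m i j * coc2 u v A B n m k l)
     & (size q <= N)%N].
Proof.
move=> uv A0 B0 AB; have [su sv] := affine_indep_size uv.
have cuv := affine_indep_comm uv.
have [S [N1 hS]] := disp_finite_places cuv su sv A0 B0 AB.
have [Z [N2 hZ]] := special_places uv A0 B0 AB.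
have [N3 hN3] := bounded_infinity2 uv A0 B0 AB.
pose Q := (\prod_(s <- S) ('X - s%:P)) ^+ N1.
pose R := (\prod_(s <- Z) ('X - s%:P)) ^+ N2.
have Q0 : Q != 0 by rewrite expf_neq0 // monic_neq0 // monic_prod_XsubC.
have R0 : R != 0 by rewrite expf_neq0 // monic_neq0 // monic_prod_XsubC.
have QR0 : Q * R != 0 by rewrite mulf_neq0.
exists (Q * R), Q, (size (Q * R)%R + size Q + N3)%N; split=> // n m i j k l.
set X := coc2 u v A B n m; have X0 : \det X != 0 by apply: det_coc2.
have [->|a0] := eqVneq (X i j) 0; first by exists 0; rewrite ?mul0r ?mulr0 ?size_poly0.
have [->|b0] := eqVneq (X k l) 0; first by exists 0; rewrite ?mul0r ?mulr0 ?size_poly0.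
have sh := size_joint n m su sv; set h := joint u v n m in sh *.
have Qh0 : Q \Po h != 0 by rewrite comp_poly2_eq0.
have rhs0 : Q * R * (Q \Po h) * (X i j * X k l) != 0 by rewrite !mulf_neq0.
have /dvdpP[q eq] : \det X %| Q * R * (Q \Po h) * (X i j * X k l).
  apply: dvdp_mup => // b; rewrite !mupM ?mulf_neq0 // mup_joint // !mup_prod_exp.
  suff [M [hM hM']] : exists M : nat, disp (vmup b) X M%:Z /\
      (M <= N1 * count_mem b S + N2 * count_mem b Z +
            N1 * count_mem (pt u n (pt v m b)) S)%N.
    have := hM _ _ _ _ a0 b0; rewrite /vmup -!PoszD lez_nat => /leq_trans; apply.
    by rewrite addnC leq_add2r.
  have cpos (c : K) T : c \in T -> (0 < count_mem c T)%N.
    by rewrite -has_pred1 has_count.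
  case: (hZ b) => [fb|[bZ hb]].
    have [h1 h2] := hS b n m fb.
    have [bS|bS] := boolP (b \in S).
      exists N1; split=> //; rewrite -addnA (leq_trans _ (leq_addr _ _)) //.
      by rewrite leq_pmulr // cpos.
    have [cS|cS] := boolP (pt u n (pt v m b) \in S).
      exists N1; split=> //; rewrite (leq_trans _ (leq_addl _ _)) //.
      by rewrite leq_pmulr // cpos.
    by exists 0%N; split=> //; apply: h2.
  exists N2; split; first exact: hb.
  rewrite addnAC (leq_trans _ (leq_addl _ _)) //.
  by rewrite leq_pmulr // cpos.
exists q; first by rewrite -eq.
have q0 : q != 0 by apply: contraNneq rhs0 => q0; rewrite eq q0 mul0r.
have := congr1 (fun r : P => size r) eq; rewrite /= !size_mul ?mulf_neq0 //.
rewrite -(size_mul Q0 R0) size_comp_poly2 //.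
move: (hN3 n m _ _ _ _ a0 b0); rewrite /vinf -/X.
move: q0 X0 a0 b0 QR0 Q0; rewrite -!size_poly_gt0.
move: (size q) (size (\det X)) (size (X i j)) (size (X k l)) (size (Q * R)) (size Q).
move=> s1 s2 s3 s4 s5 s6; lia.
Qed.

(* The quadratic forms w_i / D are transformed by (u, A) into combinations of *)
(* each other, up to the common factor det A.                                 *)
Definition quad_inv n (w : 'I_n -> 'M[P]_2) D u A :=
  exists2 L : 'M[K]_n, L \in unitmx & forall i,
    D *: (A^T *m act u (w i) *m A) = (\det A * (D \Po u)) *: lincomb w (L i).

(** The transform of the quadratic form Q E by f^n followed by g^m, times the denominator D. Both
    sides are quadratic in the cocycle, so rescaling it has no effect. Forms E of degree at most 1
    in x are enough to recover the coordinates later. *)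
Definition orbit_of u v A B D Q (w : 'M[P]_2) := exists n m E,
  szle E 2 /\ \det (coc2 u v A B n m) *: w =
    D *: ((coc2 u v A B n m)^T *m act (joint u v n m) (Q *: E) *m coc2 u v A B n m).

Lemma scalemx_polyI p A B : p != 0 -> p *: A = p *: B -> A = B.
Proof.
move=> p0 e; apply/matrixP => i j; apply: (mulfI p0).
by have := congr1 (fun Z : 'M_2 => Z i j) e; rewrite !mxE.
Qed.

(** One more generator replaces X by X(u) A up to scalars, and these cancel because X^T M X and det
    X scale alike. *)
Lemma orbit_step u A D X X' M M' w w' : size u = 2 -> \det X != 0 ->
  prop (act u X *m A) X' -> act u M = M' ->
  \det X *: w = D *: (X^T *m M *m X) -> \det X' *: w' = D *: (X'^T *m M' *m X') ->
  D *: (A^T *m act u w *m A) = (\det A * (D \Po u)) *: w'.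
Proof.
move=> su X0 [p [q [p0 q0 e]]] <- ew ew'.
set Y := act u X *m A in e.
have edet : p ^+ 2 * \det Y = q ^+ 2 * \det X'.
  by have := congr1 determinant e; rewrite !detZ.
have e2 : (\det X \Po u) *: (A^T *m act u w *m A) = (D \Po u) *: (Y^T *m act u M *m Y).
  have := congr1 (fun Z => A^T *m act u Z *m A) ew; rewrite /= !actZ !actM.
  rewrite -!scalemxAr -!scalemxAl => ->; congr (_ *: _).
  by rewrite /Y trmx_mul !mulmxA /act map_trmx.
have e3 : p ^+ 2 *: (Y^T *m act u M *m Y) = q ^+ 2 *: (X'^T *m act u M *m X').
  have E r Z : r ^+ 2 *: (Z^T *m act u M *m Z) = (r *: Z)^T *m act u M *m (r *: Z).
    have -> : (r *: Z)^T = r *: Z^T by apply/matrixP => i j; rewrite !mxE.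
    by rewrite -!scalemxAl -scalemxAr scalerA.
  by rewrite !E e.
have Xu0 : \det X \Po u != 0 by rewrite comp_poly2_eq0.
have s0 : p ^+ 2 * (\det X \Po u) != 0 by rewrite mulf_neq0 ?expf_neq0.
apply: (scalemx_polyI s0).
transitivity ((D * (D \Po u)) *: (p ^+ 2 *: (Y^T *m act u M *m Y))).
  rewrite [LHS](_ : _ = (D * p ^+ 2) *: ((\det X \Po u) *: (A^T *m act u w *m A))).
    by rewrite e2 !scalerA; congr (_ *: _); ring.
  by rewrite !scalerA; congr (_ *: _); ring.
transitivity (((D \Po u) * q ^+ 2) *: (D *: (X'^T *m act u M *m X'))).
  by rewrite e3 !scalerA; congr (_ *: _); ring.
rewrite -ew' !scalerA; congr (_ *: _).
transitivity ((D \Po u) * (q ^+ 2 * \det X')); first ring.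
by rewrite -edet /Y det_mulmx det_act; ring.
Qed.

End InvariantSpan.

Section CoreTheorem.
Variable K : closedFieldType.
Notation P := {poly K}.
Implicit Types (A B X : 'M[P]_2) (u v p q : P).

(** The entries of w combine the quotients q of [common_denominator] with the entries of E, whose
    degree at most 1 accounts for the bound [N.+1]. *)
Lemma orbit_exists u v A B D Q N : size u = 2 -> size v = 2 ->
  \det A != 0 -> \det B != 0 ->
  (forall n m i j k l,
    exists2 q, q * \det (coc2 u v A B n m) = D * (Q \Po joint u v n m) *
       (coc2 u v A B n m i j * coc2 u v A B n m k l)
     & (size q <= N)%N) ->
  forall n m E, szle E 2 -> exists2 w : 'M[P]_2, szle w N.+1 &
    \det (coc2 u v A B n m) *: w =
    D *: ((coc2 u v A B n m)^T *m act (joint u v n m) (Q *: E) *m coc2 u v A B n m).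
Proof.
move=> su sv A0 B0 hq n m E hE; have sh := size_joint n m su sv.
have hq' (t : 'I_2 * 'I_2 * ('I_2 * 'I_2)) : exists q, q * \det (coc2 u v A B n m) =
       D * (Q \Po joint u v n m) *
       (coc2 u v A B n m t.1.1 t.1.2 * coc2 u v A B n m t.2.1 t.2.2) /\ (size q <= N)%N.
  by have [q] := hq n m t.1.1 t.1.2 t.2.1 t.2.2; exists q.
have [q qP] := boolp.choice hq'; move: (joint u v n m) sh qP {hq hq'} => h sh.
move: (coc2 u v A B n m) => X qP.
pose e i j := E i j \Po h.
exists (\matrix_(k, l) (e 0 0 * q ((0, k), (0, l)) + e 0 1 * q ((0, k), (1, l))
   + (e 1 0 * q ((1, k), (0, l)) + e 1 1 * q ((1, k), (1, l))))).
  move=> k l; rewrite mxE.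
  have t i j i' j' : (size (e i j * q ((i', k), (j', l)))%R <= N.+1)%N.
    apply: leq_trans (size_polyMleq _ _) _; rewrite size_comp_poly2 //.
    have [_] := qP ((i', k), (j', l)); have := hE i j.
    by move: (size (E i j)) (size (q _)) => a b; lia.
  have le2 (a b : P) s : (size a <= s)%N -> (size b <= s)%N -> (size (a + b)%R <= s)%N.
    by move=> ha hb; apply: leq_trans (size_polyD _ _) _; rewrite geq_max ha hb.
  by rewrite !le2.
apply/matrixP => k l; rewrite [LHS]mxE [RHS]mxE mxE !mulmx2E.
rewrite !actE ![(Q *: E) _ _]mxE !rmorphM /= ![X^T _ _]mxE -/(e 0 0) -/(e 0 1) -/(e 1 0) -/(e 1 1).
have q1 := proj1 (qP ((0, k), (0, l))); have q2 := proj1 (qP ((0, k), (1, l))).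
have q3 := proj1 (qP ((1, k), (0, l))); have q4 := proj1 (qP ((1, k), (1, l))).
rewrite /= in q1 q2 q3 q4.
transitivity (e 0 0 * (q ((0, k), (0, l)) * \det X) + e 0 1 * (q ((0, k), (1, l)) * \det X)
   + (e 1 0 * (q ((1, k), (0, l)) * \det X) + e 1 1 * (q ((1, k), (1, l)) * \det X))).
  by ring.
by rewrite q1 q2 q3 q4; ring.
Qed.

(** The matrix L is invertible because w -> A^T w(u) A is injective: A is invertible over K(x), and
    composition with u is injective. *)
Lemma quad_inv_basis u A D n (w : 'I_n -> 'M[P]_2) (R : 'M[P]_2 -> Prop) :
  size u = 2 -> \det A != 0 -> D != 0 -> (forall i, R (w i)) ->
  (forall c, lincomb w c = 0 -> forall i, c i = 0) ->
  (forall x, R x -> exists c, x = lincomb w c) ->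
  (forall x, R x -> exists2 y, R y &
     D *: (A^T *m act u x *m A) = (\det A * (D \Po u)) *: y) ->
  quad_inv w D u A.
Proof.
move=> su A0 D0 Rw wf wspan hR.
have hc i : exists c, D *: (A^T *m act u (w i) *m A) = (\det A * (D \Po u)) *: lincomb w c.
  by have [y /wspan[c ->] e] := hR _ (Rw i); exists c.
have [L hL] := boolp.choice hc.
have lE (M : 'M[K]_n) i : lincomb w (fun j => M i j) = lincomb w (M i) by [].
exists (\matrix_(i, j) L i j); last first.
  move=> i; rewrite hL; congr (_ *: _); apply: eq_bigr => j _.
  by rewrite mxE.
rewrite -row_free_unit; apply/inj_row_free => c hc0.
have ew : lincomb w (fun i => c 0 i) = 0.
  have s : D *: (A^T *m act u (lincomb w (fun i => c 0 i)) *m A) = 0.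
    have -> : act u (lincomb w (fun i => c 0 i)) = \sum_i (c 0 i)%:P *: act u (w i).
      apply/matrixP => i j; rewrite actE !summxE rmorph_sum /=; apply: eq_bigr => k _.
      by rewrite mxE rmorphM /= comp_polyC mxE actE.
    rewrite mulmx_sumr mulmx_suml scaler_sumr.
    have -> : \sum_i D *: (A^T *m ((c 0 i)%:P *: act u (w i)) *m A) =
        \sum_i (\det A * (D \Po u)) *: ((c 0 i)%:P *: lincomb w (L i)).
      apply: eq_bigr => i _; rewrite -scalemxAr -scalemxAl scalerA [D * _]mulrC -[in LHS]scalerA hL.
      by rewrite !scalerA; congr (_ *: _); ring.
    rewrite -scaler_sumr; suff -> : \sum_i (c 0 i)%:P *: lincomb w (L i) = 0 by rewrite scaler0.
    have -> : \sum_i (c 0 i)%:P *: lincomb w (L i) =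
        lincomb w ((c *m \matrix_(i, j) L i j) 0).
      rewrite /lincomb; under eq_bigr => i _ do rewrite scaler_sumr.
      rewrite exchange_big; apply: eq_bigr => j _ /=.
      rewrite mxE rmorph_sum scaler_suml; apply: eq_bigr => i _ /=.
      by rewrite scalerA mxE polyCM.
    by rewrite hc0 /lincomb big1 // => i _; rewrite mxE scale0r.
  have s1 : A^T *m act u (lincomb w (fun i => c 0 i)) *m A = 0.
    by apply: (scalemx_polyI D0); rewrite s scaler0.
  have s2 : act u (lincomb w (fun i => c 0 i)) = 0.
    have := congr1 (fun Z => \adj A^T *m (Z *m \adj A)) s1.
    rewrite mul0mx mulmx0 -!mulmxA mul_mx_adj !mulmxA mul_adj_mx det_tr.
    rewrite mul_scalar_mx mul_mx_scalar => z.
    by apply: (scalemx_polyI A0); apply: (scalemx_polyI A0); rewrite z !scaler0.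
  apply/matrixP => i j; apply/eqP; rewrite mxE -(comp_poly2_eq0 _ su) -actE s2 mxE.
  exact: eqxx.
apply/rowP => i; rewrite mxE; exact: wf ew i.
Qed.

Lemma invariant_span u v A B : affine_indep u v -> \det A != 0 -> \det B != 0 ->
  prop (act v A *m B) (act u B *m A) ->
  exists N n (w : 'I_n.+1 -> 'M[P]_2) (D Q : P),
    [/\ D != 0, Q != 0 & forall i, szle (w i) N.+1] /\
    [/\ forall E, szle E 2 -> exists c, Q *: E = lincomb w c,
        quad_inv w D u A & quad_inv w D v B].
Proof.
move=> uv A0 B0 AB; have [su sv] := affine_indep_size uv.
have cuv := affine_indep_comm uv.
have [D [Q [N [D0 Q0 hq]]]] := common_denominator uv A0 B0 AB.
have hex := orbit_exists su sv A0 B0 hq.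
pose R (w : 'M[P]_2) := szle w N.+1 /\ orbit_of u v A B D Q w.
have RQ E : szle E 2 -> R ((D * Q) *: E).
  move=> hE; have [w hw ew] := hex 0%N 0%N E hE.
  have e1 : coc2 u v A B 0 0 = 1%:M by rewrite /coc2 /= actX mulmx1.
  have e2 : joint u v 0 0 = 'X by rewrite /joint /= comp_polyX.
  suff -> : (D * Q) *: E = w by split=> //; exists 0%N, 0%N, E.
  by move: ew; rewrite e1 e2 actX det1 scale1r trmx1 mul1mx mulmx1 scalerA.
have s1 : szle (1%:M : 'M[P]_2) 2.
  by move=> i j; rewrite mxE; case: (i == j); rewrite ?size_poly1 ?size_poly0.
have nz : (D * Q) *: (1%:M : 'M[P]_2) != 0.
  apply/eqP => /(congr1 (fun Z : 'M_2 => Z 0 0)); rewrite !mxE mulr1 => /eqP.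
  by rewrite mulf_eq0 (negPf D0) (negPf Q0).
have [n [w [Rw wf wspan]]] := span_basis (fun w (h : R w) => proj1 h) (RQ _ s1) nz.
(* For n = m = 0 the transform of Q E is D Q E, so the multiplier that serves from here on is D
   Q. *)
exists N, n, w, D, (D * Q); split; first by split; rewrite ?mulf_neq0 // => i; case: (Rw i).
have det0 k l : \det (coc2 u v A B k l) != 0 by apply: det_coc2.
split; first by move=> E /RQ/wspan.
  apply: (@quad_inv_basis _ _ _ _ _ R) => // x [_ [k [l [E [hE ex]]]]].
  have [y hy ey] := hex k.+1 l E hE; exists y; first by split=> //; exists k.+1, l, E.
  apply: (orbit_step su (det0 k l) _ _ ex ey).
    rewrite /coc2 actM act_comp -mulmxA; exact: prop_refl.
  by rewrite act_comp /joint /= -!comp_polyA (itp_comm _ (esym cuv)).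
apply: (@quad_inv_basis _ _ _ _ _ R) => // x [_ [k [l [E [hE ex]]]]].
have [y hy ey] := hex k l.+1 E hE; exists y; first by split=> //; exists k, l.+1, E.
apply: (orbit_step sv (det0 k l) _ _ ex ey).
  (* The cocycle [coc2] runs through f first, so the step by g is added after exchanging the two
     orders. *)
  apply: prop_trans (prop_mulr _ (prop_act sv _)) _; first exact/prop_sym/coc2_sym.
  apply: prop_trans _ (coc2_sym _ _ cuv su sv AB).
  rewrite /coc2 actM act_comp -mulmxA; exact: prop_refl.
by rewrite act_comp /joint -comp_polyA.
Qed.

End CoreTheorem.

(** * Surfaces on which a group acts linearly *)

Section BirationalReps.
Variable K : closedFieldType.

Lemma vanishes_P2 n (p : {mpoly K[n.+1]}) : vanishes (projspace K n) p = (p == 0).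
Proof. by []. Qed.

(** That T maps X into Y is tested on homogeneous equations of Y, where a power of a component of r
    can be cancelled. The old backward tuple still inverts T. *)
Lemma represents_same n m (X : projvar K n) (Y : projvar K m) (r : bir_rep X Y)
    (T : m.+1.-tuple {mpoly K[n.+1]}) d :
  (forall i, tnth T i \is d.-homog) -> same_map X (fwd r) T ->
  represents (\pi_(bir X Y) r) T.
Proof.
move=> hT rT; have [Nr [j Tj] cross] := rT.
have TP : ratmap X Y T.
  split; [by exists d | by exists j |].
  move=> p pY; rewrite (pihomog_partitionE (leqnn (msize p))) rmorph_sum.
  apply: rpred_sum => e _; set q := pihomog _ _ _.
  have qY : vanishes Y q by apply: pv_homog.
  have hq : q \is (e : nat).-homog by apply: pihomogP.
  have := vanishes_comp_proj (cross^~ j) hq.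
  have := let: And3 _ _ h := fwdP r in h q qY => rq.
  move=> h; have : vanishes X (tnth (fwd r) j ^+ e * (q \mPo T)).
    rewrite -[_ * _](subKr (tnth T j ^+ e * (q \mPo fwd r))).
    by apply: vanishesD; [apply: vanishesMl | rewrite vanishesN].
  have rj : ~~ vanishes X (tnth (fwd r) j).
    case: Nr => i ri; apply/negP => rj; move: (cross i j) => h'.
    have : vanishes X (tnth (fwd r) i * tnth T j).
      rewrite -[_ * _](subrK (tnth (fwd r) j * tnth T i)).
      by apply: vanishesD => //; rewrite mulrC; apply: vanishesMl.
    by rewrite vanishesM (negPf ri) (negPf Tj).
  by rewrite vanishesM (negPf (vanishesXn _ rj)).
have [e he] : exists e, forall i, tnth (bwd r) i \is e.-homog by case: (bwdP r).
have [e' he'] : exists e, forall i, tnth (fwd r) i \is e.-homog by case: (fwdP r).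
have NK : exists i, ~~ vanishes X (tnth (comp_tuple (bwd r) (fwd r)) i) by case: (fwdK r).
have fK : same_map X (comp_tuple (bwd r) T) (id_tuple K n).
  apply: same_map_trans (fwdK r); apply: (same_map_postcomp he) => //.
  exact: same_map_sym.
have bK : same_map Y (comp_tuple T (bwd r)) (id_tuple K m).
  apply: same_map_trans (bwdK r).
  apply: (same_map_precomp (rep_inv r) hT he'); exact: same_map_sym.
exists (BirRep TP (bwdP r) fK bK) => //.
by apply/pi_birP/same_map_sym.
Qed.

(** Over a domain the top components multiply to the top component, here t itself. So a common
    factor of homogeneous components may be taken homogeneous. *)
Lemma mul_top_homog n (q h t : {mpoly K[n]}) d e : t = q * h -> t \is d.-homog ->
  h != 0 -> msize h = e.+1 ->
  t = pihomog mdeg (d - e) q * pihomog mdeg e h.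
Proof.
move=> et ht h0 sh; have [t0|tn0] := eqVneq t 0.
  have : q * h == 0 by rewrite -et t0.
  by rewrite mulf_eq0 (negPf h0) orbF t0 => /eqP->; rewrite pihomog0 mul0r.
have q0 : q != 0 by apply: contraNneq tn0 => q0; rewrite et q0 mul0r.
have st : msize t = d.+1.
  have := dhomog_msize ht => /(dhomog_uniq tn0 ht) ->.
  by rewrite prednK // lt0n mmeasure_poly_eq0.
have sq : msize q = (d - e).+1 /\ (e <= d)%N.
  have := msizeM q0 h0; rewrite -et st sh.
  have : (0 < msize q)%N by rewrite lt0n mmeasure_poly_eq0.
  by move: (msize q) => s; lia.
have [{}sq ed] := sq.
have eq : q = \sum_(a < (d - e).+1) pihomog mdeg a q.
  by apply: pihomog_partitionE; rewrite sq.
have eh : h = \sum_(b < e.+1) pihomog mdeg b h by apply: pihomog_partitionE; rewrite sh.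
rewrite -[LHS](pihomog_dE ht).
transitivity (pihomog mdeg d ((\sum_(a < (d - e).+1) pihomog mdeg a q) *
  (\sum_(b < e.+1) pihomog mdeg b h))); first by rewrite -eq -eh et.
rewrite mulr_suml raddf_sum (bigD1 ord_max) //= [X in _ + X]big1 ?addr0 => [|a na].
  rewrite mulr_sumr raddf_sum (bigD1 ord_max) //= [X in _ + X]big1 ?addr0 => [|b nb].
    rewrite pihomog_dE // -[X in _ \is X.-homog](subnK ed).
    by apply: dhomogM; apply: pihomogP.
  apply: (@pihomog_ne0 _ _ _ (d - e + b)%N); last by apply: dhomogM; apply: pihomogP.
  have := ltn_ord b; rewrite -val_eqE /= in nb; move: nb.
  by move: (nat_of_ord b) => s; lia.
rewrite mulr_sumr raddf_sum big1 // => b _.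
apply: (@pihomog_ne0 _ _ _ (a + b)%N); last by apply: dhomogM; apply: pihomogP.
have := ltn_ord b; have := ltn_ord a; rewrite -val_eqE /= in na; move: na.
by move: (nat_of_ord a) (nat_of_ord b) => s t'; lia.
Qed.

Lemma has_degree_le (f : Cr2 K) d F : represents f F ->
  (forall i, tnth F i \is d.-homog) -> exists2 e, has_degree f e & (e <= d)%N.
Proof.
elim/ltn_ind: d F => d IH F fF hF.
have [dF|] := pselect (has_degree f d); first by exists d.
move=> ndF.
have [h hh sh] : exists2 h : {mpoly K[3]}, (forall i, exists q, tnth F i = q * h)
    & (1 < msize h)%N.
  apply: contrapT => nh; apply: ndF; exists F; split=> // h hh.
  by rewrite leqNgt; apply/negP => sh; apply: nh; exists h.
have h0 : h != 0 by apply: contraTneq sh => ->; rewrite mmeasure0.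
have [e se] : exists e, msize h = e.+2 by exists (msize h).-2; move: sh; case: (msize h) => [|[]].
have [q hq] := boolp.choice hh.
pose h' := pihomog mdeg e.+1 h.
pose F' := [tuple pihomog mdeg (d - e.+1) (q i) | i < 3].
have eF i : tnth F i = tnth F' i * h'.
  by rewrite tnth_mktuple; apply: mul_top_homog.
case: (fF) => r rf rF.
have [i0 Fi0] : exists i, tnth F i != 0 by rewrite -rF; case: (fwdP r).
have [h'0 F'0] : h' != 0 /\ tnth F' i0 != 0.
  by move: Fi0; rewrite eF mulf_eq0 negb_or => /andP[].
have hF' i : tnth F' i \is (d - e.+1).-homog by rewrite tnth_mktuple; apply: pihomogP.
have ed : (e < d)%N.
  have hh' : h' \is e.+1.-homog by apply: pihomogP.
  rewrite ltnNge; apply/negP => de.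
  have := dhomog_uniq Fi0 (hF i0); rewrite eF => /(_ _ (dhomogM (hF' i0) hh')).
  lia.
have [|||e' he' le] := IH (d - e.+1)%N _ F'.
- lia.
- rewrite -rf; apply: represents_same hF' _; rewrite rF; split.
  + by exists i0.
  + by exists i0.
  by move=> i j; rewrite !eF vanishes_P2; apply/eqP; ring.
- exact: hF'.
by exists e' => //; apply: leq_trans le (leq_subr _ _).
Qed.

End BirationalReps.

(** * The closure of the image of a tuple of forms *)

Section ImageIdeal.
Variables (K : closedFieldType) (k n : nat) (S : n.+1.-tuple {mpoly K[k.+1]}).

Definition image_ideal : {pred {mpoly K[n.+1]}} := fun p => p \mPo S == 0.

Lemma image_ideal_closed : idealr_closed image_ideal.
Proof.
split; rewrite ?unfold_in ?comp_mpoly0 ?comp_mpoly1 ?oner_eq0 // => a p q.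
by rewrite !unfold_in rmorphD rmorphM /= => /eqP-> /eqP->; rewrite mulr0 addr0.
Qed.

Lemma image_ideal_prime : prime_idealr_closed image_ideal.
Proof. by move=> p q; rewrite !unfold_in rmorphM mulf_eq0. Qed.

HB.instance Definition _ :=
  isIdealr.Build {mpoly K[n.+1]} image_ideal image_ideal_closed.
HB.instance Definition _ :=
  isPrimeIdealrClosed.Build {mpoly K[n.+1]} image_ideal image_ideal_prime.

(** Components of p of different degrees pull back to different degrees, as [D.+1] is positive, so
    they cannot cancel one another. *)
Lemma image_ideal_homog D p d : (forall i, tnth S i \is D.+1.-homog) ->
  p \in (image_ideal : pred _) -> pihomog mdeg d p \in (image_ideal : pred _).
Proof.
rewrite !unfold_in => hS /eqP p0.
have hd e : pihomog mdeg e p \mPo S \is (D.+1 * e).-homog.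
  by apply: comp_dhomog => //; apply: pihomogP.
have [lt|ge] := ltnP d (msize p); last first.
  have : pihomog mdeg d p = 0.
    rewrite pihomogE big1_seq // => m /andP[/eqP md mp].
    by have := msize_mdeg_lt mp; rewrite md ltnNge ge.
  by move=> ->; rewrite comp_mpoly0.
have := congr1 (pihomog mdeg (D.+1 * d)) p0; rewrite pihomog0.
rewrite {1}(pihomog_partitionE (leqnn (msize p))) rmorph_sum raddf_sum /=.
rewrite (bigD1 (Ordinal lt)) //= [X in _ + X]big1 ?addr0 => [|e ne].
  by rewrite pihomog_dE // => ->.
apply: (@pihomog_ne0 _ _ _ (D.+1 * e)%N); last exact: hd.
by rewrite -val_eqE /= in ne; rewrite eqn_pmul2l.
Qed.

End ImageIdeal.

Section LinearTuple.
Variables (K : closedFieldType) (n : nat).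

Definition lin_tuple m (L : 'M[K]_(m.+1, n.+1)) : m.+1.-tuple {mpoly K[n.+1]} :=
  [tuple \sum_j L i j *: 'X_j | i < m.+1].

Lemma lin_tuple_homog m (L : 'M[K]_(m.+1, n.+1)) i : tnth (lin_tuple L) i \is 1.-homog.
Proof.
rewrite tnth_mktuple; apply: rpred_sum => j _; apply: dhomogZ.
by rewrite dhomogX /= mdeg1.
Qed.

Lemma comp_lin_tuple k m (L : 'M[K]_(m.+1, n.+1)) (S : n.+1.-tuple {mpoly K[k.+1]}) i :
  tnth (comp_tuple (lin_tuple L) S) i = \sum_j L i j *: tnth S j.
Proof.
rewrite !tnth_mktuple rmorph_sum; apply: eq_bigr => j _ /=.
by rewrite comp_mpolyZ comp_mpolyXU -tnth_nth.
Qed.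

End LinearTuple.

Lemma comp_lin_tupleM (K : closedFieldType) k n m l (L : 'M[K]_(l.+1, m.+1))
    (M : 'M[K]_(m.+1, n.+1)) (S : n.+1.-tuple {mpoly K[k.+1]}) :
  comp_tuple (lin_tuple L) (comp_tuple (lin_tuple M) S) =
  comp_tuple (lin_tuple (L *m M)) S.
Proof.
apply: eq_from_tnth => i; rewrite !comp_lin_tuple.
under eq_bigr => j _ do rewrite comp_lin_tuple scaler_sumr.
rewrite exchange_big; apply: eq_bigr => j _ /=.
by rewrite mxE scaler_suml; apply: eq_bigr => t _; rewrite scalerA.
Qed.

Lemma comp_lin_tuple1 (K : closedFieldType) k n (S : n.+1.-tuple {mpoly K[k.+1]}) :
  comp_tuple (lin_tuple 1%:M) S = S.
Proof.
apply: eq_from_tnth => i; rewrite comp_lin_tuple (bigD1 i) //= big1 ?addr0 => [|j ji].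
  by rewrite mxE eqxx scale1r.
by rewrite mxE eq_sym (negPf ji) scale0r.
Qed.

Lemma pi_inv (K : closedFieldType) n m (X : projvar K n) (Y : projvar K m)
  (r : bir_rep X Y) : bir_inv (\pi_(bir X Y) r) = \pi_(bir Y X) (rep_inv r).
Proof.
set x := \pi_(bir X Y) r; set y := \pi_(bir Y X) _.
have xy : bir_comp x y = bir_id Y by rewrite pi_comp; apply/pi_birP/bwdK.
by rewrite -[LHS]bir_compf1 -xy bir_compA bir_compVf bir_comp1f.
Qed.

Section Model.
Variables (K : closedFieldType) (n D : nat) (S : n.+1.-tuple {mpoly K[3]}).
Variables (H : {mpoly K[3]}) (C : 'M[K]_(3, n.+1)).
Hypothesis hS : forall i, tnth S i \is D.+1.-homog.
Hypothesis H0 : H != 0.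
Hypothesis hC : forall i, tnth (comp_tuple (lin_tuple C) S) i = H * 'X_i.

Notation P2 := (projspace K 2).

Lemma mpolyX_neq0 k (i : 'I_k) : 'X_i != 0 :> {mpoly K[k]}.
Proof.
apply/eqP => /(congr1 (mcoeff U_(i))).
by rewrite mcoeffX eqxx mcoeff0 => /eqP; rewrite oner_eq0.
Qed.

Lemma S_neq0 : exists i, tnth S i != 0.
Proof.
apply: contrapT => nS; have : H * 'X_ord0 != 0 by rewrite mulf_neq0 ?mpolyX_neq0.
rewrite -hC comp_lin_tuple big1 ?eqxx // => j _.
case: (eqVneq (tnth S j) 0) => [->|nz]; first by rewrite scaler0.
by case: nS; exists j.
Qed.

Lemma image_relevant : exists i : 'I_n.+1, 'X_i \notin (image_ideal S : pred _).
Proof.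
have [i Si] := S_neq0; exists i.
by rewrite unfold_in comp_mpolyXU -tnth_nth.
Qed.

Definition image_var : projvar K n :=
  @ProjVar K n (image_ideal S : prime_idealr {mpoly K[n.+1]})
    (fun p d => @image_ideal_homog K 2 n S D p d hS) image_relevant.

Lemma vanishes_image p : vanishes image_var p = (p \mPo S == 0).
Proof. by []. Qed.

Lemma image_fwdP : ratmap P2 image_var S.
Proof.
split; [by exists D.+1 | exact: S_neq0 |].
by move=> p; rewrite vanishes_image vanishes_P2.
Qed.

Lemma image_bwdP : ratmap image_var P2 (lin_tuple C).
Proof.
split; first by exists 1%N; apply: lin_tuple_homog.
  exists ord0; rewrite vanishes_image; have := hC ord0.
  by rewrite tnth_mktuple => ->; rewrite mulf_neq0 ?mpolyX_neq0.
by move=> p; rewrite vanishes_P2 => /eqP->; rewrite comp_mpoly0 vanishes0.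
Qed.

Lemma image_fwdK : same_map P2 (comp_tuple (lin_tuple C) S) (id_tuple K 2).
Proof.
split.
- by exists ord0; rewrite hC vanishes_P2 mulf_neq0 ?mpolyX_neq0.
- by exists ord0; rewrite tnth_mktuple vanishes_P2 mpolyX_neq0.
by move=> i j; rewrite !hC ![tnth (id_tuple _ _) _]tnth_mktuple vanishes_P2; apply/eqP; ring.
Qed.

Lemma image_bwdK : same_map image_var (comp_tuple S (lin_tuple C)) (id_tuple K n).
Proof.
have e i : tnth (comp_tuple S (lin_tuple C)) i \mPo S = H ^+ D.+1 * tnth S i.
  rewrite tnth_mktuple comp_mpolyA.
  have -> : [tuple tnth (lin_tuple C) i0 \mPo S | i0 < 3] =
    [tuple H * tnth (id_tuple K 2) j | j < 3].
    apply: eq_from_tnth => j; rewrite !tnth_mktuple.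
    by have := hC j; rewrite !tnth_mktuple.
  by rewrite (comp_homogM _ _ (hS i)) comp_mpoly_id.
have [i0 Si0] := S_neq0.
split.
- by exists i0; rewrite vanishes_image e mulf_neq0 // expf_neq0.
- by exists i0; rewrite vanishes_image tnth_mktuple comp_mpolyXU -tnth_nth.
move=> i j; rewrite vanishes_image rmorphB !rmorphM /= !e.
rewrite ![tnth (id_tuple _ _) _]tnth_mktuple !comp_mpolyXU -!tnth_nth; apply/eqP; ring.
Qed.

Definition image_rep : bir_rep P2 image_var :=
  BirRep image_fwdP image_bwdP image_fwdK image_bwdK.

Definition linear_on (f : Cr2 K) := exists2 L : 'M[K]_n.+1, L \in unitmx &
  same_map P2 (comp_tuple S (fwd (repr f))) (comp_tuple (lin_tuple L) S).

Lemma lin_tuple_neq0 (L : 'M[K]_n.+1) : L \in unitmx ->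
  exists i, ~~ vanishes P2 (tnth (comp_tuple (lin_tuple L) S) i).
Proof.
move=> uL; apply: contrapT => nz; have [j Sj] := S_neq0.
have z : comp_tuple (lin_tuple L) S = [tuple 0 | i < n.+1].
  apply: eq_from_tnth => i; rewrite [RHS]tnth_mktuple; apply/eqP/negPn/negP => ni.
  by apply: nz; exists i.
have := congr1 (fun T => tnth (comp_tuple (lin_tuple (invmx L)) T) j) z.
rewrite /= comp_lin_tupleM mulVmx // comp_lin_tuple1 comp_lin_tuple big1.
  by move=> e; rewrite e eqxx in Sj.
by move=> i _; rewrite tnth_mktuple scaler0.
Qed.

Lemma linear_on_mul (f g : Cr2 K) : linear_on f -> linear_on g -> linear_on (f * g)%g.
Proof.
case=> L uL hL [M uM hM]; exists (L *m M); first by rewrite unitmx_mul uL.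
set F := repr f in hL; set G := repr g in hM.
have hfg : same_map P2 (fwd (repr (f * g)%g)) (comp_tuple (fwd F) (fwd G)).
  by apply: (repr_pi (rep_comp F G)).
have [d hF] : exists d, forall i, tnth (comp_tuple S (fwd F)) i \is d.-homog.
  case: (fwdP F) => -[d hF] _ _; exists (d * D.+1)%N => i.
  by rewrite tnth_mktuple; apply: comp_dhomog.
have hLS i : tnth (comp_tuple (lin_tuple L) S) i \is D.+1.-homog.
  by rewrite comp_lin_tuple; apply: rpred_sum => j _; apply: dhomogZ.
apply: same_map_trans.
  apply: (same_map_postcomp hS hfg).
  by case: (fwdP (rep_comp image_rep (rep_comp F G))).
rewrite comp_tupleA.
apply: same_map_trans (same_map_precomp G hF hLS hL) _.
rewrite -comp_tupleA -comp_lin_tupleM.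
apply: (same_map_postcomp (@lin_tuple_homog _ _ _ L) hM).
rewrite comp_lin_tupleM; apply: lin_tuple_neq0; by rewrite unitmx_mul uL.
Qed.

Lemma linear_on_inv (f : Cr2 K) : linear_on f -> linear_on (f^-1)%g.
Proof.
case=> L uL hL; exists (invmx L); first by rewrite unitmx_inv.
set F := repr f in hL.
have hf' : same_map P2 (fwd (repr (f^-1)%g)) (bwd F) by apply: (repr_pi (rep_inv F)).
have [d hF] : exists d, forall i, tnth (comp_tuple S (fwd F)) i \is d.-homog.
  case: (fwdP F) => -[d hF] _ _; exists (d * D.+1)%N => i.
  by rewrite tnth_mktuple; apply: comp_dhomog.
have hLS i : tnth (comp_tuple (lin_tuple L) S) i \is D.+1.-homog.
  by rewrite comp_lin_tuple; apply: rpred_sum => j _; apply: dhomogZ.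
have NB : exists i, ~~ vanishes P2 (tnth (comp_tuple S (bwd F)) i).
  by case: (fwdP (rep_comp image_rep (rep_inv F))).
apply: same_map_trans (same_map_postcomp hS hf' NB) _.
have h1 := same_map_precomp (rep_inv F) hF hLS hL; rewrite /= -!comp_tupleA in h1.
have h2 : same_map P2 (comp_tuple S (comp_tuple (fwd F) (bwd F))) S.
  rewrite -[X in same_map _ _ X]comp_id_tupler.
  apply: (same_map_postcomp hS (bwdK F)).
  by rewrite comp_id_tupler; apply: S_neq0.
have h3 := same_map_trans (same_map_sym h1) h2.
have uL' : invmx L \in unitmx by rewrite unitmx_inv.
have := same_map_postcomp (@lin_tuple_homog _ _ _ (invmx L)) h3 (lin_tuple_neq0 uL').
by rewrite comp_lin_tupleM (mulVmx uL) comp_lin_tuple1.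
Qed.

Let phi : bir P2 image_var := \pi_(bir P2 image_var) image_rep.

(** On the image surface f is represented by the linear tuple of L, and an invertible L kills no
    nonzero vector. *)
Lemma linear_on_regular (f : Cr2 K) : linear_on f ->
  regular (bir_comp (bir_comp phi f) (bir_inv phi)).
Proof.
case=> L uL hL v [vn0 _]; set F := repr f in hL.
have e : bir_comp (bir_comp phi f) (bir_inv phi) =
  \pi_(bir image_var image_var) (rep_comp (rep_comp image_rep F) (rep_inv image_rep)).
  by rewrite -[f in LHS]reprK /phi pi_inv (pi_comp image_rep F) pi_comp.
have [d hF] : exists d, forall i, tnth (comp_tuple S (fwd F)) i \is d.-homog.
  case: (fwdP F) => -[d hF] _ _; exists (d * D.+1)%N => i.
  by rewrite tnth_mktuple; apply: comp_dhomog.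
have hLS i : tnth (comp_tuple (lin_tuple L) S) i \is D.+1.-homog.
  by rewrite comp_lin_tuple; apply: rpred_sum => j _; apply: dhomogZ.
have NL : exists i, ~~ vanishes image_var (tnth (lin_tuple L) i).
  have [i Li] := lin_tuple_neq0 uL; exists i; rewrite vanishes_image.
  by move: Li; rewrite tnth_mktuple.
have h : same_map image_var (fwd (rep_comp (rep_comp image_rep F) (rep_inv image_rep)))
   (lin_tuple L).
  apply: same_map_trans (same_map_precomp (rep_inv image_rep) hF hLS hL) _.
  rewrite /= -comp_tupleA -[X in same_map _ _ X]comp_id_tupler.
  apply: (same_map_postcomp (@lin_tuple_homog _ _ _ L) image_bwdK).
  by rewrite comp_id_tupler.
exists (lin_tuple L); first by rewrite e; apply: represents_same (@lin_tuple_homog _ _ _ L) h.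
apply: contrapT => nz; case: vn0 => j; rewrite -[v j]/(_) => vj.
have z : L *m (\col_i v i) = 0.
  apply/colP => i; rewrite [RHS]mxE mxE; apply/eqP/negPn/negP => ni.
  apply: nz; exists i; apply: contra ni => /eqP z; apply/eqP.
  transitivity ((tnth (lin_tuple L) i).@[v]); last exact: z.
  rewrite tnth_mktuple rmorph_sum; apply: eq_bigr => t _ /=.
  by rewrite mevalZ mevalXU !mxE.
have : \col_i v i = 0 by rewrite -[LHS](mulKmx uL) z mulmx0.
by move/colP/(_ j); rewrite !mxE => e'; rewrite e' eqxx in vj.
Qed.

Lemma linear_on_automorphism (f : Cr2 K) : linear_on f ->
  is_automorphism (bir_comp (bir_comp phi f) (bir_inv phi)).
Proof.
move=> hf; split; first exact: linear_on_regular.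
have := linear_on_regular (linear_on_inv hf); congr regular.
set a := bir_comp _ _; set b := bir_comp _ _.
have ba : (b * a)%g = 1%g.
  rewrite -[(b * a)%g]/(bir_comp b a) /a /b -!bir_compA.
  rewrite [bir_comp (bir_inv phi) (bir_comp phi _)]bir_compA bir_compVf bir_comp1f.
  rewrite [bir_comp f _]bir_compA; have -> : bir_comp f (f^-1)%g = bir_id P2.
    exact: mulgV.
  by rewrite bir_comp1f bir_compfV.
by rewrite -[LHS](mulKg b) ba mulg1.
Qed.

(** Applying the linear projection C to S f = L S recovers f as C L S, whose degree does not depend
    on f. *)
Lemma linear_on_represents (f : Cr2 K) : linear_on f ->
  exists2 F, represents f F & forall i, tnth F i \is D.+1.-homog.
Proof.
case=> L uL hL; set F := repr f in hL.
have hLS i : tnth (comp_tuple (lin_tuple L) S) i \is D.+1.-homog.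
  by rewrite comp_lin_tuple; apply: rpred_sum => j _; apply: dhomogZ.
pose T := comp_tuple (lin_tuple C) (comp_tuple (lin_tuple L) S).
have hT i : tnth T i \is D.+1.-homog.
  by rewrite comp_lin_tuple; apply: rpred_sum => j _; apply: dhomogZ.
exists T => //; rewrite -[f]reprK -/F; apply: represents_same hT _.
have [d hF] : exists d, forall i, tnth (fwd F) i \is d.-homog by case: (fwdP F).
have hCS i : tnth (comp_tuple (lin_tuple C) S) i \is D.+1.-homog.
  by rewrite comp_lin_tuple; apply: rpred_sum => j _; apply: dhomogZ.
have hid i : tnth (id_tuple K 2) i \is 1.-homog.
  by rewrite tnth_mktuple dhomogX /= mdeg1.
have h1 := same_map_precomp F hCS hid image_fwdK.
rewrite comp_id_tuplel -comp_tupleA in h1.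
apply: same_map_trans (same_map_sym h1) _; apply: same_map_sym.
apply: (same_map_postcomp (@lin_tuple_homog _ _ _ C) (same_map_sym hL)).
by case: h1.
Qed.

End Model.

Lemma elliptic_criterion (K : closedFieldType) (G : {pred Cr2 K})
    n D (S : n.+1.-tuple {mpoly K[3]}) (H : {mpoly K[3]}) (C : 'M[K]_(3, n.+1)) :
  group_closed G ->
  (forall i, tnth S i \is D.+1.-homog) -> H != 0 ->
  (forall i, tnth (comp_tuple (lin_tuple C) S) i = H * 'X_i) ->
  (forall f, f \in G -> linear_on S f) -> elliptic_subgroup G.
Proof.
move=> gG hS H0 hC lin; split; last first.
  exists n, (image_var hS H0 hC), (\pi_(bir _ _) (image_rep hS H0 hC)) => f fG.
  exact/linear_on_automorphism/lin.
have GM := group_closedM gG; have G1 := gG.1.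
move=> f fG; exists D.+1 => k.
have fkG : (f ^+ k)%g \in G by elim: k => [|k IH]; rewrite ?expg0 // expgS GM.
have [F fF hF] := linear_on_represents hS H0 hC (lin _ fkG).
by have [d fd dD] := has_degree_le fF hF; exists d.
Qed.

(** * Transformations in the affine chart *)

Section Moebius.
Variables (k L : fieldType) (iota : {rmorphism k -> L}).
Implicit Types (M N : 'M[k]_2) (z : L).

(** Avoiding the constants is all that is asked: it already keeps the linear denominators of [mob]
    away from zero. *)
Definition transc z := forall r : k, z != iota r.

Definition mob M z := mobius (map_mx iota M) z.

Lemma linear_neq0 z c d : transc z -> (c != 0) || (d != 0) -> iota c * z + iota d != 0.
Proof.
move=> tz; have [->|c0 _] := eqVneq c 0.
  by rewrite rmorph0 mul0r add0r fmorph_eq0.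
apply/eqP => e; have /eqP := tz (- (d / c)); apply.
have ic : iota c != 0 by rewrite fmorph_eq0.
rewrite rmorphN rmorphM fmorphV; apply: (mulfI ic).
rewrite mulrN mulrCA divff // mulr1.
by apply/eqP; rewrite -addr_eq0 e.
Qed.

Lemma row_neq0 M i : \det M != 0 -> (M i 0 != 0) || (M i 1 != 0).
Proof.
move=> M0; apply: contraNT M0; rewrite negb_or !negbK => /andP[/eqP a /eqP b].
by case: (ord2P i) a b => -> a b; rewrite det2E a b ?(mul0r, mulr0) subrr.
Qed.

Lemma den_neq0 M i z : \det M != 0 -> transc z ->
  iota (M i 0) * z + iota (M i 1) != 0.
Proof. by move=> M0 tz; apply: linear_neq0 => //; apply: row_neq0. Qed.

Lemma mobE M z : mob M z =
  (iota (M 0 0) * z + iota (M 0 1)) / (iota (M 1 0) * z + iota (M 1 1)).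
Proof. by rewrite /mob /mobius !mxE. Qed.

Lemma mob_transc M z : \det M != 0 -> transc z -> transc (mob M z).
Proof.
move=> M0 tz r; rewrite mobE; have dn := den_neq0 1 M0 tz.
apply/eqP => /(congr1 (fun w => w * (iota (M 1 0) * z + iota (M 1 1)))).
rewrite divfK // => e.
have : iota (M 0 0 - r * M 1 0) * z + iota (M 0 1 - r * M 1 1) == 0.
  by rewrite !rmorphB !rmorphM; apply/eqP; apply: (eq_by_sub e); ring.
apply/negP/linear_neq0 => //; apply: contraNT M0.
rewrite negb_or !negbK !subr_eq0 => /andP[/eqP a /eqP b].
by rewrite det2E a b; apply/eqP; ring.
Qed.

Lemma mob_comp M N z : \det M != 0 -> \det N != 0 -> transc z ->
  mob M (mob N z) = mob (M *m N) z.
Proof.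
move=> M0 N0 tz; have d1 := den_neq0 1 N0 tz.
have E (a b c d n1 n0 : L) : n0 != 0 ->
    (a * (n1 / n0) + b) / (c * (n1 / n0) + d) = (a * n1 + b * n0) / (c * n1 + d * n0).
  move=> n00; have F (x y : L) : x * (n1 / n0) + y = (x * n1 + y * n0) / n0 by field.
  by rewrite !F invf_div mulrA divfK.
rewrite !mobE E // !mulmx2E !rmorphD !rmorphM; congr (_ / _); ring.
Qed.

Lemma mob1 z : mob 1%:M z = z.
Proof. by rewrite mobE !mxE /= rmorph1 rmorph0 mul1r mul0r addr0 add0r divr1. Qed.

Lemma mob_scale c M z : c != 0 -> mob (c *: M) z = mob M z.
Proof.
move=> c0; have ic : iota c != 0 by rewrite fmorph_eq0.
rewrite !mobE !mxE !rmorphM -!mulrA -!mulrDr invfM mulrACA divff //.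
by rewrite mul1r.
Qed.

Lemma mob_id M z : \det M != 0 -> transc z ->
  (forall a b c, iota a * z ^+ 2 + iota b * z + iota c = 0 ->
     [/\ a = 0, b = 0 & c = 0]) ->
  mob M z = z -> M = (M 0 0)%:M.
Proof.
move=> M0 tz tz2 e; have d1 := den_neq0 1 M0 tz.
have := congr1 (fun w => w * (iota (M 1 0) * z + iota (M 1 1))) e.
rewrite /= mobE divfK // => e1.
have [|a b c] := tz2 (M 1 0) (M 1 1 - M 0 0) (- M 0 1).
  by rewrite !rmorphN rmorphB; apply: (eq_by_sub (esym e1)); ring.
apply/mx2P; rewrite mxE /= ?mulr1n ?mulr0n //.
  by apply/eqP; rewrite -oppr_eq0 c.
by apply/eqP; rewrite -subr_eq0 b.
Qed.

(** If adj(M) N fixes z, then z satisfies a quadratic equation over k, which the hypothesis makes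
    trivial, so adj(M) N is scalar. *)
Lemma mob_inj M N z : \det M != 0 -> \det N != 0 -> transc z ->
  (forall a b c, iota a * z ^+ 2 + iota b * z + iota c = 0 ->
     [/\ a = 0, b = 0 & c = 0]) ->
  mob M z = mob N z -> exists2 c, c != 0 & N = c *: M.
Proof.
move=> M0 N0 tz tz2 e; have aM0 : \det (\adj M) != 0 by rewrite det_adj2.
have e1 : mob (\adj M *m N) z = z.
  rewrite -mob_comp // -e mob_comp // mul_adj_mx -scalemx1 mob_scale //.
  exact: mob1.
have X0 : \det (\adj M *m N) != 0 by rewrite det_mulmx mulf_neq0.
have := mob_id X0 tz tz2 e1; set c := (_ *m _) 0 0 => ec.
have : M *m (\adj M *m N) = M *m c%:M by rewrite ec.
rewrite mulmxA mul_mx_adj mul_scalar_mx mul_mx_scalar => eN.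
exists (c / \det M).
  rewrite mulf_neq0 ?invr_eq0 //; apply: contraNneq X0 => c0.
  by rewrite ec c0 -scalemx1 scale0r det0.
by rewrite mulrC -scalerA -eN scalerA mulVf // scale1r.
Qed.

End Moebius.

Lemma frac_decomp (R : idomainType) (w : {fraction R}) :
  exists n d, d != 0 /\ w = (tofrac n / tofrac d : {fraction R}).
Proof.
elim/quotW: w => r; exists \n_r, \d_r; split; first exact: denom_ratioP.
have d0 : (tofrac \d_r : {fraction R}) != 0 by rewrite tofrac_eq0 denom_ratioP.
apply: (mulIf d0); rewrite divfK //.
rewrite [LHS]/GRing.mul /= !piE; apply/eqmodP; rewrite /= FracField.equivfE.
by rewrite /FracField.mulf !numden_Ratio ?(oner_eq0, mulf_neq0, denom_ratioP) // !mulr1 mulrC.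
Qed.

Lemma tofrac_transc (F : fieldType) (r : F) :
  (tofrac 'X : {fraction {poly F}}) != tofrac r%:P.
Proof.
rewrite tofrac_eq; apply/eqP => /(congr1 (fun p : {poly F} => size p)).
by rewrite size_polyX size_polyC; case: (r != 0).
Qed.

Lemma tofrac_transc2 (F : fieldType) (a b c : F) :
  tofrac a%:P * tofrac 'X ^+ 2 + tofrac b%:P * tofrac 'X + tofrac c%:P
    = 0 :> {fraction {poly F}} -> [/\ a = 0, b = 0 & c = 0].
Proof.
rewrite -tofracXn -!tofracM -!tofracD => /eqP; rewrite tofrac_eq0 => /eqP e.
have h i : (a%:P * 'X ^+ 2 + b%:P * 'X + c%:P)`_i = 0 by rewrite e coef0.
have := h 0%N; have := h 1%N; have := h 2%N.
rewrite !coefD !coefCM !coefXn !coefX !coefC /= !(mulr0, mulr1, addr0, add0r).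
by move=> -> -> ->.
Qed.

Section MmapLemmas.
Variables (n : nat) (R S : comNzRingType) (f : {rmorphism R -> S}).

Lemma mmap_comp m (h : 'I_m -> S) (F : n.-tuple {mpoly R[m]}) p :
  mmap f h (p \mPo F) = mmap f (fun i => mmap f h (tnth F i)) p.
Proof.
rewrite comp_mpolyE rmorph_sum /=; apply: eq_bigr => mo _.
rewrite mmapZ rmorph_prod; congr (_ * _); apply: eq_bigr => i _.
by rewrite rmorphXn.
Qed.

Lemma mmap_homog (h : 'I_n -> S) (p : {mpoly R[n]}) c d : p \is d.-homog ->
  mmap f (fun i => c * h i) p = c ^+ d * mmap f h p.
Proof.
move=> /dhomogP hp; rewrite /mmap mulr_sumr; apply: eq_big_seq => mo mop.
rewrite mulrCA; congr (_ * _); rewrite /mmap1.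
under eq_bigr => i _ do rewrite exprMn.
by rewrite big_split /= prodrXr -mdegE (hp _ mop).
Qed.

Lemma mmap_eq (h h' : 'I_n -> S) (p : {mpoly R[n]}) : h =1 h' ->
  mmap f h p = mmap f h' p.
Proof. by move=> hh; apply: eq_bigr => m _; rewrite (mmap1_eq _ hh). Qed.

End MmapLemmas.

Lemma common_den (F : fieldType) (p00 p01 p10 p11 q00 q01 q10 q11 : F) :
  q00 != 0 -> q01 != 0 -> q10 != 0 -> q11 != 0 ->
  let c := q00 * q01 * q10 * q11 in
  [/\ p00 * (q01 * q10 * q11) = c * (p00 / q00),
     p01 * (q00 * q10 * q11) = c * (p01 / q01),
     p10 * (q00 * q01 * q11) = c * (p10 / q10)
   & p11 * (q00 * q01 * q10) = c * (p11 / q11)].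
Proof. by move=> h00 h01 h10 h11 c; rewrite /c; split; field. Qed.

(** * Polynomials in a new coordinate of the base *)

Section Evaluation.
Variable K : closedFieldType.
Notation x := (xcoord K).
Notation y := (ycoord K).
Implicit Types (z : Kx K) (p q : {poly K}) (A : 'M[{poly K}]_2).

Lemma x_transc : transc (@constx K) x.
Proof. by move=> r; apply: tofrac_transc. Qed.

Lemma y_transc : transc (@constxy K) y.
Proof. by move=> r; apply: tofrac_transc. Qed.

Definition evp z p : Kx K := (map_poly (@constx K) p).[z].

Lemma evp_is_rmorphism z : GRing.zmod_morphism (evp z) * GRing.monoid_morphism (evp z).
Proof.
split; first by move=> p q; rewrite /evp rmorphB hornerD hornerN.
by split=> [|p q]; rewrite /evp ?rmorph1 ?hornerC // rmorphM hornerM.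
Qed.

HB.instance Definition _ z := GRing.isZmodMorphism.Build {poly K} (Kx K) (evp z)
  (evp_is_rmorphism z).1.
HB.instance Definition _ z := GRing.isMonoidMorphism.Build {poly K} (Kx K) (evp z)
  (evp_is_rmorphism z).2.

Lemma evpC z c : evp z c%:P = constx c.
Proof. by rewrite /evp map_polyC hornerC. Qed.

Lemma evpX z : evp z 'X = z.
Proof. by rewrite /evp map_polyX hornerX. Qed.

Lemma evp_comp z p q : evp z (p \Po q) = evp (evp z q) p.
Proof. by rewrite /evp map_comp_poly horner_comp. Qed.

Lemma evp_x p : evp x p = tofrac p.
Proof.
rewrite /evp horner_coef size_map_poly -[in RHS](coefK p) poly_def rmorph_sum /=.
by apply: eq_bigr => i _; rewrite coef_map -mul_polyC rmorphM rmorphXn.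
Qed.

Lemma evp_neq0 z p : transc (@constx K) z -> p != 0 -> evp z p != 0.
Proof.
move=> tz p0; have [r e] := closed_field_poly_normal p.
rewrite e -mul_polyC rmorphM rmorph_prod /= evpC mulf_neq0 //.
  by rewrite fmorph_eq0 lead_coef_eq0.
rewrite prodf_seq_neq0; apply/allP => c _ /=.
by rewrite rmorphB /= evpX evpC subr_eq0 tz.
Qed.

(** The quotients of polynomials in X = P x are closed under the field operations and contain the
    constants and x, which is adj(P) applied to X. *)
Lemma poly_ratio P (w : Kx K) : P \in unitmx -> exists p q,
  q != 0 /\ w = evp (mob (@constx K) P x) p / evp (mob (@constx K) P x) q.
Proof.
rewrite unitmxE unitfE => P0; set X := mob _ P x.
have tX : transc (@constx K) X by apply: mob_transc => //; apply: x_transc.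
pose R w := exists p q, q != 0 /\ w = evp X p / evp X q.
have RC c : R (constx c) by exists c%:P, 1; rewrite oner_neq0 evpC rmorph1 divr1.
have RD a b : R a -> R b -> R (a + b).
  case=> p [q [q0 ->]] [p' [q' [q'0 ->]]]; exists (p * q' + p' * q), (q * q').
  rewrite mulf_neq0 // rmorphD !rmorphM /=; split=> //.
  by rewrite addf_div ?evp_neq0.
have RM a b : R a -> R b -> R (a * b).
  case=> p [q [q0 ->]] [p' [q' [q'0 ->]]]; exists (p * p'), (q * q').
  by rewrite mulf_neq0 // !rmorphM /= mulf_div.
have RV a : R a -> R a^-1.
  case=> p [q [q0 ->]]; have [->|p0] := eqVneq p 0.
    by rewrite rmorph0 mul0r invr0; exists 0, 1; rewrite oner_neq0 rmorph0 mul0r.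
  by exists q, p; rewrite invf_div.
have RX : R X by exists 'X, 1; rewrite oner_neq0 evpX rmorph1 divr1.
have Rx : R x.
  have -> : x = mob (@constx K) (\adj P) X.
    have aP0 : \det (\adj P) != 0 by rewrite det_adj2.
    by rewrite (mob_comp aP0 P0 x_transc) mul_adj_mx -scalemx1 (@mob_scale _ _ _ _ _ _ P0) mob1.
  rewrite mobE; have lin a b : R (constx a * X + constx b).
    exact: (RD _ _ (RM _ _ (RC _) RX) (RC _)).
  exact: (RM _ _ (lin _ _) (RV _ (lin _ _))).
have Rp n : R (tofrac n).
  rewrite -evp_x; elim/poly_ind: n => [|n c IH]; first by rewrite rmorph0 -(rmorph0 (@constx K)); apply: (RC).
  rewrite rmorphD rmorphM /= evpX evpC.
  exact: (RD _ _ (RM _ _ IH Rx) (RC _)).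
have [n [d [d0 ->]]] := frac_decomp w.
exact: (RM _ _ (Rp _) (RV _ (Rp _))).
Qed.

Definition evpm z A : 'M[Kx K]_2 := map_mx (evp z) A.

Lemma det_evpm z A : \det (evpm z A) = evp z (\det A).
Proof. by rewrite /evpm det_map_mx. Qed.

Lemma evpmM z A B : evpm z (A *m B) = evpm z A *m evpm z B.
Proof. by rewrite /evpm map_mxM. Qed.

Lemma evpm_act z u A : evpm z (act u A) = evpm (evp z u) A.
Proof. by apply/matrixP => i j; rewrite !mxE evp_comp. Qed.

Lemma evpm_inj z A B : transc (@constx K) z -> evpm z A = evpm z B -> A = B.
Proof.
move=> tz e; apply/matrixP => i j; apply/eqP; rewrite -subr_eq0.
apply: contraTT isT => ne; have := evp_neq0 tz ne.
rewrite rmorphB /= -[evp z (A i j)](mxE matrix_key (fun i j => evp z (A i j)) i j).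
have := congr1 (fun M : 'M_2 => M i j) e; rewrite !mxE => ->.
by rewrite subrr eqxx.
Qed.

Lemma poly_matrix P (N : 'M[Kx K]_2) : P \in unitmx -> \det N != 0 ->
  exists A c, [/\ c != 0, \det A != 0 & evpm (mob (@constx K) P x) A = c *: N].
Proof.
move=> uP N0; set X := mob _ P x.
have tX : transc (@constx K) X.
  by apply: mob_transc; [rewrite -unitfE -unitmxE | apply: x_transc].
have [p00 [q00 [n00 e00]]] := poly_ratio (N 0 0) uP.
have [p01 [q01 [n01 e01]]] := poly_ratio (N 0 1) uP.
have [p10 [q10 [n10 e10]]] := poly_ratio (N 1 0) uP.
have [p11 [q11 [n11 e11]]] := poly_ratio (N 1 1) uP.
pose A := mx2 (p00 * (q01 * q10 * q11)) (p01 * (q00 * q10 * q11))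
              (p10 * (q00 * q01 * q11)) (p11 * (q00 * q01 * q10)).
pose c := evp X (q00 * q01 * q10 * q11).
have c0 : c != 0 by rewrite evp_neq0 // !mulf_neq0.
have eA : evpm X A = c *: N.
  have [h1 h2 h3 h4] := common_den (evp X p00) (evp X p01) (evp X p10) (evp X p11)
    (evp_neq0 tX n00) (evp_neq0 tX n01) (evp_neq0 tX n10) (evp_neq0 tX n11).
  have [a1 a2 a3 a4] := mx2E (p00 * (q01 * q10 * q11)) (p01 * (q00 * q10 * q11))
              (p10 * (q00 * q01 * q11)) (p11 * (q00 * q01 * q10)).
  apply/mx2P; rewrite [LHS]mxE [RHS]mxE.
  - by rewrite a1 e00 /c !rmorphM.
  - by rewrite a2 e01 /c !rmorphM.
  - by rewrite a3 e10 /c !rmorphM.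
  - by rewrite a4 e11 /c !rmorphM.
exists A, c; split=> //; apply: contraNneq N0 => A0.
have := congr1 determinant eA; rewrite det_evpm A0 rmorph0 detZ => /esym/eqP.
by rewrite mulf_eq0 expf_eq0 /= (negPf c0).
Qed.

End Evaluation.

Lemma div_cross (F : fieldType) (a b c d : F) :
  b != 0 -> d != 0 -> a * d = b * c -> a / b = c / d.
Proof. by move=> b0 d0 e; apply/eqP; rewrite eqr_div // e mulrC. Qed.

Lemma hom_term (F : fieldType) (c n d : F) k N : d != 0 -> (k <= N)%N ->
  c * (n ^+ k * d ^+ (N - k)) = d ^+ N * (c * (n / d) ^+ k).
Proof.
move=> d0 kN; have -> : d ^+ N = d ^+ (N - k) * d ^+ k by rewrite -exprD subnK.
have dk : d ^+ k != 0 by rewrite expf_neq0.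
by rewrite expr_div_n; field.
Qed.

Lemma big_ord3 (R : Type) (idx : R) (op : Monoid.law idx) (F : 'I_3 -> R) :
  \big[op/idx]_i F i = op (F 0) (op (F 1) (F 2)).
Proof.
rewrite !big_ord_recl big_ord0 Monoid.mulm1.
by congr (op _ (op _ _)); congr F; apply: val_inj.
Qed.

Lemma mmap1_tuple3 (S : comNzRingType) (a b : S) (m : 'X_{1..3}) :
  mmap1 (tnth [tuple a; b; 1]) m = a ^+ m 0 * b ^+ m 1.
Proof. by rewrite /mmap1 big_ord3 /= expr1n mulr1. Qed.

(** * Cremona maps read in the affine chart *)

Section Charts.
Variable K : closedFieldType.
Notation x := (xcoord K).
Notation y := (ycoord K).
Notation P2 := (projspace K 2).
Implicit Types (a b : Kxy K) (p q : {mpoly K[3]}) (z : Kx K) (f g : Cr2 K).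

Lemma ord3P (i : 'I_3) : [\/ i = 0, i = 1 | i = 2].
Proof.
case: i => [[|[|[|//]]] ?];
  [apply: Or31|apply: Or32|apply: Or33]; exact: val_inj.
Qed.

Definition ev3 a b p : Kxy K := mmap (@constxy K \o @constx K) (tnth [tuple a; b; 1]) p.

HB.instance Definition _ a b := GRing.RMorphism.copy (ev3 a b)
  (mmap (@constxy K \o @constx K) (tnth [tuple a; b; 1])).

Lemma in_chartE p : in_chart p = ev3 (constxy x) y p.
Proof. by []. Qed.

Lemma ev3X0 a b : ev3 a b 'X_0 = a.
Proof. by rewrite /ev3 mmapX mmap1U. Qed.

Lemma ev3X1 a b : ev3 a b 'X_1 = b.
Proof. by rewrite /ev3 mmapX mmap1U. Qed.

Lemma ev3X2 a b : ev3 a b 'X_2 = 1.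
Proof. by rewrite /ev3 mmapX mmap1U. Qed.

Lemma ev3D a b p q : ev3 a b (p + q) = ev3 a b p + ev3 a b q.
Proof. exact: rmorphD. Qed.

Lemma ev3B a b p q : ev3 a b (p - q) = ev3 a b p - ev3 a b q.
Proof. exact: rmorphB. Qed.

Lemma ev3M a b p q : ev3 a b (p * q) = ev3 a b p * ev3 a b q.
Proof. exact: rmorphM. Qed.

Lemma ev3Xn a b p n : ev3 a b (p ^+ n) = ev3 a b p ^+ n.
Proof. exact: rmorphXn. Qed.

Lemma constxyD z w : constxy (z + w) = constxy z + constxy w.
Proof. exact: rmorphD. Qed.

Lemma constxyM z w : constxy (z * w) = constxy z * constxy w.
Proof. exact: rmorphM. Qed.

Lemma constxyXn z n : constxy (z ^+ n) = constxy z ^+ n.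
Proof. exact: rmorphXn. Qed.

Lemma ev3Z a b c p : ev3 a b (c *: p) = constxy (constx c) * ev3 a b p.
Proof. by rewrite /ev3 mmapZ. Qed.

Lemma ev3_comp a b (G : 3.-tuple {mpoly K[3]}) p d : p \is d.-homog ->
  ev3 a b (tnth G 2) != 0 ->
  ev3 a b (p \mPo G) = ev3 a b (tnth G 2) ^+ d *
    ev3 (ev3 a b (tnth G 0) / ev3 a b (tnth G 2))
        (ev3 a b (tnth G 1) / ev3 a b (tnth G 2)) p.
Proof.
move=> hp w0; rewrite {1}/ev3 mmap_comp /ev3 -(mmap_homog _ _ _ hp).
apply: mmap_eq => i; rewrite -!/(ev3 _ _ _); case: (ord3P i) => ->.
- by rewrite mulrC divfK.
- by rewrite mulrC divfK.
by rewrite mulr1.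
Qed.

Lemma constxy_monom z n : tofrac (z *: 'X^n) = constxy z * y ^+ n :> Kxy K.
Proof. by rewrite -mul_polyC tofracM tofracXn. Qed.

Lemma constx_monom (c : K) n : tofrac (c *: 'X^n) = constx c * x ^+ n :> Kx K.
Proof. by rewrite -mul_polyC tofracM tofracXn. Qed.

(** In a fixed degree the exponents of X_0 and X_1 determine that of X_2, so no monomials merge when
    X_2 is set to 1. *)
Lemma chart_inj p d : p \is d.-homog -> in_chart p = 0 -> p = 0.
Proof.
move=> hp p0; apply/mpolyP => mu; rewrite mcoeff0.
have [mup|] := boolP (mu \in msupp p); last exact: memN_msupp_eq0.
pose R1 : {poly Kx K} := \sum_(m <- msupp p) (constx p@_m * x ^+ m 0) *: 'X^(m 1).
have R10 : R1 = 0.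
  apply/eqP; rewrite -tofrac_eq0 -[X in _ == X]p0; apply/eqP.
  rewrite /R1 rmorph_sum /in_chart /mmap; apply: eq_bigr => m _ /=.
  by rewrite mmap1_tuple3 constxy_monom rmorphM rmorphXn mulrA.
have := congr1 (fun q : {poly Kx K} => q`_(mu 1)) R10; rewrite coef0 coef_sum.
pose R2 : {poly K} := \sum_(m <- msupp p | m 1 == mu 1) p@_m *: 'X^(m 0).
have -> : \sum_(m <- msupp p) ((constx p@_m * x ^+ m 0) *: 'X^(m 1))`_(mu 1) =
    (tofrac R2 : Kx K).
  rewrite rmorph_sum [RHS]big_mkcond; apply: eq_bigr => m _ /=.
  rewrite coefZ coefXn eq_sym; case: eqP => _; last by rewrite mulr0.
  by rewrite mulr1 constx_monom.
move=> /eqP; rewrite tofrac_eq0 => /eqP R20.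
have := congr1 (fun q : {poly K} => q`_(mu 0)) R20; rewrite coef0 coef_sum.
rewrite big_mkcond (bigD1_seq mu) ?msupp_uniq //= eqxx coefZ coefXn eqxx mulr1 big1_seq ?addr0 //.
move=> m /andP[mmu mp]; case: eqP => // m1; rewrite coefZ coefXn.
case: eqP => [m0|]; last by rewrite mulr0.
case/eqP: mmu; apply/mnmP => i.
have e1 : mdeg m = d := dhomog_mf hp mp; have e2 : mdeg mu = d := dhomog_mf hp mup.
have : mdeg m = mdeg mu by rewrite e1 e2.
rewrite !mdegE !big_ord3 /= -m0 m1.
by case: (ord3P i) => ->; rewrite ?m1 -?m0 // => /addnI/addnI.
Qed.

Definition chart f a b := exists2 F, represents f F &
  [/\ in_chart (tnth F 2) != 0, in_chart (tnth F 0) / in_chart (tnth F 2) = a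
    & in_chart (tnth F 1) / in_chart (tnth F 2) = b].

Lemma represents_same_map f F G : represents f F -> represents f G -> same_map P2 F G.
Proof. by case=> r <- <- [s e <-]; apply/pi_birP. Qed.

Lemma represents_homog f F : represents f F -> exists d, forall i, tnth F i \is d.-homog.
Proof. by case=> r _ <-; case: (fwdP r). Qed.

Lemma chart_uniq f a b a' b' : chart f a b -> chart f a' b' -> a = a' /\ b = b'.
Proof.
case=> F fF [F2 <- <-] [G fG [G2 <- <-]].
have [_ _ e] := represents_same_map fF fG.
have E i : in_chart (tnth F i) / in_chart (tnth F 2) = in_chart (tnth G i) / in_chart (tnth G 2).
  have /eqP/subr0_eq/(congr1 (@in_chart K)) := e i 2.
  rewrite !in_chartE !rmorphM /= -!in_chartE => h.
  exact: (div_cross F2 G2 h).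
by split; apply: E.
Qed.

(** Division by zero returns 0, so a vanishing last component would make the base coordinate
    zero. *)
Lemma tail_neq0 f F : represents f F -> forall z, z != 0 ->
  in_chart (tnth F 0) / in_chart (tnth F 2) = constxy z -> in_chart (tnth F 2) != 0.
Proof.
move=> fF z z0 e; apply: contraNneq z0 => F2.
by move: e; rewrite F2 invr0 mulr0 => /esym/eqP; rewrite fmorph_eq0.
Qed.

Lemma jonq_chart f M N : M \in unitmx -> jonq_form f M N ->
  chart f (constxy (mob (@constx K) M x)) (mob (@constxy K) N y).
Proof.
rewrite unitmxE unitfE => M0 [F [fF e0 e1]]; exists F => //; split=> //.
apply: (tail_neq0 fF _ e0); rewrite -[mobius _ _]/(mob _ _ _) mobE.
by rewrite mulf_neq0 ?invr_eq0 // den_neq0 //; apply: x_transc.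
Qed.

Lemma chart_jonq f M N :
  chart f (constxy (mob (@constx K) M x)) (mob (@constxy K) N y) -> jonq_form f M N.
Proof. by case=> F fF [_ e0 e1]; exists F. Qed.

Lemma chart_id : chart (1%g : Cr2 K) (constxy x) y.
Proof.
exists (id_tuple K 2); first by exists (rep_id P2).
rewrite !in_chartE ![tnth (id_tuple _ _) _]tnth_mktuple ev3X0 ev3X1 ev3X2.
by rewrite oner_neq0 !divr1.
Qed.

End Charts.

Section Forms.
Variables (K : closedFieldType) (P : 'M[K]_2).
Hypothesis uP : P \in unitmx.
Notation x := (xcoord K).
Notation y := (ycoord K).
Notation P2 := (projspace K 2).
Implicit Types (a b : Kxy K) (p : {poly K}) (z : Kx K) (f g : Cr2 K).

Lemma P_det : \det P != 0.
Proof. by rewrite -unitfE -unitmxE. Qed.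

Definition lin_form i : {mpoly K[3]} := P i 0 *: 'X_0 + P i 1 *: 'X_2.

(* The homogenisation in degree N of p, a polynomial in the coordinate P.x.   *)
Definition form N p : {mpoly K[3]} :=
  \sum_(k < N.+1) p`_k *: (lin_form 0 ^+ k * lin_form 1 ^+ (N - k)).

Lemma lin_form_homog i : lin_form i \is 1.-homog.
Proof. by apply: rpredD; apply: dhomogZ; rewrite dhomogX /= mdeg1. Qed.

Lemma form_homog N p : form N p \is N.-homog.
Proof.
apply: rpred_sum => k _; apply: dhomogZ.
have kN : (k <= N)%N by rewrite -ltnS.
rewrite -[X in _ \is X.-homog](subnKC kN) -[X in (X + _)%N]mul1n -[X in (_ + X)%N]mul1n.
by apply: dhomogM; apply: dhomogMn; apply: lin_form_homog.
Qed.

Definition den z := constx (P 1 0) * z + constx (P 1 1).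

Lemma ev3_lin_form z b i :
  ev3 (constxy z) b (lin_form i) = constxy (constx (P i 0) * z + constx (P i 1)).
Proof.
rewrite ev3D (ev3Z _ _ (P i 0)) (ev3Z _ _ (P i 1)) ev3X0 ev3X2 constxyD constxyM.
by rewrite [X in _ + X]mulr1.
Qed.

Lemma ev3_form z b N p : transc (@constx K) z -> (size p <= N.+1)%N ->
  ev3 (constxy z) b (form N p) = constxy (den z ^+ N * evp (mob (@constx K) P z) p).
Proof.
move=> tz hp; have dn : den z != 0 by apply: den_neq0 => //; apply: P_det.
have hp' : (size (map_poly (@constx K) p) <= N.+1)%N by rewrite size_map_poly.
rewrite /evp (horner_coef_wide _ hp') mulr_sumr [LHS]rmorph_sum [RHS]rmorph_sum.
apply: eq_bigr => k _; rewrite coef_map -[LHS]/(ev3 _ _ _) -[RHS]/(constxy _).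
transitivity (constxy (constx p`_k *
  ((constx (P 0 0) * z + constx (P 0 1)) ^+ k * den z ^+ (N - k)))).
  rewrite constxyM constxyM constxyXn constxyXn.
  by rewrite (ev3Z _ _ p`_k) (ev3M _ _ (_ ^+ _)) (ev3Xn _ _ (lin_form 0))
    (ev3Xn _ _ (lin_form 1)) (ev3_lin_form _ _ 0) (ev3_lin_form _ _ 1).
apply: (congr1 (@constxy K)); rewrite mobE; apply: hom_term; first exact: dn.
by rewrite -ltnS.
Qed.

End Forms.

Lemma ratio_cross (F : fieldType) (p q a b c d s y : F) : q != 0 -> s != 0 ->
  c * y + d != 0 ->
  (p * (s * c * y + s * d) = q * (s * a * y + s * b)) <->
  p / q = (a * y + b) / (c * y + d).
Proof.
move=> q0 s0 n0.
have e1 : p * (s * c * y + s * d) = s * (p * (c * y + d)) by ring.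
have e2 : q * (s * a * y + s * b) = s * (q * (a * y + b)) by ring.
rewrite e1 e2; split=> [/(mulfI s0) e|e]; first exact: div_cross.
congr (_ * _); rewrite -[p](divfK q0) e; field.
exact: n0.
Qed.

Lemma cross_div (F : fieldType) (a b c d : F) : b != 0 -> d != 0 ->
  a / b = c / d -> a * d = b * c.
Proof. by move=> b0 d0 /eqP; rewrite eqr_div // => /eqP ->; rewrite mulrC. Qed.

Lemma addr_mulr1 (R : pzRingType) (a b : R) : a + b * 1 = a + b.
Proof. by rewrite mulr1. Qed.

Lemma div_mul2 (F : fieldType) (w p q : F) : w != 0 -> (w * p) / (w * q) = p / q.
Proof. by move=> w0; rewrite -mulf_div divff // mul1r. Qed.

Section ChartComp.
Variables (K : closedFieldType) (P : 'M[K]_2).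
Hypothesis uP : P \in unitmx.
Notation x := (xcoord K).
Notation y := (ycoord K).
Notation P2 := (projspace K 2).
Notation Mx := (mob (@constx K)).
Notation My := (mob (@constxy K)).
Implicit Types (a b : Kxy K) (p : {poly K}) (z : Kx K) (f g : Cr2 K).

(** An identity between forms, unlike one in K(x,y), can be evaluated at another point;
    [chart_compP] needs this for composition. *)
Lemma base_relation (M : 'M[K]_2) (F : 3.-tuple {mpoly K[3]}) d : \det M != 0 ->
  (forall i, tnth F i \is d.-homog) -> in_chart (tnth F 2) != 0 ->
  in_chart (tnth F 0) / in_chart (tnth F 2) = constxy (Mx M x) ->
  tnth F 0 * lin_form M 1 = tnth F 2 * lin_form M 0.
Proof.
move=> M0 hF F2 e; apply/subr0_eq; apply: (@chart_inj _ _ (d + 1)%N).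
  by apply: rpredB; apply: dhomogM => //; apply: lin_form_homog.
rewrite in_chartE ev3B (ev3M _ _ (tnth F 0)) (ev3M _ _ (tnth F 2)).
rewrite (ev3_lin_form _ _ _ 0) (ev3_lin_form _ _ _ 1).
have dn := den_neq0 1 M0 (@x_transc K).
have dn' : constxy (constx (M 1 0) * x + constx (M 1 1)) != 0 by rewrite fmorph_eq0.
apply/eqP; rewrite subr_eq0; apply/eqP.
have := e; rewrite mobE fmorph_div => e'.
exact: (cross_div F2 dn' e').
Qed.

Lemma ev3_fiber N (p q : {poly K}) z b : transc (@constx K) z ->
  (size p <= N.+1)%N -> (size q <= N.+1)%N ->
  ev3 (constxy z) b (form P N p * 'X_1 + form P N q * 'X_2) =
  constxy (den P z ^+ N) * constxy (evp (Mx P z) p) * b +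
  constxy (den P z ^+ N) * constxy (evp (Mx P z) q).
Proof.
move=> tz hp hq; rewrite ev3D (ev3M _ _ (form P N p)) (ev3M _ _ (form P N q)).
rewrite (ev3_form uP b tz hp) (ev3_form uP b tz hq) ev3X1 ev3X2.
rewrite (constxyM _ (evp (Mx P z) p)) (constxyM _ (evp (Mx P z) q)).
exact: addr_mulr1.
Qed.

Lemma fiber_homog N (p q : {poly K}) :
  form P N p * 'X_1 + form P N q * 'X_2 \is N.+1.-homog.
Proof.
have X1 (i : 'I_3) : 'X_i \is [in K[3], 1.-homog] by rewrite dhomogX /= mdeg1.
have e : N.+1 = (N + 1)%N by rewrite addn1.
by apply: rpredD; rewrite e; apply: dhomogM; rewrite ?form_homog.
Qed.

Lemma fiber_den (A : 'M[{poly K}]_2) z b i : \det A != 0 ->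
  transc (@constx K) z -> transc (@constxy K) b ->
  constxy (evp (Mx P z) (A i 0)) * b + constxy (evp (Mx P z) (A i 1)) != 0.
Proof.
move=> A0 tz tb; have tX : transc (@constx K) (Mx P z).
  by apply: mob_transc => //; apply: P_det.
have : \det (evpm (Mx P z) A) != 0 by rewrite det_evpm evp_neq0.
by move/(den_neq0 i)/(_ tb); rewrite ![evpm _ _ _ _]mxE.
Qed.

Lemma My_evpm (A : 'M[{poly K}]_2) z b : My (evpm (Mx P z) A) b =
  (constxy (evp (Mx P z) (A 0 0)) * b + constxy (evp (Mx P z) (A 0 1))) /
  (constxy (evp (Mx P z) (A 1 0)) * b + constxy (evp (Mx P z) (A 1 1))).
Proof. by rewrite mobE ![evpm _ _ _ _]mxE. Qed.

Lemma fiber_relation (A : 'M[{poly K}]_2) N (F : 3.-tuple {mpoly K[3]}) d :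
  \det A != 0 -> szle A N.+1 ->
  (forall i, tnth F i \is d.-homog) -> in_chart (tnth F 2) != 0 ->
  in_chart (tnth F 1) / in_chart (tnth F 2) = My (evpm (Mx P x) A) y ->
  tnth F 1 * (form P N (A 1 0) * 'X_1 + form P N (A 1 1) * 'X_2) =
  tnth F 2 * (form P N (A 0 0) * 'X_1 + form P N (A 0 1) * 'X_2).
Proof.
move=> A0 hA hF F2 e; apply/subr0_eq; apply: (@chart_inj _ _ (d + N.+1)%N).
  by apply: rpredB; apply: dhomogM => //; apply: fiber_homog.
have tx := @x_transc K; have ty := @y_transc K.
rewrite in_chartE ev3B (ev3M _ _ (tnth F 1)) (ev3M _ _ (tnth F 2)).
rewrite (ev3_fiber _ tx (hA 1 0) (hA 1 1)) (ev3_fiber _ tx (hA 0 0) (hA 0 1)).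
have s0 : constxy (den P x ^+ N) != 0.
  by rewrite fmorph_eq0 expf_neq0 // den_neq0 // P_det.
apply/eqP; rewrite subr_eq0; apply/eqP.
apply/(ratio_cross _ _ _ F2 s0 (fiber_den 1 A0 tx ty)).
by rewrite -My_evpm.
Qed.

Lemma chart_compP f g (M : 'M[K]_2) (A : 'M[{poly K}]_2) z b :
  \det M != 0 -> \det A != 0 ->
  chart f (constxy (Mx M x)) (My (evpm (Mx P x) A) y) ->
  chart g (constxy z) b -> transc (@constx K) z -> transc (@constxy K) b ->
  chart (f * g)%g (constxy (Mx M z)) (My (evpm (Mx P z) A) b).
Proof.
move=> M0 A0 [F fF [F2 e0 e1]] [G gG [G2 g0 g1]] tz tb.
have [d hF] := represents_homog fF; have [e hG] := represents_homog gG.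
have [n [_ [_ [hA _]]]] := max_size A0.
have r0 := base_relation M0 hF F2 e0; have r1 := fiber_relation A0 hA hF F2 e1.
have fgFG : represents (f * g)%g (comp_tuple F G).
  case: fF gG => r <- <- [s <- <-]; exists (rep_comp r s) => //.
  by rewrite -[RHS]/(bir_comp _ _) pi_comp.
have eC i : in_chart (tnth (comp_tuple F G) i) =
    in_chart (tnth G 2) ^+ d * ev3 (constxy z) b (tnth F i).
  by rewrite tnth_mktuple -g0 -g1; exact: (ev3_comp (hF i) G2).
(* A birational g is dominant, so a nonzero F_2 stays nonzero after composition with G. *)
have FG2 : in_chart (tnth (comp_tuple F G) 2) != 0.
  apply: contraNneq F2 => FG2.
  have FG20 : tnth (comp_tuple F G) 2 = 0.
    by apply: chart_inj FG2; rewrite tnth_mktuple; apply: comp_dhomog (hF 2) hG.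
  case: gG => s _ sG; have : vanishes P2 (tnth F 2 \mPo fwd s).
    by rewrite vanishes_P2 sG -FG20 tnth_mktuple.
  by move/(rep_dominant (hF 2)); rewrite vanishes_P2 => /eqP ->; rewrite in_chartE rmorph0.
have q0 : ev3 (constxy z) b (tnth F 2) != 0.
  by move: FG2; rewrite eC; apply: contraNneq => ->; rewrite mulr0.
have w0 := expf_neq0 d G2.
exists (comp_tuple F G); first exact: fgFG.
split; first exact: FG2.
  rewrite (eC 0) (eC 2) (div_mul2 _ _ w0).
  have := congr1 (ev3 (constxy z) b) r0.
  rewrite (ev3M _ _ (tnth F 0)) (ev3M _ _ (tnth F 2)).
  rewrite (ev3_lin_form _ _ _ 0) (ev3_lin_form _ _ _ 1) mobE fmorph_div => h.
  have dz : constxy (constx (M 1 0) * z + constx (M 1 1)) != 0.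
    by rewrite fmorph_eq0 den_neq0.
  exact: (div_cross q0 dz h).
rewrite (eC 1) (eC 2) (div_mul2 _ _ w0) My_evpm.
have s0 : constxy (den P z ^+ n) != 0.
  by rewrite fmorph_eq0 expf_neq0 // den_neq0 // P_det.
apply/(ratio_cross _ _ _ q0 s0 (fiber_den 1 A0 tz tb)).
have := congr1 (ev3 (constxy z) b) r1.
rewrite (ev3M _ _ (tnth F 1)) (ev3M _ _ (tnth F 2)).
by rewrite (ev3_fiber _ tz (hA 1 0) (hA 1 1)) (ev3_fiber _ tz (hA 0 0) (hA 0 1)).
Qed.

End ChartComp.

(** * Quadratic forms as homogeneous polynomials *)

Section QuadGeneric.
Variable F : fieldType.
Implicit Types (W A : 'M[F]_2) (b : F).

Definition quadv W b := W 0 0 * b ^+ 2 + (W 0 1 + W 1 0) * b + W 1 1.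

Lemma quadv_conj W A b : A 1 0 * b + A 1 1 != 0 ->
  quadv (A^T *m W *m A) b = (A 1 0 * b + A 1 1) ^+ 2 *
    quadv W ((A 0 0 * b + A 0 1) / (A 1 0 * b + A 1 1)).
Proof.
move=> d0; rewrite /quadv !mulmx2E ![A^T _ _]mxE.
move: d0; set d := A 1 0 * b + A 1 1 => d0; set n := A 0 0 * b + A 0 1.
have -> : d ^+ 2 * (W 0 0 * (n / d) ^+ 2 + (W 0 1 + W 1 0) * (n / d) + W 1 1) =
  W 0 0 * n ^+ 2 + (W 0 1 + W 1 0) * (n * d) + W 1 1 * d ^+ 2 by field.
by rewrite /n /d; ring.
Qed.

Lemma quadvZ c W b : quadv (c *: W) b = c * quadv W b.
Proof. by rewrite /quadv !mxE; ring. Qed.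

Lemma quadv_scale (d p q r s b : F) :
  d * p * b ^+ 2 + (d * q + d * r) * (b * 1) + d * s * 1 ^+ 2 =
  d * (p * b ^+ 2 + (q + r) * b + s).
Proof. by ring. Qed.

Lemma mul_form (d D a b : F) : d * D * (a * b) = D * a * (d ^+ 1 * b).
Proof. by ring. Qed.

Lemma quadv_sum (I : finType) (W : I -> 'M[F]_2) b :
  quadv (\sum_i W i) b = \sum_i quadv (W i) b.
Proof.
rewrite /quadv !summxE -big_split /= !mulr_suml -!big_split /=.
by apply: eq_bigr.
Qed.

Lemma cross_from_scalars (I : Type) (a b q t : I -> F) w s k m :
  w != 0 -> s != 0 -> k != 0 -> m != 0 ->
  (forall i, a i = w * q i) -> (forall i, b i = s * t i) ->
  (forall i, k * q i = m * t i) ->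
  (forall i j, a i * b j = a j * b i) /\ (forall i, b i != 0 -> a i != 0).
Proof.
move=> w0 s0 k0 m0 ea eb e; split=> [i j|i].
  apply: (mulfI k0); rewrite !ea !eb.
  transitivity (w * s * (k * q i) * t j); first ring.
  rewrite e; transitivity (w * s * (m * t j) * t i); first ring.
  by rewrite -e; ring.
rewrite ea eb mulf_eq0 (negPf s0) /= => t0; rewrite mulf_neq0 //.
apply: contraNneq t0 => q0; have := e i; rewrite q0 mulr0 => /esym/eqP.
by rewrite mulf_eq0 (negPf m0).
Qed.

End QuadGeneric.

Section QuadForms.
Variables (K : closedFieldType) (P : 'M[K]_2) (N : nat).
Hypothesis uP : P \in unitmx.
Notation x := (xcoord K).
Notation y := (ycoord K).
Notation P2 := (projspace K 2).
Notation Mx := (mob (@constx K)).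
Notation My := (mob (@constxy K)).
Implicit Types (b : Kxy K) (p q : {poly K}) (z : Kx K) (f g : Cr2 K)
  (W : 'M[{poly K}]_2).

Lemma formD p q : form P N (p + q) = form P N p + form P N q.
Proof.
by rewrite /form -big_split; apply: eq_bigr => k _; rewrite coefD scalerDl.
Qed.

Lemma formZ c p : form P N (c%:P * p) = c *: form P N p.
Proof.
by rewrite /form scaler_sumr; apply: eq_bigr => k _; rewrite coefCM scalerA.
Qed.

Lemma form0 : form P N 0 = 0.
Proof. by rewrite /form big1 // => k _; rewrite coef0 scale0r. Qed.

Lemma form_sum (I : finType) (F : I -> {poly K}) :
  form P N (\sum_i F i) = \sum_i form P N (F i).
Proof.
by apply: (big_morph (form P N)); [exact: formD | exact: form0].
Qed.

Definition qform W : {mpoly K[3]} :=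
  form P N (W 0 0) * 'X_1 ^+ 2 + form P N (W 0 1 + W 1 0) * ('X_1 * 'X_2)
  + form P N (W 1 1) * 'X_2 ^+ 2.

Lemma qform_homog W : qform W \is N.+2.-homog.
Proof.
have X1 (i : 'I_3) : 'X_i \is [in K[3], 1.-homog] by rewrite dhomogX /= mdeg1.
have e : N.+2 = (N + (1 + 1))%N by rewrite addn2.
have e' : N.+2 = (N + 1 * 2)%N by rewrite addn2.
apply: rpredD; first apply: rpredD.
- by rewrite e'; apply: dhomogM; [apply: form_homog | apply: dhomogMn].
- by rewrite e; apply: dhomogM; [apply: form_homog | apply: dhomogM].
by rewrite e'; apply: dhomogM; [apply: form_homog | apply: dhomogMn].
Qed.

Lemma qform_lincomb n (w : 'I_n -> 'M[{poly K}]_2) c :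
  qform (lincomb w c) = \sum_j c j *: qform (w j).
Proof.
have E i j : form P N (lincomb w c i j) = \sum_l c l *: form P N (w l i j).
  rewrite summxE form_sum; apply: eq_bigr => l _.
  by rewrite mxE formZ.
rewrite /qform formD !E -big_split /= !mulr_suml -!big_split /=.
apply: eq_bigr => l _; rewrite formD -!mul_mpolyC; ring.
Qed.

Lemma ev3_qform z b W : transc (@constx K) z -> szle W N.+1 ->
  ev3 (constxy z) b (qform W) =
  constxy (den P z ^+ N) * quadv (map_mx (@constxy K) (evpm (Mx P z) W)) b.
Proof.
move=> tz hW; rewrite /qform formD.
rewrite ev3D ev3D (ev3M _ _ (form P N (W 0 0))) (ev3M _ _ (_ + _)).
rewrite (ev3M _ _ (form P N (W 1 1))) ev3D ev3M !ev3Xn ev3X1 ev3X2.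
rewrite (ev3_form uP b tz (hW 0 0)) (ev3_form uP b tz (hW 0 1)).
rewrite (ev3_form uP b tz (hW 1 0)) (ev3_form uP b tz (hW 1 1)).
rewrite (constxyM _ (evp _ (W 0 0))) (constxyM _ (evp _ (W 0 1))).
rewrite (constxyM _ (evp _ (W 1 0))) (constxyM _ (evp _ (W 1 1))).
rewrite /quadv ![map_mx _ _ _ _]mxE.
exact: quadv_scale.
Qed.

Lemma evpM z p q : evp z (p * q) = evp z p * evp z q.
Proof. exact: rmorphM. Qed.

(** Splitting N as (N - 1) + 1 isolates a linear form in X_0 and X_2 that can be chosen at will. *)
Lemma form_mul p (e : {poly K}) : (size p <= N)%N ->
  (size e <= 2)%N -> form P N (p * e) = form P N.-1 p * form P 1 e.
Proof.
move=> hp he; have [->|p0] := eqVneq p 0.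
  by rewrite mul0r form0 /form big1 ?mul0r // => k _; rewrite coef0 scale0r.
have N0 : (0 < N)%N by apply: leq_trans hp; rewrite size_poly_gt0.
have hpe : (size (p * e)%R <= N.+1)%N.
  apply: leq_trans (size_polyMleq _ _) _; move: hp he.
  by move: (size p) (size e) => s t; lia.
have eN : (N.-1 + 1 = N)%N by rewrite addn1 prednK.
apply/subr0_eq; apply: (@chart_inj _ _ (N.-1 + 1)%N).
  apply: rpredB; first by rewrite eN; apply: form_homog.
  by apply: dhomogM; apply: form_homog.
have tx := @x_transc K; have hp' : (size p <= N.-1.+1)%N by rewrite prednK.
rewrite in_chartE ev3B (ev3M _ _ (form P N.-1 p)).
rewrite (ev3_form uP y tx hpe) (ev3_form uP y tx hp') (ev3_form uP y tx he).
apply/eqP; rewrite subr_eq0; apply/eqP; rewrite -constxyM.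
apply: (congr1 (@constxy K)); rewrite evpM -{1}(prednK N0) exprS; exact: mul_form.
Qed.

End QuadForms.

Lemma quadv_map (K : closedFieldType) (F : fieldType) (phi : {rmorphism {poly K} -> F})
    n (w : 'I_n.+1 -> 'M[{poly K}]_2) (W A : 'M[{poly K}]_2) (D m : {poly K})
    (c : 'I_n.+1 -> K) b :
  D *: (A^T *m W *m A) = m *: lincomb w c ->
  phi (A 1 0) * b + phi (A 1 1) != 0 ->
  (phi D * (phi (A 1 0) * b + phi (A 1 1)) ^+ 2) *
    quadv (map_mx phi W) ((phi (A 0 0) * b + phi (A 0 1)) /
                          (phi (A 1 0) * b + phi (A 1 1))) =
  phi m * \sum_j phi (c j)%:P * quadv (map_mx phi (w j)) b.
Proof.
move=> e d0.
have := congr1 (fun W => quadv (map_mx phi W) b) e.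
rewrite /lincomb !map_mxZ !map_mxM -map_trmx !quadvZ quadv_conj; last by rewrite !mxE.
rewrite map_mx_sum quadv_sum ![map_mx phi A _ _]mxE mulrA => ->; congr (_ * _).
by apply: eq_bigr => j _; rewrite map_mxZ quadvZ.
Qed.

Section LinearAction.
Variables (K : closedFieldType) (P : 'M[K]_2) (N : nat).
Hypothesis uP : P \in unitmx.
Notation x := (xcoord K).
Notation y := (ycoord K).
Notation P2 := (projspace K 2).
Notation Mx := (mob (@constx K)).
Notation My := (mob (@constxy K)).
Implicit Types (b : Kxy K) (p q : {poly K}) (z : Kx K) (f g : Cr2 K)
  (W : 'M[{poly K}]_2).

Definition evpxy z p := constxy (evp z p).
HB.instance Definition _ z := GRing.RMorphism.copy (evpxy z) (@constxy K \o evp z).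

Lemma map_evpxy z W : map_mx (evpxy z) W = map_mx (@constxy K) (evpm z W).
Proof. by apply/matrixP => i j; rewrite !mxE. Qed.

Lemma evpxyC z c : evpxy z c%:P = constxy (constx c).
Proof. by rewrite /evpxy evpC. Qed.

Lemma evpxy_neq0 z p : transc (@constx K) z -> p != 0 -> evpxy z p != 0.
Proof. by move=> tz p0; rewrite fmorph_eq0 evp_neq0. Qed.

Lemma den_exp_neq0 z : transc (@constx K) z -> constxy (den P z ^+ N) != 0.
Proof. by move=> tz; rewrite fmorph_eq0 expf_neq0 // den_neq0 // P_det. Qed.

Definition qtuple n (w : 'I_n.+1 -> 'M[{poly K}]_2) : n.+1.-tuple {mpoly K[3]} :=
  [tuple qform P N (w i) | i < n.+1].

Lemma tnth_qtuple n (w : 'I_n.+1 -> 'M[{poly K}]_2) i :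
  tnth (qtuple w) i = qform P N (w i).
Proof. exact: tnth_mktuple. Qed.

Lemma qtuple_homog n (w : 'I_n.+1 -> 'M[{poly K}]_2) i :
  tnth (qtuple w) i \is N.+2.-homog.
Proof. by rewrite tnth_qtuple qform_homog. Qed.

Lemma in_chart_qtuple n (w : 'I_n.+1 -> 'M[{poly K}]_2) (L : 'M[K]_n.+1) i :
  (forall i, szle (w i) N.+1) ->
  in_chart (tnth (comp_tuple (lin_tuple L) (qtuple w)) i) =
  constxy (den P x ^+ N) * \sum_j evpxy (Mx P x) (L i j)%:P *
    quadv (map_mx (evpxy (Mx P x)) (w j)) y.
Proof.
move=> hw; rewrite comp_lin_tuple in_chartE rmorph_sum mulr_sumr.
apply: eq_bigr => j _; rewrite -[LHS]/(ev3 _ _ _) (ev3Z _ _ (L i j)) tnth_qtuple.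
rewrite (ev3_qform uP y (@x_transc K) (hw j)) -map_evpxy evpxyC.
exact: mulrCA.
Qed.

(** Evaluated at y, [quad_inv] says that the values of the w_i at the image point are those of the
    combinations given by L at the original point, up to a factor independent of i. The cross
    products of the two tuples thus vanish in the chart, hence identically by [chart_inj]. *)
Lemma quad_linear_on n (w : 'I_n.+1 -> 'M[{poly K}]_2) (D u : {poly K})
    (M : 'M[K]_2) (A : 'M[{poly K}]_2) f :
  (forall i, szle (w i) N.+1) -> D != 0 -> size u = 2 ->
  \det M != 0 -> \det A != 0 ->
  (forall L : 'M[K]_n.+1, L \in unitmx ->
     exists i, ~~ vanishes P2 (tnth (comp_tuple (lin_tuple L) (qtuple w)) i)) ->
  evp (Mx P x) u = Mx P (Mx M x) -> quad_inv w D u A ->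
  chart f (constxy (Mx M x)) (My (evpm (Mx P x) A) y) ->
  linear_on (qtuple w) f.
Proof.
move=> hw D0 su M0 A0 hL eu [L uL eL] [F fF [F2 e0 e1]]; exists L => //.
have tx := @x_transc K; have ty := @y_transc K.
have P0 := P_det uP.
have tX := mob_transc P0 tx; have tM := mob_transc M0 tx.
have [d hF] := represents_homog fF.
pose X := Mx P x.
pose b' := My (evpm X A) y.
have W0 : in_chart (tnth F 2) ^+ N.+2 * constxy (den P (Mx M x) ^+ N) != 0.
  exact: (mulf_neq0 (expf_neq0 _ F2) (den_exp_neq0 tM)).
have ea i : in_chart (tnth (comp_tuple (qtuple w) F) i) =
    in_chart (tnth F 2) ^+ N.+2 * constxy (den P (Mx M x) ^+ N) *
    quadv (map_mx (evpxy X) (act u (w i))) b'.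
  transitivity (in_chart (tnth F 2) ^+ N.+2 *
      ev3 (constxy (Mx M x)) b' (tnth (qtuple w) i)).
    by rewrite tnth_mktuple /b' -e0 -e1; exact: (ev3_comp (qtuple_homog w i) F2).
  rewrite tnth_qtuple (ev3_qform uP b' tM (hw i)) map_evpxy evpm_act eu.
  exact: mulrA.
have S0 := den_exp_neq0 tx.
have d0 : evpxy X (A 1 0) * y + evpxy X (A 1 1) != 0 := fiber_den uP 1 A0 tx ty.
have k0 : evpxy X D * (evpxy X (A 1 0) * y + evpxy X (A 1 1)) ^+ 2 != 0.
  exact: (mulf_neq0 (evpxy_neq0 tX D0) (expf_neq0 _ d0)).
have Du0 : D \Po u != 0 by rewrite comp_poly_eq0 // su.
have m0 := evpxy_neq0 tX (mulf_neq0 A0 Du0).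
have e i := quadv_map (eL i) d0.
rewrite -(My_evpm P A x y) in e.
have [cross nz] := cross_from_scalars W0 S0 k0 m0 ea
  (fun i => in_chart_qtuple L i hw) e.
have LT : forall i, tnth (comp_tuple (lin_tuple L) (qtuple w)) i \is N.+2.-homog.
  by move=> i; rewrite comp_lin_tuple; apply: rpred_sum => j _; apply: dhomogZ;
    apply: qtuple_homog.
have FT i : tnth (comp_tuple (qtuple w) F) i \is (d * N.+2).-homog.
  by rewrite tnth_mktuple; apply: comp_dhomog => //; apply: qtuple_homog.
have [i Li] := hL L uL.
have Fi : ~~ vanishes P2 (tnth (comp_tuple (qtuple w) F) i).
  rewrite vanishes_P2; apply/eqP => Fi0.
  have : in_chart (tnth (comp_tuple (lin_tuple L) (qtuple w)) i) != 0.
    by apply: contraNneq Li => /(chart_inj (LT i)) ->; rewrite vanishes0.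
  by move/nz; rewrite Fi0 in_chartE rmorph0 eqxx.
have fF' : represents f (fwd (repr f)) by exists (repr f); rewrite ?reprK.
apply: (@same_map_trans _ _ _ _ _ (comp_tuple (qtuple w) F)).
  apply: (same_map_postcomp (qtuple_homog w) (represents_same_map fF' fF)).
  by exists i.
split; [by exists i | by exists i | move=> j k].
rewrite vanishes_P2; apply/eqP; apply: (@chart_inj _ _ (d * N.+2 + N.+2)%N).
  by apply: rpredB; apply: dhomogM.
rewrite in_chartE ev3B (ev3M _ _ (tnth _ j)) (ev3M _ _ (tnth _ k)).
by apply/eqP; rewrite subr_eq0; apply/eqP; exact: cross.
Qed.

Lemma form1 (a b : K) : form P 1 (a *: 'X + b%:P) =
  (a * P 0 0 + b * P 1 0) *: 'X_0 + (a * P 0 1 + b * P 1 1) *: 'X_2.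
Proof.
rewrite /form !big_ord_recl big_ord0 /= /bump /= !coefD !coefZ !coefX !coefC /=.
rewrite mulr0 mulr1 add0r addr0 subn0 expr0 expr1 mul1r mulr1 addr0.
by rewrite /lin_form -!mul_mpolyC !rmorphD !rmorphM /=; ring.
Qed.

Lemma linear_form_onto (a b : K) : exists2 e : {poly K}, (size e <= 2)%N &
  form P 1 e = a *: 'X_0 + b *: 'X_2.
Proof.
have P0 := P_det uP.
exists (((a * P 1 1 - b * P 1 0) / \det P) *: 'X + ((b * P 0 0 - a * P 0 1) / \det P)%:P).
  rewrite (leq_trans (size_polyD _ _)) // geq_max (leq_trans (size_scale_leq _ _)) ?size_polyX //.
  by rewrite (leq_trans (size_polyC_leq1 _)).
by rewrite form1; congr (_ *: _ + _ *: _); move: P0; rewrite det2E => P0; field.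
Qed.

Lemma qform_scaled (Q e00 e01 e11 : {poly K}) : (size Q <= N)%N ->
  (size e00 <= 2)%N -> (size e01 <= 2)%N -> (size e11 <= 2)%N ->
  qform P N (Q *: mx2 e00 e01 0 e11) = form P N.-1 Q *
    (form P 1 e00 * 'X_1 ^+ 2 + form P 1 e01 * ('X_1 * 'X_2) + form P 1 e11 * 'X_2 ^+ 2).
Proof.
move=> sQ s00 s01 s11; have [a b c d] := mx2E e00 e01 0 e11.
have E i j : (Q *: mx2 e00 e01 0 e11) i j = Q * mx2 e00 e01 0 e11 i j by rewrite mxE.
rewrite /qform !E a b c d mulr0 addr0 !form_mul //; ring.
Qed.

Lemma form_neq0 m p : (size p <= m.+1)%N -> p != 0 -> form P m p != 0.
Proof.
move=> sp p0; apply/eqP => f0.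
have := ev3_form uP y (@x_transc K) sp; rewrite f0 rmorph0.
have d0 : den P x != 0 := den_neq0 1 (P_det uP) (@x_transc K).
have e0 := evp_neq0 (mob_transc (P_det uP) (@x_transc K)) p0.
move/esym/eqP; rewrite fmorph_eq0; apply/negP.
exact: (mulf_neq0 (expf_neq0 _ d0) e0).
Qed.

(** Suitable E of degree at most 1 homogenise to X_0 X_2^2, X_1 X_2^2 and X_2^3, so multiples of all
    three coordinates by one form H lie in the linear system. *)
Lemma coord_matrix n (w : 'I_n.+1 -> 'M[{poly K}]_2) (Q : {poly K}) :
  Q != 0 -> (forall i, szle (w i) N.+1) ->
  (forall E, szle E 2 -> exists c, Q *: E = lincomb w c) ->
  exists H (C : 'M[K]_(3, n.+1)), H != 0 /\
    forall i, tnth (comp_tuple (lin_tuple C) (qtuple w)) i = H * 'X_i.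
Proof.
move=> Q0 hw hQ.
have mx2_szle (a b c d : {poly K}) : (size a <= 2)%N -> (size b <= 2)%N -> (size c <= 2)%N ->
    (size d <= 2)%N -> szle (mx2 a b c d) 2.
  move=> sa sb sc sd i j; have [ea eb ec ed] := mx2E a b c d.
  by case: (ord2P i) => ->; case: (ord2P j) => ->; rewrite ?ea ?eb ?ec ?ed.
have s0 : (size (0 : {poly K})%R <= 2)%N by rewrite size_poly0.
have sX : (size ('X : {poly K})%R <= 2)%N by rewrite size_polyX.
(* The span contains a matrix with entry Q X, and its members have degree at most N. *)
have sQ : (size Q <= N)%N.
  have [c /(congr1 (fun W : 'M[{poly K}]_2 => W 1 1))] :=
    hQ _ (mx2_szle 0 0 0 'X s0 s0 s0 sX).
  have [_ _ _ e] := mx2E 0 0 0 ('X : {poly K}).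
  rewrite [LHS]mxE e summxE => eQ; rewrite -ltnS -(size_mulX Q0) eQ.
  apply: (leq_trans (size_sum _ _ _)); apply/bigmax_leqP => l _.
  by rewrite mxE mul_polyC (leq_trans (size_scale_leq _ _)) ?hw.
have [e0 se0 f0] := linear_form_onto 1 0.
have [e2 se2 f2] := linear_form_onto 0 1.
rewrite scale1r scale0r addr0 in f0; rewrite scale1r scale0r add0r in f2.
have fz : form P 1 0 = 0 by apply: form0.
have [c0 h0] := hQ _ (mx2_szle 0 0 0 e0 s0 s0 s0 se0).
have [c1 h1] := hQ _ (mx2_szle 0 e2 0 0 s0 se2 s0 s0).
have [c2 h2] := hQ _ (mx2_szle 0 0 0 e2 s0 s0 s0 se2).
exists (form P N.-1 Q * 'X_2 ^+ 2).
exists (\matrix_(i < 3, j < n.+1) [tuple c0 j; c1 j; c2 j]`_i); split.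
  have fQ : form P N.-1 Q != 0.
    by apply: form_neq0 => //; apply: (leq_trans sQ); case: (N).
  by rewrite mulf_neq0 // expf_neq0 // mpolyX_neq0.
have row (i : 'I_3) c : (forall j, [tuple c0 j; c1 j; c2 j]`_i = c j) ->
    tnth (comp_tuple (lin_tuple (\matrix_(i < 3, j < n.+1) [tuple c0 j; c1 j; c2 j]`_i))
      (qtuple w)) i = qform P N (lincomb w c).
  move=> hc; rewrite comp_lin_tuple qform_lincomb; apply: eq_bigr => j _.
  by rewrite mxE hc tnth_qtuple.
move=> i; case: (ord3P i) => ->.
- by rewrite (row 0 c0) // -h0 qform_scaled // f0 fz; ring.
- by rewrite (row 1 c1) // -h1 qform_scaled // f2 fz; ring.
- by rewrite (row 2 c2) // -h2 qform_scaled // f2 fz; ring.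
Qed.

End LinearAction.

(** * Commuting projectivities of the base *)

Section NormalForm.
Variable K : closedFieldType.
Implicit Types (M T P : 'M[K]_2) (a b c d : K).

Lemma eigenrow M : exists2 v : 'rV[K]_2, v != 0 & exists a, v *m M = a *: v.
Proof.
have [|a ra] := closed_rootP (char_poly M) _; first by rewrite size_char_poly.
have /eigenvalueP[v ev v0] : eigenvalue M a by rewrite eigenvalue_root_char.
by exists v => //; exists a.
Qed.

Lemma row_prop (v w : 'rV[K]_2) : v != 0 ->
  v 0 0 * w 0 1 = v 0 1 * w 0 0 -> exists d, w = d *: v.
Proof.
move=> v0 e.
have e2 (d : K) : d * v 0 0 = w 0 0 -> d * v 0 1 = w 0 1 -> w = d *: v.
  by move=> a b; apply/rowP => i; rewrite mxE; case: (ord2P i) => ->.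
have [v00|v00] := eqVneq (v 0 0) 0; last first.
  exists (w 0 0 / v 0 0); apply: e2; first by rewrite divfK.
  by apply: (mulfI v00); rewrite e; field.
have v01 : v 0 1 != 0.
  by apply: contraNneq v0 => v01; apply/eqP/rowP => i; rewrite mxE; case: (ord2P i) => ->.
exists (w 0 1 / v 0 1); apply: e2; last by rewrite divfK.
rewrite v00 mulr0; apply: (mulfI v01); rewrite mulr0 -e v00 mul0r //.
Qed.

Definition noscalar M := forall a, M != a%:M.

(** If v and v M_2 were independent, M_1 would multiply both by the same eigenvalue and be
    scalar. *)
Lemma common_eigenrow M1 M2 : noscalar M1 -> M1 *m M2 = M2 *m M1 ->
  exists2 v : 'rV[K]_2, v != 0 &
    exists a b, v *m M1 = a *: v /\ v *m M2 = b *: v.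
Proof.
move=> ns com; have [v v0 [a va]] := eigenrow M1; exists v => //; exists a.
pose B : 'M[K]_2 := \matrix_(i, j) (if i == 0 then v 0 j else (v *m M2) 0 j).
have r0 : row 0 B = v by apply/rowP => j; rewrite !mxE.
have r1 : row 1 B = v *m M2 by apply/rowP => j; rewrite !mxE.
have BM : B *m M1 = a *: B.
  apply/row_matrixP => i; rewrite row_mul linearZ /=; case: (ord2P i) => ->.
    by rewrite r0.
  by rewrite r1 -mulmxA -com mulmxA va scalemxAl.
have B0 : \det B = 0.
  apply/eqP; apply: contraTT isT => B0; have /negP := ns a; case.
  have uB : B \in unitmx by rewrite unitmxE unitfE.
  by rewrite -[M1](mulKmx uB) BM -scalemxAr mulVmx // scalemx1.
have [|b vb] := @row_prop v (v *m M2) v0; last by exists b.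
by move: B0; rewrite det2E -!r1 -[in v 0 _]r0; rewrite !mxE /= => /subr0_eq ->.
Qed.

Lemma complete_row (v : 'rV[K]_2) : v != 0 -> exists2 P, P \in unitmx & row 1 P = v.
Proof.
move=> v0; have [v00|v00] := eqVneq (v 0 0) 0.
  have v01 : v 0 1 != 0.
    by apply: contraNneq v0 => v01; apply/eqP/rowP => i; rewrite mxE; case: (ord2P i) => ->.
  have [a b c d] := mx2E 1 0 (v 0 0) (v 0 1).
  exists (mx2 1 0 (v 0 0) (v 0 1)); first by rewrite unitmxE unitfE det2E a b c d mul1r mul0r subr0.
  by apply/rowP => i; rewrite mxE; case: (ord2P i) => ->.
have [a b c d] := mx2E 0 1 (v 0 0) (v 0 1).
exists (mx2 0 1 (v 0 0) (v 0 1)).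
  by rewrite unitmxE unitfE det2E a b c d mul0r mul1r sub0r oppr_eq0.
by apply/rowP => i; rewrite mxE; case: (ord2P i) => ->.
Qed.

Lemma triangular_form P M a : P \in unitmx -> \det M != 0 ->
  row 1 P *m M = a *: row 1 P -> exists p q,
  [/\ a != 0, p != 0 & P *m M = a *: mx2 p q 0 1 *m P].
Proof.
move=> uP M0 ra; pose T := P *m M *m invmx P.
have eT : P *m M = T *m P by rewrite mulmxKV.
have /rowP r1 : row 1 T = a *: row 1 1%:M.
  by rewrite !row_mul ra -scalemxAl -row_mul mulmxV.
have rE j : T 1 j = a * (1%:M : 'M[K]_2) 1 j.
  by have := r1 j; rewrite [LHS]mxE [RHS]mxE [row 1 1%:M _ _]mxE.
have t10 : T 1 0 = 0 by rewrite rE mxE mulr0.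
have t11 : T 1 1 = a by rewrite rE mxE mulr1.
have : \det T != 0.
  have P0 : \det P != 0 by rewrite -unitfE -unitmxE.
  by rewrite -(inj_eq (mulIf P0)) mul0r -det_mulmx -eT det_mulmx mulf_neq0.
rewrite det2E t10 t11 mulr0 subr0 mulf_eq0 negb_or => /andP[t00 a0].
exists (T 0 0 / a), (T 0 1 / a); split => //; first by rewrite mulf_neq0 ?invr_eq0.
rewrite eT; congr (_ *m _); have [e1 e2 e3 e4] := mx2E (T 0 0 / a) (T 0 1 / a) 0 1.
by apply/mx2P; rewrite [RHS]mxE ?e1 ?e2 ?e3 ?e4 ?t10 ?t11 ?mulr0 ?mulr1 // mulrC divfK.
Qed.

(** In the base coordinate P x, the map of M reads X -> a X + c. *)
Definition conj_affine P M a c :=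
  a != 0 /\ exists2 d, d != 0 & P *m M = d *: mx2 a c 0 1 *m P.

Lemma conj_affine1 P : conj_affine P 1 1 0.
Proof.
split; first exact: oner_neq0.
exists 1; first exact: oner_neq0.
have [e1 e2 e3 e4] := mx2E (1 : K) 0 0 1.
have -> : mx2 (1 : K) 0 0 1 = 1%:M by apply/mx2P; rewrite ?e1 ?e2 ?e3 ?e4 mxE.
by rewrite scale1r mul1mx mulmx1.
Qed.

Lemma mul_affine a b c d : mx2 a c 0 1 *m mx2 b d 0 1 = mx2 (a * b) (a * d + c) 0 1.
Proof.
have [a1 a2 a3 a4] := mx2E a c 0 1; have [b1 b2 b3 b4] := mx2E b d 0 1.
have [c1 c2 c3 c4] := mx2E (a * b) (a * d + c) 0 1.
by apply/mx2P; rewrite mulmx2E ?(a1, a2, a3, a4, b1, b2, b3, b4) ?(c1, c2, c3, c4); ring.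
Qed.

Lemma conj_affineM P M M' a b c d : conj_affine P M a c -> conj_affine P M' b d ->
  conj_affine P (M *m M') (a * b) (a * d + c).
Proof.
case=> a0 [l l0 eM] [b0 [l' l'0 eM']]; split; first by rewrite mulf_neq0.
exists (l * l'); first by rewrite mulf_neq0.
rewrite mulmxA eM -mulmxA eM' mulmxA -scalemxAl -scalemxAr mul_affine scalerA.
by [].
Qed.

Lemma conj_affine_exp_scale P M a i : conj_affine P M a 0 -> conj_affine P (M ^+ i) (a ^+ i) 0.
Proof.
move=> h; elim: i => [|i IH]; first exact: conj_affine1.
rewrite !exprS; have := conj_affineM h IH; rewrite mulr0 addr0.
exact.
Qed.

Lemma conj_affine_exp_translate P M c i : conj_affine P M 1 c -> conj_affine P (M ^+ i) 1 (c *+ i).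
Proof.
move=> h; elim: i => [|i IH]; first exact: conj_affine1.
rewrite exprS mulrSr; have := conj_affineM h IH; rewrite !mul1r; exact.
Qed.

Lemma conj_affine_uniq P M M' a c : P \in unitmx ->
  conj_affine P M a c -> conj_affine P M' a c -> exists2 k, k != 0 & M = k *: M'.
Proof.
move=> uP [_ [l l0 e]] [_ [l' l'0 e']]; exists (l / l'); first by rewrite mulf_neq0 ?invr_eq0.
rewrite -[M](mulKmx uP) -[M'](mulKmx uP) e e' -!scalemxAl -!scalemxAr scalerA.
by rewrite divfK.
Qed.

Lemma conj_affine_translate P M a c t : conj_affine P M a c ->
  conj_affine (mx2 1 t 0 1 *m P) M a (c + t - a * t).
Proof.
case=> a0 [l l0 e]; split=> //; exists l => //.
rewrite -mulmxA e -!scalemxAl -scalemxAr !mulmxA !mul_affine.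
by congr (_ *: (mx2 _ _ _ _ *m _)); ring.
Qed.

Lemma conj_affine_comm P M M' a b c d : P \in unitmx -> M *m M' = M' *m M ->
  \det M != 0 -> \det M' != 0 ->
  conj_affine P M a c -> conj_affine P M' b d -> a * d + c = b * c + d.
Proof.
move=> uP com M0 M'0 h h'; have [ab0 [l l0 e]] := conj_affineM h h'.
have [_ [l' l'0 e']] := conj_affineM h' h.
have /(can_inj (mulmxK uP)) E : l *: mx2 (a * b) (a * d + c) 0 1 *m P =
    l' *: mx2 (b * a) (b * c + d) 0 1 *m P by rewrite -e -e' com.
have [c1 c2 c3 c4] := mx2E (a * b) (a * d + c) 0 1.
have [d1 d2 d3 d4] := mx2E (b * a) (b * c + d) 0 1.
have := congr1 (fun M : 'M[K]_2 => M 1 1) E.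
rewrite [LHS]mxE [RHS]mxE c4 d4 !mulr1 => ll.
have := congr1 (fun M : 'M[K]_2 => M 0 1) E.
rewrite [LHS]mxE [RHS]mxE c2 d2 ll.
exact: (mulfI l'0).
Qed.

(** Commutation reads (a - 1) d = (b - 1) c. If a differs from 1, moving the fixed point of X -> a X
    + c to 0 kills both constants. If a = 1 and b differs from 1, then c = 0 and M would be
    scalar. *)
Lemma affine_normal_form M M' : noscalar M -> noscalar M' ->
  \det M != 0 -> \det M' != 0 -> M *m M' = M' *m M ->
  exists P a c b d, [/\ P \in unitmx, conj_affine P M a c, conj_affine P M' b d
    & (c = 0 /\ d = 0) \/ (a = 1 /\ b = 1)].
Proof.
move=> ns ns' M0 M'0 com.
have [v v0 [l [l' [e e']]]] := common_eigenrow ns com.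
have [P uP rP] := complete_row v0; rewrite -rP in e e'.
have [a [c [l0 a0 h]]] := triangular_form uP M0 e.
have [b [d [l'0 b0 h']]] := triangular_form uP M'0 e'.
have H : conj_affine P M a c by split => //; exists l.
have H' : conj_affine P M' b d by split => //; exists l'.
have cd := conj_affine_comm uP com M0 M'0 H H'.
have [a1|a1] := eqVneq a 1.
  have [b1|b1] := eqVneq b 1; first by exists P, a, c, b, d; split=> //; right.
  have c0 : c = 0.
    have nz : b - 1 != 0 by rewrite subr_eq0.
    by apply: (mulfI nz); move: cd; rewrite a1 => cd; apply: (eq_by_sub (esym cd)); ring.
  move: H; rewrite a1 c0 => H.
  have [k k0 eM] := conj_affine_uniq uP H (conj_affine1 P).
  by have := ns k; rewrite eM scalemx1 eqxx.
have nz : a - 1 != 0 by rewrite subr_eq0.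
pose t := c / (a - 1); exists (mx2 1 t 0 1 *m P), a, 0, b, 0.
have [e1 e2 e3 e4] := mx2E 1 t 0 1.
split; last by left.
- by rewrite unitmx_mul uP andbT unitmxE unitfE det2E e1 e2 e3 e4 mulr1 mulr0 subr0 oner_neq0.
- have := conj_affine_translate t H.
  by have -> : c + t - a * t = 0 by rewrite /t; field.
have := conj_affine_translate t H'.
have -> // : d + t - b * t = 0.
by apply: (mulfI nz); rewrite mulr0 /t; apply: (eq_by_sub cd); field.
Qed.

End NormalForm.

(** * Independent base maps *)

Section IndependentPowers.
Variable K : closedFieldType.
Implicit Types (M T P : 'M[K]_2) (a b c d : K) (u v : {poly K}).
Notation x := (xcoord K).
Notation Mx := (mob (@constx K)).

Definition indep_powers M M' := forall (i j i' j' : nat) k, k != 0 ->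
  M ^+ i *m M' ^+ j = k *: (M ^+ i' *m M' ^+ j') -> i = i' /\ j = j'.

Lemma sqr_mx2 M : M *m M = \tr M *: M - (\det M)%:M.
Proof.
have tE : \tr M = M 0 0 + M 1 1.
  by rewrite /mxtrace !big_ord_recl big_ord0 addr0; congr (_ + M _ _); apply: val_inj.
have E i j : (\tr M *: M - (\det M)%:M) i j = \tr M * M i j - \det M *+ (i == j).
  by rewrite !mxE.
by apply/mx2P; rewrite mulmx2E E tE det2E /= ?mulr1n ?mulr0n; ring.
Qed.

(** M is conjugate to c M, so their traces agree. If c is not 1, the trace vanishes and M^2 is
    scalar by Cayley-Hamilton ([sqr_mx2]), against independence. *)
Lemma indep_powers_commute M M' c : \det M != 0 -> \det M' != 0 ->
  indep_powers M M' -> M *m M' = c *: (M' *m M) -> M *m M' = M' *m M.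
Proof.
move=> M0 M'0 ind e; have uM' : M' \in unitmx by rewrite unitmxE unitfE.
have := congr1 (fun T => \tr (T *m invmx M')) e.
rewrite mulmxK // -scalemxAl mxtraceZ mxtrace_mulC mulmxA mulVmx // mul1mx => trM.
have [c1|c1] := eqVneq c 1; first by rewrite e c1 scale1r.
have tr0 : \tr M = 0.
  have nz : 1 - c != 0 by rewrite subr_eq0 eq_sym.
  by apply: (mulfI nz); rewrite mulr0 mulrBl mul1r -trM subrr.
have d0 : - \det M != 0 by rewrite oppr_eq0.
have [] // := ind 2%N 0%N 0%N 0%N _ d0.
rewrite !expr0 mulmx1 expr2 -[M * M]/(M *m M) sqr_mx2 tr0 scale0r sub0r mulmx1.
by rewrite -scaleN1r -scalemx1 scalerA mulN1r.
Qed.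

Lemma indep_powers_noscalar M M' : \det M != 0 -> \det M' != 0 ->
  indep_powers M M' -> noscalar M /\ noscalar M'.
Proof.
move=> M0 M'0 ind; split=> a; apply/eqP => e.
  have a0 : a != 0 by apply: contraNneq M0 => a0; rewrite e a0 det_scalar expr0n.
  by have [] // := ind 1%N 0%N 0%N 0%N _ a0; rewrite expr1 !expr0 !mulmx1 e scalemx1.
have a0 : a != 0 by apply: contraNneq M'0 => a0; rewrite e a0 det_scalar expr0n.
by have [] // := ind 0%N 1%N 0%N 0%N _ a0; rewrite expr1 !expr0 !mul1mx e scalemx1.
Qed.

Lemma evp_affine (z : Kx K) a c : evp z (a *: 'X + c%:P) = constx a * z + constx c.
Proof.
by rewrite /evp rmorphD /= map_polyZ map_polyX map_polyC hornerD hornerZ hornerX hornerC.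
Qed.

Lemma conj_affine_mob P M a c : P \in unitmx -> \det M != 0 -> conj_affine P M a c ->
  evp (Mx P x) (a *: 'X + c%:P) = Mx P (Mx M x).
Proof.
move=> uP M0 [a0 [d d0 e]]; have P0 := P_det uP; have tx := @x_transc K.
have [e1 e2 e3 e4] := mx2E a c 0 1.
have T0 : \det (mx2 a c 0 1) != 0 by rewrite det2E e1 e2 e3 e4 mulr1 mulr0 subr0.
have dT0 : \det (d *: mx2 a c 0 1) != 0 by rewrite detZ mulf_neq0 // expf_neq0.
rewrite (mob_comp P0 M0 tx) e -(mob_comp dT0 P0 tx) (mob_scale _ _ _ d0) [RHS]mobE e1 e2 e3 e4.
by rewrite rmorph1 rmorph0 mul0r add0r divr1 evp_affine.
Qed.

Lemma indep_powers_normal_form M M' c : \det M != 0 -> \det M' != 0 ->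
  indep_powers M M' -> M *m M' = c *: (M' *m M) ->
  exists P u v, [/\ P \in unitmx, affine_indep u v,
    evp (Mx P x) u = Mx P (Mx M x) & evp (Mx P x) v = Mx P (Mx M' x)].
Proof.
move=> M0 M'0 ind e; have com := indep_powers_commute M0 M'0 ind e.
have [ns ns'] := indep_powers_noscalar M0 M'0 ind.
have [P [a [s [b [t [uP h h' cases]]]]]] := affine_normal_form ns ns' M0 M'0 com.
exists P, (a *: 'X + s%:P), (b *: 'X + t%:P); split=> //; last first.
- exact: conj_affine_mob.
- exact: conj_affine_mob.
case: cases => [[s0 t0]|[a1 b1]].
  left; exists a, b; rewrite s0 t0 polyC0 !addr0; split=> //; [by case: h|by case: h'|].
  rewrite s0 in h; rewrite t0 in h'; move=> i j i' j' eq.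
  have H := conj_affineM (conj_affine_exp_scale i h) (conj_affine_exp_scale j h').
  have H' := conj_affineM (conj_affine_exp_scale i' h) (conj_affine_exp_scale j' h').
  rewrite eq !mulr0 !addr0 in H H'.
  by have [k k0 /ind] := conj_affine_uniq uP H H'; apply.
right; exists s, t; rewrite a1 b1 !scale1r; split=> // i j i' j' eq.
rewrite a1 in h; rewrite b1 in h'.
have H := conj_affineM (conj_affine_exp_translate i h) (conj_affine_exp_translate j h').
have H' := conj_affineM (conj_affine_exp_translate i' h) (conj_affine_exp_translate j' h').
rewrite !mul1r addrC eq in H; rewrite !mul1r addrC in H'.
by have [k k0 /ind] := conj_affine_uniq uP H H'; apply.
Qed.

End IndependentPowers.

(** * Action on the base and on the fibres *)

Section JonquieresCharts.
Variable K : closedFieldType.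
Notation x := (xcoord K).
Notation y := (ycoord K).
Notation Mx := (mob (@constx K)).
Notation My := (mob (@constxy K)).
Implicit Types (f g : Cr2 K) (M : 'M[K]_2).

Definition jonq_chart_over f M := \det M != 0 /\
  exists2 N : 'M[Kx K]_2, \det N != 0 & chart f (constxy (Mx M x)) (My N y).

Lemma Jonq_chart f : Jonq f -> exists M, jonq_chart_over f M.
Proof.
case=> M [N [uM uN h]]; exists M; split; first by rewrite -unitfE -unitmxE.
by exists N; [rewrite -unitfE -unitmxE | apply: jonq_chart].
Qed.

Lemma jonq_chart_base_action f M : jonq_chart_over f M -> base_action f M.
Proof.
case=> M0 [N N0 h]; split; first by rewrite unitmxE unitfE.
by exists N; [rewrite unitmxE unitfE | apply: chart_jonq].
Qed.

Lemma jonq_chart_poly P f M : P \in unitmx -> jonq_chart_over f M ->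
  exists2 A : 'M[{poly K}]_2, \det A != 0 &
    chart f (constxy (Mx M x)) (My (evpm (Mx P x) A) y).
Proof.
move=> uP [_ [N N0 h]]; have [A [c [c0 A0 eA]]] := poly_matrix uP N0.
exists A; first exact: A0.
rewrite eA (mob_scale (@constxy K) N y c0); exact: h.
Qed.

Lemma jonq_chart1 : jonq_chart_over 1%g 1%:M.
Proof.
split; first by rewrite det1 oner_neq0.
exists 1%:M; first by rewrite det1 oner_neq0.
rewrite !mob1; exact: chart_id.
Qed.

Lemma det_evpm_neq0 z (A : 'M[{poly K}]_2) : transc (@constx K) z ->
  \det A != 0 -> \det (evpm z A) != 0.
Proof. by move=> tz A0; rewrite det_evpm; apply: evp_neq0. Qed.

Lemma jonq_chartM f g M M' : jonq_chart_over f M -> jonq_chart_over g M' ->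
  jonq_chart_over (f * g)%g (M *m M').
Proof.
move=> hf [M'0 [N' N'0 hg]]; have M0 := proj1 hf.
have u1 : (1%:M : 'M[K]_2) \in unitmx by apply: unitmx1.
have [A A0 hA] := jonq_chart_poly u1 hf.
have tx := @x_transc K; have tM := mob_transc M'0 tx.
have ty := @y_transc K; have tN := mob_transc N'0 ty.
have t1 := mob_transc (P_det u1) tM.
split; first by rewrite det_mulmx mulf_neq0.
exists (evpm (Mx 1%:M (Mx M' x)) A *m N').
  by rewrite det_mulmx; apply: mulf_neq0 N'0; apply: det_evpm_neq0.
have := chart_compP u1 M0 A0 hA hg tM tN.
rewrite (mob_comp M0 M'0 tx).
by rewrite (mob_comp (det_evpm_neq0 t1 A0) N'0 ty).
Qed.

Lemma jonq_chartX f M i : jonq_chart_over f M -> jonq_chart_over (f ^+ i)%g (M ^+ i).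
Proof.
move=> h; elim: i => [|i IH]; first exact: jonq_chart1.
by rewrite expgS exprS; apply: jonq_chartM.
Qed.

Lemma jonq_chart_comm f g M M' : (f * g = g * f)%g ->
  jonq_chart_over f M -> jonq_chart_over g M' -> exists c, M *m M' = c *: (M' *m M).
Proof.
move=> com hf hg; have [MM0 [N N0 h]] := jonq_chartM hf hg.
have [MM'0 [N' N'0 h']] := jonq_chartM hg hf; rewrite com in h.
have [e _] := chart_uniq h' h; have e' := fmorph_inj (@constxy K) e.
have [c _ ->] := mob_inj MM'0 MM0 (@x_transc K) (@tofrac_transc2 K) e'.
by exists c.
Qed.

(** A nonzero entry of A and the matching entry of B serve as polynomial scalars. *)
Lemma evpm_prop z (A B : 'M[{poly K}]_2) (c : Kx K) : transc (@constx K) z ->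
  \det A != 0 -> c != 0 -> evpm z B = c *: evpm z A -> prop A B.
Proof.
move=> tz A0 c0 e.
have E i j : evp z (B i j) = c * evp z (A i j).
  by have := congr1 (fun T : 'M_2 => T i j) e; rewrite !mxE.
have [i [j Aij]] : exists i j, A i j != 0.
  have [a0|] := eqVneq (A 0 0) 0; last by exists 0, 0.
  exists 0, 1; apply: contraNneq A0 => b0.
  by rewrite det2E a0 b0 !mul0r subrr.
have eAij := evp_neq0 tz Aij.
have eBij : evp z (B i j) != 0 by rewrite E; exact: (mulf_neq0 c0 eAij).
have Bij : B i j != 0 by apply: contraNneq eBij => ->; rewrite rmorph0.
exists (B i j), (A i j); split=> //; apply: (evpm_inj tz).
apply/matrixP => k l; rewrite [LHS]mxE [RHS]mxE.
rewrite [(B i j *: A) k l]mxE [(A i j *: B) k l]mxE.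
rewrite (evpM _ (B i j)) (evpM _ (A i j)) (E i j) (E k l).
rewrite -mulrA; exact: mulrCA.
Qed.

End JonquieresCharts.

Section Commutation.
Variables (K : closedFieldType) (P : 'M[K]_2).
Hypothesis uP : P \in unitmx.
Notation x := (xcoord K).
Notation y := (ycoord K).
Notation Mx := (mob (@constx K)).
Notation My := (mob (@constxy K)).
Notation X := (mob (@constx K) P (xcoord K)).
Implicit Types (f g : Cr2 K) (M : 'M[K]_2) (A B : 'M[{poly K}]_2) (u v : {poly K}).

Lemma det_act_neq0 A v : size v = 2 -> \det A != 0 -> \det (act v A) != 0.
Proof. by move=> sv A0; rewrite det_act comp_poly_eq0 // sv. Qed.

Lemma chart_comp_poly f g M M' A B v : \det M != 0 -> \det M' != 0 ->
  \det A != 0 -> \det B != 0 -> size v = 2 -> evp X v = Mx P (Mx M' x) ->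
  chart f (constxy (Mx M x)) (My (evpm X A) y) ->
  chart g (constxy (Mx M' x)) (My (evpm X B) y) ->
  chart (f * g)%g (constxy (Mx M (Mx M' x))) (My (evpm X (act v A *m B)) y).
Proof.
move=> M0 M'0 A0 B0 sv ev hf hg.
have tx := @x_transc K; have tM := mob_transc M'0 tx.
have ty := @y_transc K; have tX := mob_transc (P_det uP) tx.
have B'0 := det_evpm_neq0 tX B0; have tN := mob_transc B'0 ty.
have A'0 : \det (evpm X (act v A)) != 0.
  exact: (det_evpm_neq0 tX (det_act_neq0 sv A0)).
have := chart_compP uP M0 A0 hf hg tM tN.
by rewrite -ev -evpm_act (mob_comp A'0 B'0 ty) -evpmM.
Qed.

(** The chart expression of fg = gf is unique, and the fibre map determines its matrix up to a
    scalar. *)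
Lemma comm_prop f g M M' A B u v : (f * g = g * f)%g ->
  \det M != 0 -> \det M' != 0 -> \det A != 0 -> \det B != 0 ->
  size u = 2 -> size v = 2 ->
  evp X u = Mx P (Mx M x) -> evp X v = Mx P (Mx M' x) ->
  chart f (constxy (Mx M x)) (My (evpm X A) y) ->
  chart g (constxy (Mx M' x)) (My (evpm X B) y) ->
  prop (act v A *m B) (act u B *m A).
Proof.
move=> com M0 M'0 A0 B0 su sv eu ev hf hg.
have h := chart_comp_poly M0 M'0 A0 B0 sv ev hf hg.
have h' := chart_comp_poly M'0 M0 B0 A0 su eu hg hf.
rewrite com in h; have [_ e] := chart_uniq h h'.
have tX := mob_transc (P_det uP) (@x_transc K).
have AB0 : \det (act v A *m B) != 0.
  by rewrite det_mulmx; apply: mulf_neq0 (det_act_neq0 sv A0) B0.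
have BA0 : \det (act u B *m A) != 0.
  by rewrite det_mulmx; apply: mulf_neq0 (det_act_neq0 su B0) A0.
have [c c0 ec] := mob_inj (det_evpm_neq0 tX AB0) (det_evpm_neq0 tX BA0)
  (@y_transc K) (@tofrac_transc2 (Kx K)) e.
exact: (evpm_prop tX AB0 c0 ec).
Qed.

End Commutation.

Lemma Z2_generators (K : closedFieldType) (rho : int * int -> Cr2 K) :
  {morph rho : u v / u + v >-> (u * v)%g} ->
  [/\ rho 0 = 1%g, forall u, rho (- u) = (rho u)^-1%g
    & forall i j : nat, rho (i%:Z, j%:Z) = (rho (1, 0)%R ^+ i * rho (0, 1)%R ^+ j)%g].
Proof.
move=> rhoD; have rho0 : rho 0 = 1%g.
  by apply: (mulgI (rho 0)); rewrite -rhoD addr0 mulg1.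
split=> // [u|i j].
  by apply: (mulgI (rho u)); rewrite -rhoD subrr mulgV.
have e1 : rho (i%:Z, 0) = (rho (1, 0)%R ^+ i)%g.
  elim: i => [|i IH]; first exact: rho0.
  by rewrite expgS -IH -rhoD; congr rho.
have e2 : rho (0, j%:Z) = (rho (0, 1)%R ^+ j)%g.
  elim: j => [|j IH]; first exact: rho0.
  by rewrite expgS -IH -rhoD; congr rho.
by rewrite -e1 -e2 -rhoD; congr rho; congr (_, _); rewrite ?addr0 ?add0r.
Qed.

Lemma Z2_ind (K : closedFieldType) (rho : int * int -> Cr2 K) (Q : Cr2 K -> Prop) :
  {morph rho : u v / u + v >-> (u * v)%g} ->
  (forall f g, Q f -> Q g -> Q (f * g)%g) -> (forall f, Q f -> Q (f^-1)%g) ->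
  Q (rho (1, 0)) -> Q (rho (0, 1)) -> forall u, Q (rho u).
Proof.
move=> rhoD QM QV Qf Qg; have [_ rhoN rhoE] := Z2_generators rhoD.
have Q1 : Q 1%g by rewrite -(mulgV (rho (1, 0))); apply/QM/QV.
have QX h i : Q h -> Q (h ^+ i)%g.
  by move=> Qh; elim: i => [|i IH]; rewrite ?expg0 ?expgS; [exact: Q1 | exact: QM].
have Qnat i j : Q (rho (Posz i, Posz j)) by rewrite rhoE; apply: QM; apply: QX.
have QN u : Q (rho u) -> Q (rho (- u)) by rewrite rhoN; apply: QV.
have Q0 i (b : bool) : Q (rho (if b then (i, 0) else (0, i))).
  case: b; case: (intP i) => [|k|k]; rewrite ?NegzE; try exact: (Qnat 0%N 0%N).
  - exact: (Qnat k.+1 0%N).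
  - exact: (QN (Posz k.+1, 0) (Qnat k.+1 0%N)).
  - exact: (Qnat 0%N k.+1).
  - exact: (QN (0, Posz k.+1) (Qnat 0%N k.+1)).
case=> i j; have -> : (i, j) = (i, 0) + (0, j).
  by congr (_, _); rewrite ?addr0 ?add0r.
by rewrite rhoD; apply: QM; [exact: (Q0 i true) | exact: (Q0 j false)].
Qed.

Theorem corollary1p4 (K : closedFieldType) (G : {pred Cr2 K})
    (subgroupG : group_closed G)
    (jonqG : forall f, f \in G -> Jonq f)
    (isoG : isomorphic_Z2 G)
    (faithfulG : faithful_on_base G) :
  elliptic_subgroup G.
Proof.
have [rho [rho_inj rhoD rhoG]] := isoG.
have Grho u : rho u \in G by apply/rhoG; exists u.
have [_ _ rhoE] := Z2_generators rhoD.
have [M hM] := Jonq_chart (jonqG _ (Grho (1, 0))).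
have [M' hM'] := Jonq_chart (jonqG _ (Grho (0, 1))).
have com : (rho (1, 0)%R * rho (0, 1)%R = rho (0, 1)%R * rho (1, 0)%R)%g.
  by rewrite -!rhoD addrC.
have M0 := proj1 hM; have M'0 := proj1 hM'.
have [c ec] := jonq_chart_comm com hM hM'.
(* Two monomials in M and M' with the same class in PGL_2 belong, by faithfulness, to one element of
   G, and [rho] is injective. *)
have ind : indep_powers M M'.
  move=> i j i' j' k k0 e.
  have H := jonq_chartM (jonq_chartX i hM) (jonq_chartX j hM').
  have H' := jonq_chartM (jonq_chartX i' hM) (jonq_chartX j' hM').
  rewrite -!rhoE in H H'.
  have /rho_inj[-> ->] // : rho (i'%:Z, j'%:Z) = rho (i%:Z, j%:Z).
  apply: (faithfulG _ _ _ _ (Grho _) (Grho _) (jonq_chart_base_action H')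
    (jonq_chart_base_action H)).
  by exists k.
have [P [u [v [uP uv eu ev]]]] := indep_powers_normal_form M0 M'0 ind ec.
have [su sv] := affine_indep_size uv.
have [A A0 hA] := jonq_chart_poly uP hM.
have [B B0 hB] := jonq_chart_poly uP hM'.
have AB := comm_prop uP com M0 M'0 A0 B0 su sv eu ev hA hB.
have [N [n [w [D [Q [[D0 Q0 hw] [hQ qA qB]]]]]]] := invariant_span uv A0 B0 AB.
have [H [C [H0 hC]]] := coord_matrix uP Q0 hw hQ.
have hS := qtuple_homog P N w.
have nz := lin_tuple_neq0 H0 hC.
apply: (elliptic_criterion subgroupG hS H0 hC) => _ /rhoG[t <-].
(* The maps acting linearly through the tuple are closed under products and inverses, so the two
   generators suffice. *)
apply: (@Z2_ind _ _ (linear_on (qtuple P N w)) rhoD).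
- exact: (linear_on_mul hS H0 hC).
- exact: (linear_on_inv hS H0 hC).
- exact: (quad_linear_on uP hw D0 su M0 A0 nz eu qA hA).
exact: (quad_linear_on uP hw D0 sv M'0 B0 nz ev qB hB).
Qed.
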